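(* Given $q\in(1,\infty)$, $\delta>0$ and $D_0\in\mathbb{N}$, there are $\varepsilon>0$ and $D\ge D_0$ such that the following holds for all sufficiently large $\ell\in\mathbb{N}$. Let $m=\ell D$ and let $\mu,\nu$ be $2^{-m}$-measures with $\|\mu*\nu\|_q\ge2^{-\varepsilon m}\|\mu\|_q$ (convolution on $\mathbb{R}/\mathbb{Z}$). Then, after translating $\mu$ and $\nu$ (each by some number of the form $k2^{-m}$, on the circle), there exist sets $A\subset\operatorname{supp}\mu$, $B\subset\operatorname{supp}\nu$ such that: (A-i) $\|\mu|_A\|_q\ge2^{-\delta m}\|\mu\|_q$; (A-ii) $\mu(y)\le2\mu(x)$ for all $x,y\in A$; (A-iii) there is a sequence $(R'_s)_{s\in[\ell]}$ with $\mathcal{N}_{(s+1)D}(A\cap I)=R'_s$ for all $s\in[\ell]$ and all $I\in\mathcal{D}_{sD}(A)$; (A-iv) $x\in\frac12\mathcal{D}_{sD}(x)$ for all $x\in A$, $s\in[\ell]$; (B-i) $\nu(B)\ge2^{-\delta m}$; (B-ii) $\nu(y)\le2\nu(x)$ for all $x,y\in B$; (B-iii) there is a sequence $(R''_s)_{s\in[\ell]}$ with $\mathcal{N}_{(s+1)D}(B\cap I)=R''_s$ for all $s\in[\ell]$ and all $I\in\mathcal{D}_{sD}(B)$; (B-iv) $y\in\frac12\mathcal{D}_{sD}(y)$ for all $y\in B$, $s\in[\ell]$. Moreover: (v) for each $s\in[\ell]$, either $R''_s=1$ or $R'_s\ge2^{(1-\delta)D}$; and (vi) if $\mathcal{S}$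 is the set of $s\in[\ell]$ with $R'_s\ge 2^{(1-\delta)D}$, then \[ \log(\|\nu\|_q^{-q'})-\delta m\le D|\mathcal{S}|\le\log(\|\mu\|_q^{-q'})+\delta m. \]
   Context: Logarithms base 2. $[\ell]=\{0,1,\dots,\ell-1\}$. A $2^{-m}$-measure is a probability measure supported on $2^{-m}\mathbb{Z}\cap[0,1)$, identified with points of $\mathbb{R}/\mathbb{Z}$. For a purely atomic measure $\mu$, $\|\mu\|_q=(\sum_y\mu(y)^q)^{1/q}$; $q'=q/(q-1)$. $\mathcal{D}_s$ is the family of dyadic intervals $[j2^{-s},(j+1)2^{-s})$; $\mathcal{D}_s(E)$ is the set of those meeting $E$; $\mathcal{N}_s(E)=|\mathcal{D}_s(E)|$; $\mathcal{D}_s(x)$ is the element of $\mathcal{D}_s$ containing $x$; $\frac12I$ is the interval with the same center as $I$ and half its length. $\mu|_A$ is the restriction of $\mu$ to $A$. *)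

(* Defs.v *)
From Stdlib Require Import Reals.
From mathcomp Require Import all_boot.
Local Open Scope R_scope.
Set Implicit Arguments. Unset Strict Implicit. Unset Printing Implicit Defensive.

Lemma pos2m (m : nat) : (0 < 2 ^ m)%N.
Proof. by rewrite expn_gt0. Qed.

(* Points of 2^{-m}Z ∩ [0,1) are indexed by i : 'I_(2^m), the point being i/2^m. *)
Definition modI (m : nat) (x : nat) : 'I_(2 ^ m) := Ordinal (ltn_pmod x (pos2m m)).

Definition rsum (T : finType) (A : {pred T}) (F : T -> R) : R :=
  \big[Rplus/R0]_(i in A) F i.

Definition measure2 (m : nat) (mu : 'I_(2 ^ m) -> R) : Prop :=
  (forall i, 0 <= mu i) /\ rsum [set: 'I_(2 ^ m)] mu = 1.

Definition rpow (x q : R) : R :=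
  if Req_EM_T x 0 then 0 else Rpower x q.

Definition lqnorm_on (m : nat) (q : R) (mu : 'I_(2 ^ m) -> R) (A : {set 'I_(2 ^ m)}) : R :=
  rpow (rsum A (fun i => rpow (mu i) q)) (1 / q).
Definition lqnorm (m : nat) (q : R) (mu : 'I_(2 ^ m) -> R) : R :=
  lqnorm_on q mu [set: 'I_(2 ^ m)].

Definition mass (m : nat) (mu : 'I_(2 ^ m) -> R) (A : {set 'I_(2 ^ m)}) : R :=
  rsum A mu.

Definition conv (m : nat) (mu nu : 'I_(2 ^ m) -> R) (k : 'I_(2 ^ m)) : R :=
  rsum [set: 'I_(2 ^ m)] (fun j => mu j * nu (modI m (k + (2 ^ m - j))%N)).

Definition transl (m : nat) (t : 'I_(2 ^ m)) (mu : 'I_(2 ^ m) -> R) : 'I_(2 ^ m) -> R :=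
  fun i => mu (modI m (i + (2 ^ m - t))%N).

(* index j of the dyadic interval D_r(i/2^m) = [j 2^{-r}, (j+1) 2^{-r}), for r <= m *)
Definition blk (m r i : nat) : nat := (i %/ 2 ^ (m - r))%N.

Definition Ncount (m r : nat) (A : {set 'I_(2 ^ m)}) : nat :=
  size (undup [seq blk m r (val a) | a <- enum A]).

Definition cap_blk (m r : nat) (A : {set 'I_(2 ^ m)}) (a : 'I_(2 ^ m)) : {set 'I_(2 ^ m)} :=
  [set b in A | blk m r b == blk m r a].

(* i/2^m ∈ (1/2) D_r(i/2^m), the half interval taken half-open
   [j2^{-r} + 2^{-r}/4, j2^{-r} + 3*2^{-r}/4) *)
Definition in_half (m r i : nat) : bool :=
  let d := (2 ^ (m - r))%N in
  let rr := i %% d in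
  ((d <= 4 * rr) && (4 * rr < 3 * d))%N.

Definition Rleb (x y : R) : bool := if Rle_dec x y then true else false.

Definition log2 (x : R) : R := (ln x / ln 2).

Definition pow2R (x : R) : R := Rpower 2 x.

(* Main.v *)
Require Import Defs.
From HB Require Import structures.
From Stdlib Require Import Reals Lra.
From mathcomp Require Import all_boot.
From mathcomp Require Import boolp zify.

(** The L^q norm of [mu * nu] is expanded as a sum over pairs [(w, y)] of a weight
[nu y * gm a (mu (w - y) ^ q) ((mu * nu) w ^ q)] with [a = 1 / q]: for each [y] this is a Hoelder
sum along the tree of dyadic blocks of [b * D] scales in [w].  The hypothesis says that it loses
little, so an exponential moment estimate shows that, along most of the tree, the translate by [y]
of [mu ^ q] and the function [(mu * nu) ^ q] are nearly proportional on the cells of a block.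

Fix a block and let [sg] be the smallest shift between two such [y], of size about
[2 ^ (- tau * D)] relative to the block.  Proportionality for two shifts [y] and [y + sg] makes the
[mu ^ q]-mass of windows of length [sg] almost monotone in their position, so a window of that
length around a typical point carries a share of the block at most about [2 ^ (- (tau - 3) * D)]:
the support of [mu] branches fully on the first [tau] scales.  By minimality of [sg] the admissible
[y] do not branch on the remaining ones.  Pigeonholing over the sequence of types [tau], over dyadic
values of [mu] and [nu] and over translations keeping the points central in their dyadic intervals
produces [A] and [B]; regularising their trees and thinning the levels gives the branching numbers. *)

Set Implicit Arguments. Unset Strict Implicit. Unset Printing Implicit Defensive.

(** * Regular trees *)

(** Every loss has to stay below a small multiple of [m = l * D]. A block loses a bounded number of
    levels: one because the shift [sg] is known only up to a factor [2 ^ D], one because the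
    compared windows must stay inside the block, one to absorb absolute constants. Hence [b] levels
    are grouped in a block, with [b] large. The tolerance [eta] must be far below [2 ^ (- b * D)],
    so each failure of proportionality gains only a tiny factor in Hoelder's inequality; [eps] is
    therefore chosen after [b] and [D], small enough to confine failures to a small share of the
    blocks. The two sets arise asymmetrically. A type belongs to a block of [w], and non-branching
    compares two values of [y] seen from the same [w]: so [B] comes from the slice at one [w],
    whereas [A] collects the differences [w - y] of all selected pairs. The common label makes both
    obey the same types. The window bound controls masses of whole dyadic nodes; it becomes a count
    of branches because a regular tree with little branching could not retain the share of [mu ^ q]
    that [A] carries. *)

Lemma big_imset_fibers (T : Type) (idx : T) (op : Monoid.com_law idx) (V W : finType)
    (f g : V -> W) (A : {set V}) (F : W -> T) :
  (forall a b, f a = f b -> g a = g b) ->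
  \big[op/idx]_(u in f @: A) F u =
  \big[op/idx]_(k in g @: A) \big[op/idx]_(u in f @: [set b in A | g b == k]) F u.
Proof.
move=> fg; rewrite big_mkcond /=.
under [RHS]eq_bigr => k _ do rewrite big_mkcond /=.
rewrite [RHS]exchange_big /=; apply: eq_bigr => u _.
case: imsetP => [[a aA ->]|h]; last first.
  rewrite big1 // => k _; case: imsetP => // -[b]; rewrite inE => /andP[bA _] e.
  by case: h; exists b.
apply/esym; transitivity (\big[op/idx]_(k in g @: A) (if k == g a then F (f a) else idx)).
  apply: eq_bigr => k _; case: imsetP => [[b]|h].
    by rewrite inE => /andP[_ /eqP <-] /fg ->; rewrite eqxx.
  by case: eqP => // e; case: h; exists a; rewrite // inE aA e eqxx.
rewrite (bigD1 (g a)) ?imset_f //= eqxx big1 ?Monoid.mulm1 // => k /andP[_ /negbTE ->] //.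
Qed.

Lemma card_imset_fibers (V W : finType) (f g : V -> W) (A : {set V}) :
  (forall a b, f a = f b -> g a = g b) ->
  #|f @: A| = \sum_(k in g @: A) #|f @: [set b in A | g b == k]|.
Proof.
move=> fg; rewrite -sum1_card (big_imset_fibers _ _ _ fg); apply: eq_bigr => k _.
by rewrite sum1_card.
Qed.

Section Trees.
Variables (V W : finType) (key : nat -> V -> W) (l D : nat).
Hypothesis nest : forall s a b, s < l -> key s.+1 a = key s.+1 b -> key s a = key s b.
Hypothesis key0 : forall a b, key 0 a = key 0 b.
Hypothesis keyl : injective (key l).

Definition cap s (A : {set V}) a := [set b in A | key s b == key s a].
Definition children s (A : {set V}) a := key s.+1 @: cap s A a.
Definition regular_at s (A : {set V}) r := forall a, a \in A -> #|children s A a| = r.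

Hypothesis br_le : forall s (A : {set V}) a, s < l -> #|children s A a| <= 2 ^ D.

Lemma nest_le s s' a b : s <= s' -> s' <= l -> key s' a = key s' b -> key s a = key s b.
Proof.
move=> h; elim: s' h => [|s' IH] h hl; first by move: h; rewrite leqn0 => /eqP ->.
move: h; rewrite leq_eqVlt => /orP[/eqP -> //|h] e.
by apply: IH => //; [exact: ltnW|exact: nest e].
Qed.

Lemma children_eq s (A : {set V}) a b : key s a = key s b -> children s A a = children s A b.
Proof. by move=> e; rewrite /children /cap e. Qed.

Lemma nodes_step s (A : {set V}) r : s < l -> regular_at s A r ->
  #|key s.+1 @: A| = r * #|key s @: A|.
Proof.
move=> hs h; rewrite (@card_imset_fibers _ _ (key s.+1) (key s)); last by move=> a b; apply: nest.
rewrite mulnC -sum_nat_const; apply: eq_bigr => k /imsetP[a aA ->].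
exact: h.
Qed.

Lemma nodes_prod s (A : {set V}) (R : nat -> nat) : s <= l ->
  (forall s', s <= s' -> s' < l -> regular_at s' A (R s')) ->
  #|A| = #|key s @: A| * \prod_(s <= s' < l) R s'.
Proof.
move=> hs; rewrite -(subKn hs); move: (l - s) (leq_subr s l) => {s hs}.
elim=> [|j IH] hj h; first by rewrite subn0 big_geq // muln1 card_imset.
rewrite IH; last 2 first.
- exact: ltnW.
- by move=> s' h1 h2; apply: h => //; move: h1; clear; lia.
have hs : l - j.+1 < l by move: hj; clear; lia.
rewrite (@big_ltn _ _ _ (l - j.+1)) // (_ : (l - j.+1).+1 = l - j); last by move: hj; clear; lia.
rewrite -{1}(_ : (l - j.+1).+1 = l - j); last by move: hj; clear; lia.
by rewrite (nodes_step hs (h _ (leqnn _) hs)) mulnA (mulnC #|_|).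
Qed.

Lemma regular_card (A : {set V}) (R : nat -> nat) : 0 < #|A| ->
  (forall s, s < l -> regular_at s A (R s)) -> #|A| = \prod_(0 <= s < l) R s.
Proof.
move=> /card_gt0P[a aA] h; rewrite (@nodes_prod 0 A R) //; last by move=> s _; apply: h.
suff -> : key 0 @: A = [set key 0 a] by rewrite cards1 mul1n.
apply/setP => u; rewrite inE; apply/imsetP/eqP => [[b _ ->]|->]; [exact: key0|by exists a].
Qed.

Lemma regular_cap s s' (A : {set V}) a r : s <= s' -> s' < l ->
  regular_at s' A r -> regular_at s' (cap s A a) r.
Proof.
move=> h1 h2 h b /setIdP[bA /eqP e]; rewrite -(h b bA).
congr #|pred_of_set (_ @: pred_of_set _)|; apply/setP => c.
apply/setIdP/setIdP => -[hc e']; split => //; first by case/setIdP: hc.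
rewrite inE hc /= -e; apply/eqP/(nest_le h1 (ltnW h2)); exact/eqP.
Qed.

Lemma descendants s d (A : {set V}) (R : nat -> nat) a : s + d <= l -> a \in A ->
  (forall s', s <= s' -> s' < s + d -> regular_at s' A (R s')) ->
  #|key (s + d) @: cap s A a| = \prod_(s <= s' < s + d) R s'.
Proof.
move=> hd aA; elim: d hd => [|d IH] hd h.
  rewrite addn0 big_geq //; apply/eqP/cards1P; exists (key s a).
  apply/setP => u; rewrite inE; apply/imsetP/eqP => [[b /setIdP[_ /eqP ->]] //|->].
  by exists a; rewrite // inE aA /=.
rewrite addnS big_nat_recr ?leq_addr //= -IH; last 2 first.
- by move: hd; rewrite addnS => /ltnW.
- by move=> s' h1 h2; apply: h => //; rewrite addnS ltnW.
rewrite mulnC -nodes_step //; first by rewrite -addnS.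
by apply: regular_cap; rewrite ?leq_addr -?addnS //; apply: h; rewrite ?leq_addr // addnS.
Qed.

Definition sel (C : {set W}) k : {set W} := [set u in take k (enum C)].

Lemma card_sel (C : {set W}) k : k <= #|C| -> #|sel C k| = k.
Proof.
move=> h; rewrite cardsE (card_uniqP _) ?take_uniq ?enum_uniq // size_takel //.
by rewrite -cardE.
Qed.

Lemma sel_sub (C : {set W}) k u : u \in sel C k -> u \in C.
Proof. by rewrite inE => /mem_take; rewrite mem_enum. Qed.

(** Nodes of level [s] with fewer than [k] children are discarded. What is kept is cut out of [A]
    along whole nodes of level [s.+1], so the branching at deeper levels is untouched; when no node
    is discarded and [k] is positive, the shallower levels keep their branching too. *)
Definition select s (A : {set V}) k :=
  [set a in A | (k <= #|children s A a|) && (key s.+1 a \in sel (children s A a) k)].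

Lemma select_sub s (A : {set V}) k : select s A k \subset A.
Proof. by apply/subsetP => a; rewrite inE => /andP[]. Qed.

Lemma select_sat s (A : {set V}) k a b : s < l -> a \in select s A k -> b \in A -> key s.+1 a = key s.+1 b ->
  b \in select s A k.
Proof.
move=> hs; rewrite !inE => /andP[_ h] -> e /=.
by rewrite -(children_eq _ (nest hs e)) -e.
Qed.

Lemma select_children s (A : {set V}) k a : s < l -> a \in A -> k <= #|children s A a| ->
  children s (select s A k) a = sel (children s A a) k.
Proof.
move=> hs aA hk; apply/setP => u; apply/imsetP/idP => [[b]|hu].
  rewrite inE => /andP[]; rewrite inE => /andP[_ /andP[_ h]] /eqP e ->.
  by rewrite -(children_eq _ e).
have /imsetP[b] := sel_sub hu; rewrite inE => /andP[bA /eqP e] eu.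
by exists b => //; rewrite in_set e eqxx andbT in_set bA (children_eq _ e) hk -eu.
Qed.

Lemma select_regular s (A : {set V}) k : s < l -> regular_at s (select s A k) k.
Proof.
move=> hs a; rewrite inE => /andP[aA /andP[hk _]].
by rewrite select_children // card_sel.
Qed.

Lemma select_above s (A : {set V}) k s' r : s < s' -> s' < l -> regular_at s' A r -> regular_at s' (select s A k) r.
Proof.
move=> h1 h2 h a ha; rewrite -(h a (subsetP (select_sub s A k) _ ha)).
have hs : s < l by apply: ltn_trans h2.
congr #|pred_of_set (_ @: pred_of_set _)|; apply/setP => b.
apply/setIdP/setIdP => -[hb /eqP e]; split; try exact/eqP.
  exact: (subsetP (select_sub s A k)).
by apply: select_sat hs ha hb _; apply/esym/(nest_le h1 (ltnW h2)).
Qed.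

Lemma select_node s (A : {set V}) k b : s < l -> 0 < k -> b \in A -> k <= #|children s A b| ->
  exists2 a, a \in select s A k & key s a = key s b.
Proof.
move=> hs k0 bA hk; have : 0 < #|sel (children s A b) k| by rewrite card_sel.
rewrite -select_children // => /card_gt0P[u /imsetP[a]].
by rewrite inE => /andP[ha /eqP e] _; exists a.
Qed.

Lemma select_below s (A : {set V}) k s' r : s < l -> 0 < k -> (forall a, a \in A -> k <= #|children s A a|) ->
  s' < s -> regular_at s' A r -> regular_at s' (select s A k) r.
Proof.
move=> hs k0 hk h h' a ha; rewrite -(h' a (subsetP (select_sub s A k) _ ha)).
congr #|pred_of_set _|; apply/setP => u; apply/imsetP/imsetP => -[b].
  rewrite inE => /andP[hb e] ->; exists b => //.
  by rewrite inE e (subsetP (select_sub s A k) _ hb).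
rewrite inE => /andP[bA /eqP e] ->.
have [c hc e'] := select_node hs k0 bA (hk _ bA).
exists c; last by apply/esym/(nest_le h (ltnW hs)).
by rewrite inE hc /= -e; apply/eqP/(nest_le (ltnW h) (ltnW hs)).
Qed.

(** The levels are cut from the deepest one up to the root. As [R' s] is positive and at most the
    current branching, no node of level [s] dies, so the cut disturbs neither the deeper nor the
    shallower levels. *)
Lemma thin (A : {set V}) (R R' : nat -> nat) : 0 < #|A| ->
  (forall s, s < l -> regular_at s A (R s)) ->
  (forall s, s < l -> 0 < R' s <= R s) ->
  exists A' : {set V}, [/\ A' \subset A, 0 < #|A'| & forall s, s < l -> regular_at s A' (R' s)].
Proof.
move=> A0 hR hR'.
suff h j : j <= l -> exists A' : {set V}, [/\ A' \subset A, 0 < #|A'| &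
    forall s, s < l -> regular_at s A' (if l - j <= s then R' s else R s)].
  have [A' [h1 h2 h3]] := h l (leqnn _); exists A'; split => // s hs.
  by have := h3 s hs; rewrite subnn.
elim: j => [|j IH] hj.
  by exists A; split => // s hs; rewrite subn0 leqNgt hs; apply: hR.
have [A1 [h1 /card_gt0P[a0 ha0] h3]] := IH (ltnW hj).
set s := l - j.+1; have hs : s < l by rewrite /s; move: hj; clear; lia.
have sj : s.+1 = l - j by rewrite /s; move: hj; clear; lia.
have /andP[k0 kR] := hR' _ hs.
have hk a : a \in A1 -> R' s <= #|children s A1 a|.
  by move=> aA; rewrite (h3 s hs a aA) -sj ltnn.
exists (select s A1 (R' s)); split.
- exact: subset_trans (select_sub _ _ _) h1.
- by have [a ha _] := select_node hs k0 ha0 (hk _ ha0); apply/card_gt0P; exists a.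
- move=> s' hs'; case: (ltngtP s s') => hss.
  + by apply: select_above => //; have := h3 s' hs'; rewrite -sj hss.
  + by apply: select_below => //; have := h3 s' hs'; rewrite -sj leqNgt ltnS (ltnW hss).
  + by rewrite -hss; apply: select_regular.
Qed.

(** For [2 ^ k <= n < 2 ^ k.+1] the right-hand side is [2 ^ k.+1 - 1]. Summing over superlevel sets
    instead of dyadic classes lets [regularize] lose [D.+1] per level, with no additional rounding
    factor. *)
Lemma dyadic_sum n d : n <= 2 ^ d -> n <= \sum_(i < d.+1) (2 ^ i <= n) * 2 ^ i.
Proof.
elim: d => [|d IH] h; first by rewrite big_ord1 expn0 muln1; move: h; rewrite expn0; case: n => [|[]].
case: (leqP n (2 ^ d)) => h'.
  by apply: leq_trans (IH h') _; rewrite [X in _ <= X]big_ord_recr /= leq_addr.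
rewrite big_ord_recr /=.
have e k : k <= d -> \sum_(i < k.+1) (2 ^ i <= n) * 2 ^ i = 2 ^ k.+1 - 1.
  elim: k => [|k IHk] hk; first by rewrite big_ord1 expn0 muln1 (leq_trans _ h') // expn_gt0.
  rewrite big_ord_recr /= IHk ?(ltnW hk) //.
  have -> : 2 ^ k.+1 <= n by apply: leq_trans (ltnW h'); rewrite leq_exp2l.
  rewrite mul1n [in RHS]expnS; have : 0 < 2 ^ k.+1 by rewrite expn_gt0.
  by move: (2 ^ k.+1); clear; lia.
rewrite e //; case: (leqP (2 ^ d.+1) n) => h2; move: h h2; move: (2 ^ d.+1); clear; lia.
Qed.

(** The levels are treated from the leaves to the root. Once the levels below [s] are regular, the
    number of points is the number of nodes of level [s.+1] times a constant, so retaining a share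
    [1 / D.+1] of these nodes retains that share of the points. Discarding nodes can spoil
    regularity only nearer to the root, where nothing has been fixed yet. *)
Lemma regularize (A : {set V}) : 0 < #|A| ->
  exists (A' : {set V}) (R : nat -> nat), [/\ A' \subset A, 0 < #|A'|,
    #|A| <= #|A'| * D.+1 ^ l & forall s, s < l -> regular_at s A' (R s)].
Proof.
move=> A0.
suff h j : j <= l -> exists (A' : {set V}) (R : nat -> nat), [/\ A' \subset A, 0 < #|A'|,
    #|A| <= #|A'| * D.+1 ^ j & forall s, l - j <= s -> s < l -> regular_at s A' (R s)].
  have [A' [R [h1 h2 h3 h4]]] := h l (leqnn _); exists A', R; split => // s hs.
  by apply: h4 => //; rewrite subnn.
elim: j => [|j IH] hj.
  exists A, (fun _ => 0); split => //; first by rewrite expn0 muln1.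
  by move=> s; rewrite subn0 leqNgt => /negP.
have [A1 [R [h1 h2 h3 h4]]] := IH (ltnW hj).
set s := l - j.+1; have hs : s < l by rewrite /s; move: hj; clear; lia.
have sj : s.+1 = l - j by rewrite /s; move: hj; clear; lia.
pose cn i := #|[set k in key s @: A1 | 2 ^ i <= #|key s.+1 @: [set b in A1 | key s b == k]|]|.
have tot : #|key s.+1 @: A1| <= \sum_(i < D.+1) 2 ^ i * cn i.
  rewrite (@card_imset_fibers _ _ (key s.+1) (key s)); last by move=> a b; apply: nest.
  apply: (@leq_trans (\sum_(k in key s @: A1) \sum_(i < D.+1) (2 ^ i <= #|key s.+1 @: [set b in A1 | key s b == k]|) * 2 ^ i)).
    apply: leq_sum => k /imsetP[a aA ->]; apply: dyadic_sum; exact: br_le.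
  rewrite exchange_big /=; apply: leq_sum => i _.
  rewrite -big_distrl /= mulnC leq_mul2l; apply/orP; right.
  rewrite /cn -sum1_card big_mkcond [X in _ <= X]big_mkcond; apply: leq_sum => k _.
  by rewrite in_set; case: (k \in _) => //=; case: (_ <= _).
have [i hi] : exists i : 'I_D.+1, #|key s.+1 @: A1| <= D.+1 * (2 ^ i * cn i).
  apply: contrapT => /forallNP hn.
  have nz : 0 < #|key s.+1 @: A1|.
    by move/card_gt0P: h2 => [a aA]; apply/card_gt0P; exists (key s.+1 a); apply: imset_f.
  have : D.+1 * \sum_(i < D.+1) 2 ^ i * cn i < D.+1 * #|key s.+1 @: A1|.
    rewrite -[in X in _ < X](card_ord D.+1) -sum_nat_const big_distrr /=.
    rewrite (bigD1 ord0) //= [X in _ < X](bigD1 ord0) //= -addSn; apply: leq_add.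
      by rewrite ltnNge; apply/negP/(hn ord0).
    by apply: leq_sum => i _; rewrite ltnW // ltnNge; apply/negP/(hn i).
  by rewrite ltn_pmul2l // ltnNge tot.
set k := 2 ^ i in hi; have k0 : 0 < k by rewrite expn_gt0.
have cnE : cn i = #|key s @: select s A1 k|.
  apply: eq_card => u; rewrite in_set; apply/andP/imsetP => [[/imsetP[a aA ->] hk]|[a]].
    by have [c hc e] := select_node hs k0 aA hk; exists c.
  rewrite inE => /andP[aA /andP[hk _]] ->; split; first exact: imset_f.
  exact: hk.
have reg s' : s <= s' -> s' < l -> regular_at s' (select s A1 k) (if s' == s then k else R s').
  rewrite leq_eqVlt => /orP[/eqP <-|hss] hs'; first by rewrite eqxx; apply: select_regular.
  by rewrite gtn_eqF //; apply: select_above => //; apply: h4 => //; rewrite -sj.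
have c1 : #|A1| = #|key s.+1 @: A1| * \prod_(s.+1 <= s' < l) R s'.
  by apply: nodes_prod => // s' u; apply: h4; rewrite -sj.
have c2 : #|select s A1 k| = #|key s @: select s A1 k| * (k * \prod_(s.+1 <= s' < l) R s').
  rewrite (@nodes_prod s _ (fun s' => if s' == s then k else R s') (ltnW hs)) // big_ltn // eqxx.
  congr (_ * (_ * _)); apply: eq_big_nat => s' /andP[u _].
  by rewrite gtn_eqF.
have sz : #|A1| <= #|select s A1 k| * D.+1.
  rewrite c1 c2 -cnE; apply: leq_trans (leq_mul hi (leqnn _)) _.
  by move: (\prod_(_ <= _ < _) _) (cn i); clear; lia.
exists (select s A1 k), (fun s' => if s' == s then k else R s'); split.
- exact: subset_trans (select_sub _ _ _) h1.
- by move: sz h2; case: #|select s A1 k| => // ; rewrite mul0n leqn0 => /eqP ->.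
- by apply: leq_trans h3 _; rewrite expnS mulnA leq_mul2r sz orbT.
- exact: reg.
Qed.
End Trees.

Local Open Scope R_scope.

(** * Sums of reals *)

Lemma RplusA : associative Rplus. Proof. by move=> x y z; ring. Qed.
Lemma RplusC : commutative Rplus. Proof. by move=> x y; ring. Qed.
Lemma Rplus0 : left_id R0 Rplus. Proof. by move=> x; ring. Qed.
Lemma Rmult0l : left_zero R0 Rmult. Proof. by move=> x; ring. Qed.
Lemma Rmult0r : right_zero R0 Rmult. Proof. by move=> x; ring. Qed.
Lemma RmultDl : left_distributive Rmult Rplus. Proof. by move=> x y z; ring. Qed.
Lemma RmultDr : right_distributive Rmult Rplus. Proof. by move=> x y z; ring. Qed.
HB.instance Definition _ := Monoid.isComLaw.Build R R0 Rplus RplusA RplusC Rplus0.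
HB.instance Definition _ := Monoid.isMulLaw.Build R R0 Rmult Rmult0l Rmult0r.
HB.instance Definition _ := Monoid.isAddLaw.Build R Rmult Rplus RmultDl RmultDr.

Notation "\rsum_ ( i <- r | P ) F" := (\big[Rplus/R0]_(i <- r | P%B) F)
  (at level 34, F at level 34, i, r at level 50).
Notation "\rsum_ ( i <- r ) F" := (\big[Rplus/R0]_(i <- r) F)
  (at level 34, F at level 34, i, r at level 50).
Notation "\rsum_ ( m <= i < n | P ) F" := (\big[Rplus/R0]_(m <= i < n | P%B) F)
  (at level 34, F at level 34, i, m, n at level 50).
Notation "\rsum_ ( m <= i < n ) F" := (\big[Rplus/R0]_(m <= i < n) F)
  (at level 34, F at level 34, i, m, n at level 50).
Notation "\rsum_ ( i | P ) F" := (\big[Rplus/R0]_(i | P%B) F)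
  (at level 34, F at level 34, i at level 50).
Notation "\rsum_ ( i : t | P ) F" := (\big[Rplus/R0]_(i : t | P%B) F)
  (at level 34, F at level 34, i at level 50, only parsing).
Notation "\rsum_ ( i : t ) F" := (\big[Rplus/R0]_(i : t) F)
  (at level 34, F at level 34, i at level 50, only parsing).
Notation "\rsum_ i F" := (\big[Rplus/R0]_i F)
  (at level 34, F at level 34, i at level 0, right associativity).
Notation "\rsum_ ( i < n | P ) F" := (\big[Rplus/R0]_(i < n | P%B) F)
  (at level 34, F at level 34, i, n at level 50).
Notation "\rsum_ ( i < n ) F" := (\big[Rplus/R0]_(i < n) F)
  (at level 34, F at level 34, i, n at level 50).
Notation "\rsum_ ( i 'in' A ) F" := (\big[Rplus/R0]_(i in A) F)
  (at level 34, F at level 34, i, A at level 50).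
Notation "\rsum_ ( i 'in' A | P ) F" := (\big[Rplus/R0]_(i in A | P%B) F)
  (at level 34, F at level 34, i, A at level 50).

Section Sums.
Variables (I : Type).
Implicit Types (r : seq I) (P Q : pred I) (F G : I -> R).

Lemma rsum_ge0 r P F : (forall i, P i -> 0 <= F i) -> 0 <= \rsum_(i <- r | P i) F i.
Proof. move=> h; elim/big_ind: _ => //; [lra|move=> x y; lra]. Qed.

Lemma rsum_le r P F G : (forall i, P i -> F i <= G i) ->
  \rsum_(i <- r | P i) F i <= \rsum_(i <- r | P i) G i.
Proof. move=> h; elim/big_ind2: _ => //; [lra|move=> *; lra]. Qed.

Lemma rsum_sub r P Q F : (forall i, P i -> Q i) -> (forall i, Q i -> 0 <= F i) ->
  \rsum_(i <- r | P i) F i <= \rsum_(i <- r | Q i) F i.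
Proof.
move=> hPQ hF; rewrite big_mkcond [X in _ <= X]big_mkcond; apply: rsum_le => i _.
by case: (boolP (P i)) => [/hPQ -> |_]; [lra|case: ifP => [/hF|]; lra].
Qed.

Lemma rsumZ r P (c : R) F : \rsum_(i <- r | P i) (c * F i) = c * \rsum_(i <- r | P i) F i.
Proof. by rewrite big_distrr. Qed.

Lemma rsumD r P F G :
  \rsum_(i <- r | P i) (F i + G i) = \rsum_(i <- r | P i) F i + \rsum_(i <- r | P i) G i.
Proof. by rewrite big_split. Qed.

Lemma rsumB r P F G :
  \rsum_(i <- r | P i) (F i - G i) = \rsum_(i <- r | P i) F i - \rsum_(i <- r | P i) G i.
Proof.
have -> : \rsum_(i <- r | P i) (F i - G i) = \rsum_(i <- r | P i) (F i + (-1) * G i).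
  by apply: eq_bigr => i _; ring.
by rewrite rsumD rsumZ; ring.
Qed.

Lemma rsum_abs r P F : Rabs (\rsum_(i <- r | P i) F i) <= \rsum_(i <- r | P i) Rabs (F i).
Proof.
elim/big_ind2: _ => //; [rewrite Rabs_R0; lra| |move=> *; lra].
by move=> x y x' y' h h'; apply: Rle_trans (Rabs_triang _ _) _; lra.
Qed.
End Sums.

Lemma rsum_const (I : finType) (P : pred I) (c : R) :
  \rsum_(i | P i) c = INR #|P| * c.
Proof.
rewrite big_const; elim: #|P| => [|k IH]; first by rewrite /=; ring.
by rewrite iterS IH S_INR; ring.
Qed.

Lemma rsum_const_in (I : finType) (A : {pred I}) (c : R) :
  \rsum_(i in A) c = INR #|A| * c.
Proof. exact: rsum_const. Qed.

Lemma rsum_const_nat (u v : nat) (c : R) : \rsum_(u <= i < v) c = INR (v - u) * c.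
Proof.
rewrite big_const_nat; elim: (v - u)%N => [|k IH]; first by rewrite /=; ring.
by rewrite iterS IH S_INR; ring.
Qed.

Lemma rsum_ge_term (I : finType) (P : pred I) (F : I -> R) i :
  (forall j, P j -> 0 <= F j) -> P i -> F i <= \rsum_(j | P j) F j.
Proof.
move=> h Pi; rewrite (bigD1 i) //=.
have : 0 <= \rsum_(j | P j && (j != i)) F j by apply: rsum_ge0 => j /andP[/h].
lra.
Qed.

(** Double counting of pairs of a point and a label. Allowing many labels per point is what makes it
    possible to pigeonhole over all translations: the cost is the ratio of [#|L|] to [c], not
    [#|L|]. *)
Lemma rsum_pigeonhole (P L : finType) (X : P -> R) (E : pred P) (rel : P -> L -> bool) (c : nat) :
  (forall p, E p -> 0 <= X p) -> (forall p, E p -> (c <= #|[pred l | rel p l]|)%N) ->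
  (0 < #|L|)%N ->
  exists l, INR c * \rsum_(p | E p) X p <= INR #|L| * \rsum_(p | E p && rel p l) X p.
Proof.
move=> hX hc hL; apply: contrapT => /forallNP h.
have h1 : INR #|L| * \rsum_l \rsum_(p | E p && rel p l) X p <
    INR #|L| * (INR c * \rsum_(p | E p) X p).
  have e : INR #|L| * (INR c * \rsum_(p | E p) X p) =
      \big[Rplus/R0]_(l : L) (INR c * \rsum_(p | E p) X p) by rewrite rsum_const.
  rewrite e -rsumZ.
  have /card_gt0P [l0 _] := hL.
  rewrite (bigD1 l0) //= [X in _ < X](bigD1 l0) //=.
  apply: Rplus_lt_le_compat; first exact/Rnot_le_lt/h.
  by apply: rsum_le => l _; apply/Rlt_le/Rnot_le_lt/h.
have h2 : INR c * \rsum_(p | E p) X p <= \rsum_l \rsum_(p | E p && rel p l) X p.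
  have -> : \rsum_l \rsum_(p | E p && rel p l) X p =
      \rsum_(p | E p) \rsum_(l | rel p l) X p.
    under eq_bigr => l _ do rewrite big_mkcondr.
    by rewrite exchange_big; apply: eq_bigr => p _; rewrite -big_mkcond.
  rewrite -rsumZ; apply: rsum_le => p Ep; rewrite rsum_const.
  apply: Rmult_le_compat_r; first exact: hX.
  by apply: le_INR; apply/leP; apply: hc.
have : 0 < INR #|L| by apply: lt_0_INR; apply/ltP.
nra.
Qed.

(** * Powers and stability in Hoelder's inequality *)

Lemma rpow0 a : rpow 0 a = 0.
Proof. by rewrite /rpow; case: Req_EM_T. Qed.

Lemma rpow_pos x a : 0 < x -> rpow x a = Rpower x a.
Proof. by move=> h; rewrite /rpow; case: Req_EM_T => // e; lra. Qed.

Lemma rpow_gt0 x a : 0 < x -> 0 < rpow x a.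
Proof. by move=> h; rewrite rpow_pos //; apply: exp_pos. Qed.

Lemma rpow_ge0 x a : 0 <= rpow x a.
Proof. by rewrite /rpow; case: Req_EM_T => h /=; [lra|apply/Rlt_le/exp_pos]. Qed.

Lemma Rle0_cases x : 0 <= x -> x = 0 \/ 0 < x.
Proof. by move=> h; lra. Qed.

Lemma rpowM x y a : 0 <= x -> 0 <= y -> rpow (x * y) a = rpow x a * rpow y a.
Proof.
move=> /Rle0_cases [->|hx]; first by rewrite Rmult_0_l !rpow0; lra.
move=> /Rle0_cases [->|hy]; first by rewrite Rmult_0_r !rpow0; lra.
by rewrite !rpow_pos ?Rpower_mult_distr //; apply: Rmult_lt_0_compat.
Qed.

Lemma rpow_le x y a : 0 <= a -> 0 <= x -> x <= y -> rpow x a <= rpow y a.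
Proof.
move=> ha /Rle0_cases [->|hx] hxy; first by rewrite rpow0; apply: rpow_ge0.
by rewrite !rpow_pos; [apply: Rle_Rpower_l|lra|lra].
Qed.

Lemma rpow_rpow x a b : 0 <= x -> rpow (rpow x a) b = rpow x (a * b).
Proof.
move=> /Rle0_cases [->|hx]; first by rewrite !rpow0.
by rewrite (rpow_pos a hx) rpow_pos ?rpow_pos ?Rpower_mult //; apply: exp_pos.
Qed.

Lemma rpow1 x : 0 <= x -> rpow x 1 = x.
Proof. by move=> /Rle0_cases [->|hx]; [rewrite rpow0|rewrite rpow_pos ?Rpower_1]. Qed.

Lemma rpow_1l a : rpow 1 a = 1.
Proof. by rewrite rpow_pos; [rewrite /Rpower ln_1 Rmult_0_r exp_0|lra]. Qed.

Lemma rpowD x a b : 0 <= x -> rpow x (a + b) = rpow x a * rpow x b.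
Proof.
by move=> /Rle0_cases [->|hx]; [rewrite !rpow0; lra|rewrite !rpow_pos ?Rpower_plus].
Qed.

Lemma rpow_lt x y a : 0 < a -> 0 <= x -> x < y -> rpow x a < rpow y a.
Proof.
move=> ha /Rle0_cases [->|hx] hxy; first by rewrite rpow0; apply: rpow_gt0.
by rewrite !rpow_pos; [apply: Rlt_Rpower_l|lra|lra].
Qed.

Lemma rpow_le_inv x y a : 0 < a -> 0 <= y -> rpow x a <= rpow y a -> x <= y.
Proof. by move=> ha hy h; apply: Rnot_lt_le => /(rpow_lt ha hy); lra. Qed.

Notation p2 := pow2R.

Lemma p2_gt0 x : 0 < p2 x. Proof. exact: exp_pos. Qed.
Lemma p2D x y : p2 (x + y) = p2 x * p2 y. Proof. exact: Rpower_plus. Qed.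
Lemma p2_0 : p2 0 = 1. Proof. by rewrite /p2 Rpower_O //; lra. Qed.
Lemma p2_1 : p2 1 = 2. Proof. by rewrite /p2 Rpower_1 //; lra. Qed.
Lemma p2_le x y : x <= y -> p2 x <= p2 y.
Proof. by move=> h; apply: Rle_Rpower; lra. Qed.
Lemma p2_lt x y : x < y -> p2 x < p2 y.
Proof. by move=> h; apply: Rpower_lt; lra. Qed.
Lemma p2_le_inv x y : p2 x <= p2 y -> x <= y.
Proof. by move=> h; apply: Rnot_lt_le => /p2_lt; lra. Qed.
Lemma p2N x : p2 (- x) * p2 x = 1.
Proof. by rewrite -p2D Rplus_opp_l p2_0. Qed.
Lemma p2_rpow x a : rpow (p2 x) a = p2 (x * a).
Proof. by rewrite rpow_pos; [rewrite /p2 Rpower_mult|apply: p2_gt0]. Qed.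
Lemma p2_nat k : p2 (INR k) = INR (2 ^ k)%N.
Proof.
rewrite /p2 Rpower_pow; last lra.
by elim: k => // k IH; rewrite expnS mult_INR -IH.
Qed.
Lemma INR_expn a k : INR (a ^ k)%N = INR a ^ k.
Proof. by elim: k => // k IH; rewrite expnS mult_INR IH. Qed.

Lemma ln2_gt0 : 0 < ln 2. Proof. by rewrite -ln_1; apply: ln_increasing; lra. Qed.
Lemma log2_le x y : 0 < x -> x <= y -> log2 x <= log2 y.
Proof.
move=> hx hxy; rewrite /log2; apply: Rmult_le_compat_r.
  by apply/Rlt_le/Rinv_0_lt_compat/ln2_gt0.
by case: hxy => [h|->]; [left; apply: ln_increasing|right].
Qed.
Lemma log2_p2 x : log2 (p2 x) = x.
Proof. by rewrite /log2 /p2 /Rpower ln_exp; field; have := ln2_gt0; lra. Qed.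
Lemma p2_log2 x : 0 < x -> p2 (log2 x) = x.
Proof.
move=> h; rewrite /log2 /p2 /Rpower.
by rewrite (_ : ln x / ln 2 * ln 2 = ln x) ?exp_ln //; field; have := ln2_gt0; lra.
Qed.

(** The integrand of Hoelder's inequality with exponents [1 / a] and [1 / (1 - a)]. As [rpow 0] is
    [0] for every exponent, it vanishes as soon as one argument does, even for [a = 0] or
    [a = 1]. *)
Definition gm (a x y : R) := rpow x a * rpow y (1 - a).

Section GeometricMean.
Variable a : R.
Hypothesis (a0 : 0 < a) (a1 : a < 1).
Notation gm := (gm a).

Lemma gm_ge0 x y : 0 <= gm x y.
Proof. by apply: Rmult_le_pos; apply: rpow_ge0. Qed.
Lemma gm0l y : gm 0 y = 0. Proof. by rewrite /gm rpow0; lra. Qed.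
Lemma gm0r x : gm x 0 = 0. Proof. by rewrite /gm rpow0; lra. Qed.
Lemma gm_gt0 x y : 0 < x -> 0 < y -> 0 < gm x y.
Proof. by move=> hx hy; apply: Rmult_lt_0_compat; apply: rpow_gt0. Qed.
Lemma gm_id x : 0 <= x -> gm x x = x.
Proof. by move=> h; rewrite /gm -rpowD // (_ : a + (1 - a) = 1) ?rpow1 //; lra. Qed.
Lemma gmM x y u v : 0 <= x -> 0 <= y -> 0 <= u -> 0 <= v ->
  gm (x * u) (y * v) = gm x y * gm u v.
Proof. by move=> *; rewrite /gm !rpowM //; lra. Qed.
Lemma gm_le x y u v : 0 <= x -> 0 <= y -> x <= u -> y <= v -> gm x y <= gm u v.
Proof.
move=> hx hy hxu hyv; apply: Rmult_le_compat; try exact: rpow_ge0;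
 by apply: rpow_le; lra.
Qed.
End GeometricMean.

(** The exponential lies above its tangent at [s], the weighted mean of [ln x] and [ln y]. In the
    weighted average of the two tangent bounds the linear terms cancel and [exp s] remains. *)
Lemma gm_am a x y : 0 < a -> a < 1 -> 0 <= x -> 0 <= y -> gm a x y <= a * x + (1 - a) * y.
Proof.
move=> a0 a1 /Rle0_cases [->|hx]; first by move=> hy; rewrite gm0l; nra.
move=> /Rle0_cases [->|hy]; first by rewrite gm0r; nra.
rewrite /gm !rpow_pos // /Rpower -exp_plus.
set s := a * ln x + _.
have bound z : 0 < z -> exp s * (1 + (ln z - s)) <= z.
  move=> hz; rewrite -{2}(exp_ln _ hz).
  rewrite (_ : exp (ln z) = exp s * exp (ln z - s)).
    by apply: Rmult_le_compat_l; [apply/Rlt_le/exp_pos|apply: exp_ineq1_le].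
  by rewrite -exp_plus; congr exp; ring.
have h1 := bound _ hx; have h2 := bound _ hy.
have e : exp s = a * (exp s * (1 + (ln x - s))) + (1 - a) * (exp s * (1 + (ln y - s))).
  by rewrite /s; ring.
by rewrite e; nra.
Qed.

(** The endpoints are included because [gm_stab_half] uses the exponent [2 * a], which may be [1],
    and [p2_le1p] uses any exponent in [[0, 1]]. *)
Lemma gm_am1 a x y : 0 <= a -> a <= 1 -> 0 < x -> 0 < y -> gm a x y <= a * x + (1 - a) * y.
Proof.
move=> a0 a1 hx hy.
case: (Req_EM_T a 0) => [->|n0].
  by rewrite /gm (rpow_pos 0 hx) Rpower_O // Rminus_0_r rpow1; lra.
case: (Req_EM_T a 1) => [->|n1].
  by rewrite /gm (_ : 1 - 1 = 0) ?(rpow_pos 0 hy) ?Rpower_O // ?rpow1; lra.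
by apply: gm_am; lra.
Qed.

(** The left-hand side is also the geometric mean of [sqrt x * sqrt y] and [y] with weights [2 * a]
    and [1 - 2 * a]. The arithmetic mean of that pair with the same weights is exactly the
    right-hand side. *)
Lemma gm_stab_half a x y : 0 < a -> a <= 1 / 2 -> 0 <= x -> 0 <= y ->
  gm a x y <= a * x + (1 - a) * y - a * (sqrt x - sqrt y) ^ 2.
Proof.
move=> a0 a1 hx hy.
have sx := sqrt_sqrt _ hx; have sy := sqrt_sqrt _ hy.
have px := sqrt_pos x; have py := sqrt_pos y.
case: (Rle0_cases hx) => [->|hx1]; first by rewrite gm0l sqrt_0; nra.
case: (Rle0_cases hy) => [->|hy1]; first by rewrite gm0r sqrt_0; nra.
have s0 : 0 < sqrt x * sqrt y by apply: Rmult_lt_0_compat; apply: sqrt_lt_R0.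
have : gm a x y = gm (2 * a) (sqrt x * sqrt y) y.
  rewrite /gm rpowM // -{1}sx -{1}sy !rpowM // !(Rmult_comm 2).
  have d z b : 0 <= z -> rpow z (b * 2) = rpow z b * rpow z b.
    by move=> hz; rewrite -rpowD //; congr rpow; ring.
  rewrite !d // -{5}sy rpowM //.
  have -> : rpow (sqrt y) (1 - a) = rpow (sqrt y) a * rpow (sqrt y) (1 - a * 2).
    by rewrite -rpowD //; congr rpow; ring.
  ring.
move=> ->; have := gm_am1 (a := 2 * a) _ _ s0 hy1; nra.
Qed.

Lemma gmC a x y : gm a x y = gm (1 - a) y x.
Proof. by rewrite /gm Rmult_comm; congr (_ * rpow _ _); ring. Qed.

Lemma gm_stab a x y : 0 < a -> a < 1 -> 0 <= x -> 0 <= y ->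
  gm a x y <= a * x + (1 - a) * y - Rmin a (1 - a) * (sqrt x - sqrt y) ^ 2.
Proof.
move=> a0 a1 hx hy; have sq := pow2_ge_0 (sqrt x - sqrt y).
case: (Rle_lt_dec a (1 / 2)) => h.
  have := gm_stab_half a0 h hx hy; have := Rmin_l a (1 - a); nra.
have := @gm_stab_half (1 - a) y x _ _ hy hx; rewrite -gmC.
have := Rmin_r a (1 - a); move=> h1 h2; have := h2 ltac:(lra) ltac:(lra); nra.
Qed.

Lemma gm_holder2 a x y u v : 0 < a -> a < 1 -> 0 <= x -> 0 <= y -> 0 <= u -> 0 <= v ->
  gm a x y + gm a u v <= gm a (x + u) (y + v).
Proof.
move=> a0 a1 hx hy hu hv.
case: (@Rle0_cases (x + u)); first lra.
  move=> e; have -> : x = 0 by lra.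
  have -> : u = 0 by lra.
  by rewrite !gm0l; have := gm_ge0 a (0 + 0) (y + v); lra.
case: (@Rle0_cases (y + v)); first lra.
  move=> e _; have -> : y = 0 by lra.
  have -> : v = 0 by lra.
  by rewrite !gm0r; have := gm_ge0 a (x + u) (0 + 0); lra.
move=> hY hX; set X := x + u; set Y := y + v.
have P := gm_gt0 a hX hY.
have scale s t : 0 <= s -> 0 <= t -> gm a s t = gm a X Y * gm a (s / X) (t / Y).
  move=> hs ht; rewrite -gmM; first by congr gm; field; rewrite /X /Y; lra.
  - by rewrite /X; lra.
  - by rewrite /Y; lra.
  - by apply: Rmult_le_pos => //; apply/Rlt_le/Rinv_0_lt_compat.
  - by apply: Rmult_le_pos => //; apply/Rlt_le/Rinv_0_lt_compat.
rewrite (scale x y) // (scale u v) //.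
have nn s t : 0 <= s -> 0 < t -> 0 <= s / t.
  by move=> hs ht; apply: Rmult_le_pos => //; apply/Rlt_le/Rinv_0_lt_compat.
have h1 := gm_am a0 a1 (nn _ _ hx hX) (nn _ _ hy hY).
have h2 := gm_am a0 a1 (nn _ _ hu hX) (nn _ _ hv hY).
have e : a * (x / X) + (1 - a) * (y / Y) + (a * (u / X) + (1 - a) * (v / Y)) = 1.
  by rewrite /X /Y; field; lra.
rewrite -Rmult_plus_distr_l -[Z in _ <= Z]Rmult_1_r.
by rewrite -/X -/Y in h1 h2 P; apply: Rmult_le_compat_l; lra.
Qed.

Lemma gm_holder (a : R) (I : Type) (r : seq I) (P : pred I) (x y : I -> R) : 0 < a -> a < 1 ->
  (forall i, P i -> 0 <= x i) -> (forall i, P i -> 0 <= y i) ->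
  \rsum_(i <- r | P i) gm a (x i) (y i) <= gm a (\rsum_(i <- r | P i) x i) (\rsum_(i <- r | P i) y i).
Proof.
move=> a0 a1 hx hy.
suff : 0 <= \rsum_(i <- r | P i) x i /\ 0 <= \rsum_(i <- r | P i) y i /\
  \rsum_(i <- r | P i) gm a (x i) (y i) <= gm a (\rsum_(i <- r | P i) x i) (\rsum_(i <- r | P i) y i).
  by case=> _ [].
elim/big_rec3: _ => [|i g Y X Pi [hX [hY h]]].
  by rewrite gm0l; split; [|split]; lra.
have hxi := hx _ Pi; have hyi := hy _ Pi.
split; [lra|split; [lra|]].
by have := gm_holder2 a0 a1 hxi hyi hX hY; lra.
Qed.

Lemma rsum_ge_term_seq (I : eqType) (r : seq I) (F : I -> R) i :
  uniq r -> (forall j, 0 <= F j) -> i \in r -> F i <= \rsum_(j <- r) F j.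
Proof.
move=> ur hF ir; rewrite (bigD1_seq i) //=.
have : 0 <= \rsum_(j <- r | j != i) F j by apply: rsum_ge0.
lra.
Qed.

(* The deficit in weighted AM-GM dominates (sqrt x - sqrt y)^2, so near equality in Hoelder's
   inequality makes the two normalised sequences close. *)
Lemma gm_holder_stab (a eta : R) (I : eqType) (r : seq I) (x y : I -> R) : 0 < a -> a < 1 -> 0 <= eta ->
  uniq r -> (forall i, 0 <= x i) -> (forall i, 0 <= y i) ->
  let X := \rsum_(i <- r) x i in let Y := \rsum_(i <- r) y i in
  0 < X -> 0 < Y ->
  (1 - Rmin a (1 - a) * (eta / 2) ^ 2) * gm a X Y <= \rsum_(i <- r) gm a (x i) (y i) ->
  forall i, i \in r -> Rabs (x i / X - y i / Y) <= eta.
Proof.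
move=> a0 a1 eta0 ur hx hy X Y hX hY h i ir.
set c := Rmin a (1 - a) in h *.
have c0 : 0 < c by apply: Rmin_glb_lt; lra.
have P := gm_gt0 a hX hY.
have nn s t : 0 <= s -> 0 < t -> 0 <= s / t.
  by move=> hs ht; apply: Rmult_le_pos => //; apply/Rlt_le/Rinv_0_lt_compat.
have e : \rsum_(i <- r) gm a (x i) (y i) = gm a X Y * \rsum_(i <- r) gm a (x i / X) (y i / Y).
  rewrite -rsumZ; apply: eq_bigr => j _; rewrite -gmM; try lra; try exact: nn.
  by congr gm; field; lra.
rewrite e in h.
have h1 : 1 - c * (eta / 2) ^ 2 <= \rsum_(i <- r) gm a (x i / X) (y i / Y) by nra.
have h2 : \rsum_(i <- r) gm a (x i / X) (y i / Y) <=
   1 - c * \rsum_(i <- r) (sqrt (x i / X) - sqrt (y i / Y)) ^ 2.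
  apply: (@Rle_trans _ (\rsum_(i <- r) (a * (x i / X) + (1 - a) * (y i / Y) - c * (sqrt (x i / X) - sqrt (y i / Y)) ^ 2))).
    by apply: rsum_le => j _; apply: gm_stab => //; apply: nn.
  rewrite rsumB rsumD !rsumZ -!big_distrl /= -/X -/Y.
  by rewrite /Rdiv !Rinv_r; lra.
have h3 : (sqrt (x i / X) - sqrt (y i / Y)) ^ 2 <= \rsum_(i <- r) (sqrt (x i / X) - sqrt (y i / Y)) ^ 2.
  exact: (@rsum_ge_term_seq _ r (fun i => (sqrt (x i / X) - sqrt (y i / Y)) ^ 2) _ ur (fun j => pow2_ge_0 _) ir).
have le1 z Z : (forall i, 0 <= z i) -> Z = \rsum_(i <- r) z i -> 0 < Z -> 0 <= sqrt (z i / Z) <= 1.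
  move=> hz eZ hZ; split; first exact: sqrt_pos.
  rewrite -sqrt_1; apply: sqrt_le_1_alt; apply: (Rmult_le_reg_r Z) => //.
  rewrite /Rdiv Rmult_assoc Rinv_l; last lra.
  by have := rsum_ge_term_seq ur hz ir; lra.
have [l1 l2] := le1 x X hx erefl hX; have [l3 l4] := le1 y Y hy erefl hY.
rewrite -{1}(sqrt_sqrt (x i / X)); last exact: nn.
rewrite -{1}(sqrt_sqrt (y i / Y)); last exact: nn.
move: (sqrt (x i / X)) (sqrt (y i / Y)) h3 l1 l2 l3 l4 => s t h3 *.
(* For [s] and [t] in [[0, 1]] one has [|s ^ 2 - t ^ 2| <= 2 * |s - t|]; this is where the [eta / 2]
   of the hypothesis comes from. *)
have h4 : (s - t) ^ 2 <= (eta / 2) ^ 2 by nra.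
have h5 : Rabs (s - t) <= eta / 2 by apply: Rabs_le; split; nra.
rewrite (_ : s * s - t * t = (s - t) * (s + t)); last ring.
rewrite Rabs_mult (Rabs_pos_eq (s + t)); last lra.
have := Rabs_pos (s - t); nra.
Qed.

Lemma Rabs_le_bounds x y : Rabs x <= y -> - y <= x <= y.
Proof. by rewrite /Rabs; case: Rcase_abs => ? ?; lra. Qed.

(** * Window masses *)

Definition S (p : nat -> R) (u v : nat) := \rsum_(u <= k < v) p k.

Lemma S_cat p u v w : (u <= v)%N -> (v <= w)%N -> S p u w = S p u v + S p v w.
Proof. by move=> h1 h2; rewrite /S (big_cat_nat h1 h2). Qed.

Lemma S_shift p d u v : S p (u + d) (v + d) = S (fun k => p (k + d)%N) u v.
Proof. by rewrite /S big_addn addnK. Qed.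

Lemma eq_S p q u v : (forall k, (u <= k < v)%N -> p k = q k) -> S p u v = S q u v.
Proof. by move=> h; apply: eq_big_nat. Qed.

Lemma S_blocks p a r M : S p a (a + M * r) = \rsum_(0 <= j < M) S p (a + j * r) (a + j.+1 * r).
Proof.
elim: M => [|M IH]; first by rewrite mul0n addn0 /S !big_geq.
rewrite big_nat_recr //= -IH -S_cat //; lia.
Qed.

Section Nonneg.
Variable p : nat -> R.
Hypothesis p0 : forall k, 0 <= p k.

Lemma S_ge0 u v : 0 <= S p u v.
Proof. by apply: rsum_ge0. Qed.

Lemma S_mono u v u' v' : (u' <= u)%N -> (v <= v')%N -> S p u v <= S p u' v'.
Proof.
move=> h1 h2; case: (leqP u v) => h3; last first.
  by rewrite {1}/S big_geq ?(ltnW h3) //; apply: S_ge0.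
rewrite (@S_cat p u' u v') ?(@S_cat p u v v') //; last exact: leq_trans h2.
have := S_ge0 u' u; have := S_ge0 v v'; lra.
Qed.

Section Windows.
Variables (a sg r M i : nat) (eta : R).
Hypotheses (sga : (sg <= a)%N) (ir : (i * r <= sg)%N) (ir1 : (sg <= i.+1 * r)%N) (i1 : (1 <= i)%N).
Let c1 j := S p a (a + j * r).
Let c2 j := S p (a - sg) (a - sg + j * r).
Hypotheses (P1 : 0 < c1 M) (P2 : 0 < c2 M).
Hypothesis near : forall j, (j <= M)%N -> Rabs (c1 j / c1 M - c2 j / c2 M) <= eta.
Let g j := S p (a + j * r - sg) (a + j * r).

Lemma window_massE j : g j = S p (a - sg) a + c1 j - c2 j.
Proof.
have e1 : S p (a - sg) (a + j * r) = S p (a - sg) a + c1 j by rewrite -S_cat //; lia.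
have : S p (a - sg) (a + j * r) = c2 j + g j.
  rewrite /c2 /g (_ : (a + j * r - sg = a - sg + j * r)%N); last lia.
  by rewrite -S_cat //; lia.
lra.
Qed.

(* Windows of length sg have mass const + c1 - c2; comparing the two total masses decides
   the direction in which this is almost monotone. *)
Lemma window_mass_monotone :
  (forall j' j, (j' <= j)%N -> (j <= M)%N -> g j' <= g j + 2 * eta * c1 M) \/
  (forall j' j, (j' <= j)%N -> (j <= M)%N -> g j <= g j' + 2 * eta * c1 M).
Proof.
have eta0 : 0 <= eta by apply: Rle_trans (near (leqnn M)); apply: Rabs_pos.
have key j' j : (j' <= j)%N -> (j <= M)%N ->
   0 <= c1 j - c1 j' /\ 0 <= c2 j - c2 j' /\
   exists x y, c1 j - c1 j' = c1 M * x /\ c2 j - c2 j' = c2 M * y /\ - (2 * eta) <= x - y <= 2 * eta.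
  move=> h1 h2.
  have m1 : c1 j' <= c1 j by apply: S_mono => //; rewrite leq_add2l leq_mul2r h1 orbT.
  have m2 : c2 j' <= c2 j by apply: S_mono => //; rewrite leq_add2l leq_mul2r h1 orbT.
  split; [lra|split; [lra|]].
  exists (c1 j / c1 M - c1 j' / c1 M), (c2 j / c2 M - c2 j' / c2 M).
  split; first by field; lra.
  split; first by field; lra.
  have /Rabs_le_bounds := near h2; have /Rabs_le_bounds := near (leq_trans h1 h2).
  by move=> [? ?] [? ?]; lra.
case: (Rle_lt_dec (c2 M) (c1 M)) => h; [left|right] => j' j h1 h2;
  rewrite !window_massE; have [k1 [k2 [x [y [e1 [e2 [l1 l2]]]]]]] := key _ _ h1 h2.
- suff : c2 j - c2 j' <= c1 j - c1 j' + 2 * eta * c1 M by lra.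
  rewrite e1 e2 in k1 k2 *.
  have y0 : 0 <= y by apply: Rnot_lt_le => hy; nra.
  have : c2 M * y <= c1 M * y by apply: Rmult_le_compat_r.
  have : c1 M * y <= c1 M * (x + 2 * eta) by apply: Rmult_le_compat_l; lra.
  lra.
- suff : c1 j - c1 j' - 2 * eta * c1 M <= c2 j - c2 j' by lra.
  rewrite e1 e2 in k1 k2 *.
  have y0 : 0 <= y by apply: Rnot_lt_le => hy; nra.
  have : c1 M * y <= c2 M * y by apply: Rmult_le_compat_r; lra.
  have : c1 M * (x - 2 * eta) <= c1 M * y by apply: Rmult_le_compat_l; lra.
  lra.
Qed.

(** Successive windows end [i * r] apart, at most their length [sg], so they leave no gap. *)
Lemma windows_cover e : (5 * i <= e)%N ->
  S p (a + (e - 5 * i) * r) (a + e * r) <=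
    g e + g (e - i)%N + g (e - 2 * i)%N + g (e - 3 * i)%N + g (e - 4 * i)%N.
Proof.
move=> h.
have step j : (i <= j)%N -> S p (a + (j - i) * r) (a + j * r) <= g j.
  move=> hj; apply: S_mono => //; rewrite mulnBl.
  have : (i * r <= j * r)%N by rewrite leq_mul2r hj orbT.
  lia.
have s0 := step e ltac:(lia); have s1 := step (e - i)%N ltac:(lia).
have s2 := step (e - 2 * i)%N ltac:(lia); have s3 := step (e - 3 * i)%N ltac:(lia).
have s4 := step (e - 4 * i)%N ltac:(lia).
have le x y : (x <= y)%N -> (a + x * r <= a + y * r)%N.
  by move=> hxy; rewrite leq_add2l leq_mul2r hxy orbT.
rewrite (_ : e - i - i = e - 2 * i)%N in s1; last lia.
rewrite (_ : e - 2 * i - i = e - 3 * i)%N in s2; last lia.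
rewrite (_ : e - 3 * i - i = e - 4 * i)%N in s3; last lia.
rewrite (_ : e - 4 * i - i = e - 5 * i)%N in s4; last lia.
rewrite (@S_cat _ _ (a + (e - 4 * i) * r)%N); try (apply: le; lia).
rewrite (@S_cat _ (a + (e - 4 * i) * r)%N (a + (e - 3 * i) * r)%N); try (apply: le; lia).
rewrite (@S_cat _ (a + (e - 3 * i) * r)%N (a + (e - 2 * i) * r)%N); try (apply: le; lia).
rewrite (@S_cat _ (a + (e - 2 * i) * r)%N (a + (e - i) * r)%N); try (apply: le; lia).
lra.
Qed.

(** Here the ends are [i.+1 * r] apart, at least [sg], so the windows are disjoint. *)
Lemma windows_pack e n G : (forall k, (k < n)%N -> G <= g (e + k.+1 * i.+1)%N) ->
  INR n * G <= S p (a + e * r) (a + (e + n * i.+1) * r).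
Proof.
elim: n => [|n IH] h.
  by rewrite mul0n addn0 /S big_geq //= ; lra.
have h1 := IH (fun k hk => h k (leqW hk)); have h2 := h n (leqnn _).
have le x y : (x <= y)%N -> (a + x * r <= a + y * r)%N.
  by move=> hxy; rewrite leq_add2l leq_mul2r hxy orbT.
have h3 : g (e + n.+1 * i.+1)%N <= S p (a + (e + n * i.+1) * r) (a + (e + n.+1 * i.+1) * r).
  apply: S_mono => //; rewrite mulSn (addnCA e) (mulnDl i.+1); lia.
rewrite S_INR (@S_cat _ _ (a + (e + n * i.+1) * r)%N); try (apply: le; lia).
lra.
Qed.

(** Five windows cover the cells around [j0]. By almost monotonicity the extreme one, on the
    increasing side, is nearly the heaviest, and all windows beyond it are nearly as heavy; [n] of
    these are disjoint and stay within [Rc] cells of [j0]. Monotonicity is used twice, with error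
    [2 * eta] each time. *)
Lemma window_spread j0 Rc n : ((n + 5) * i.+1 <= Rc)%N -> (Rc <= j0)%N -> (j0 + Rc <= M)%N ->
  INR n * (S p (a + (j0 - i.+1) * r) (a + (j0 + i + 2) * r) / 5 - 4 * eta * c1 M) <=
  S p (a + (j0 - Rc) * r) (a + (j0 + Rc) * r).
Proof.
move=> hn h0 hM; set Q := S p _ (a + (j0 + i + 2) * r).
have eta0 : 0 <= eta by apply: Rle_trans (near (leqnn M)); apply: Rabs_pos.
have e0 : 0 <= eta * c1 M by apply: Rmult_le_pos; lra.
have le x y : (x <= y)%N -> (a + x * r <= a + y * r)%N.
  by move=> hxy; rewrite leq_add2l leq_mul2r hxy orbT.
(* The central piece has [2 * i + 3] cells, at most [5 * i] because [i >= 1]: hence five windows,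
   ending at cell [e] and every [i] cells before it. *)
set e := (j0 + i + 2)%N.
have hi : (5 * i + n * i.+1 + 5 <= Rc)%N by lia.
have hQ : Q <= g e + g (e - i)%N + g (e - 2 * i)%N + g (e - 3 * i)%N + g (e - 4 * i)%N.
  apply: Rle_trans (windows_cover (e := e) _); last lia.
  by apply: S_mono => //; apply: le; lia.
case: window_mass_monotone => mono.
  have b d : (d <= e)%N -> g (e - d)%N <= g e + 2 * eta * c1 M by move=> _; apply: mono; lia.
  have b0 := b 0%N ltac:(lia); have b1 := b i ltac:(lia); have b2 := b (2 * i)%N ltac:(lia).
  have b3 := b (3 * i)%N ltac:(lia); have b4 := b (4 * i)%N ltac:(lia).
  apply: Rle_trans (S_mono (u := a + e * r) (v := a + (e + n * i.+1) * r) _ _); try (apply: le; lia).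
  apply: windows_pack => k hk.
  have kn : (k.+1 * i.+1 <= n * i.+1)%N by rewrite leq_mul2r hk orbT.
  have := mono e (e + k.+1 * i.+1)%N ltac:(lia) ltac:(lia).
  lra.
set f := (e - 4 * i)%N; have hf : (n * i.+1 <= f)%N by lia.
have b d : (d <= 4 * i)%N -> g (e - d)%N <= g f + 2 * eta * c1 M by move=> hd; apply: mono; lia.
have b0 := b 0%N ltac:(lia); have b1 := b i ltac:(lia); have b2 := b (2 * i)%N ltac:(lia).
have b3 := b (3 * i)%N ltac:(lia); have b4 := b (4 * i)%N ltac:(lia).
rewrite subn0 in b0.
apply: Rle_trans (S_mono (u := a + (f - n * i.+1) * r) (v := a + (f - n * i.+1 + n * i.+1) * r) _ _);
  try (apply: le; lia).
apply: windows_pack => k hk.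
have kn : (k.+1 * i.+1 <= n * i.+1)%N by rewrite leq_mul2r hk orbT.
have := mono (f - n * i.+1 + k.+1 * i.+1)%N f ltac:(lia) ltac:(lia).
lra.
Qed.
End Windows.
End Nonneg.

(** * Counting bad levels *)

Definition near (g v : nat -> R) (eta : R) (r M x : nat) : Prop :=
  0 < S g x (x + M * r) /\ 0 < S v x (x + M * r) /\
  forall j, (j < M)%N ->
    Rabs (S g (x + j * r) (x + j.+1 * r) / S g x (x + M * r) -
          S v (x + j * r) (x + j.+1 * r) / S v x (x + M * r)) <= eta.

(** Light cells count as bad too: proportionality is known up to an additive error relative to the
    whole block, which says nothing about a cell whose share is as small as that error. *)
Definition bad_cell (g v : nat -> R) (eta th : R) (r M k : nat) : bool :=
  `[< ~ near g v eta r M (k %/ M * (M * r)) >] ||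
  `[< S g (k * r) (k.+1 * r) < th * S g (k %/ M * (M * r)) (k %/ M * (M * r) + M * r) >].

Section Moment.
Variables (a eta th A : R).
Hypotheses (a0 : 0 < a) (a1 : a < 1) (eta0 : 0 <= eta) (th0 : 0 <= th) (A1 : 1 <= A).
Hypothesis A2 : A * (1 - Rmin a (1 - a) * (eta / 2) ^ 2) <= 1.
Variables (g v : nat -> R).
Hypotheses (g0 : forall k, 0 <= g k) (v0 : forall k, 0 <= v k).

(** If the block is not near, all its cells are bad and the loss in [gm_holder_stab] compensates the
    factor [A]. If it is near, only light cells are charged: each contributes at most [rpow th a]
    times the value of the block, and there are at most [M] of them. *)
Lemma level_moment (lam : R) (r M K : nat) : 1 + (A - 1) * (INR M * rpow th a) <= lam ->
  \rsum_(0 <= j < M) (A ^ (bad_cell g v eta th r M (K * M + j) : nat) *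
     gm a (S g ((K * M + j) * r) ((K * M + j).+1 * r)) (S v ((K * M + j) * r) ((K * M + j).+1 * r))) <=
  lam * gm a (S g (K * (M * r)) (K * (M * r) + M * r)) (S v (K * (M * r)) (K * (M * r) + M * r)).
Proof.
move=> hlam; set x := (K * (M * r))%N.
have cell j : ((K * M + j) * r = x + j * r)%N by rewrite mulnDl -mulnA.
have cell1 j : ((K * M + j).+1 * r = x + j.+1 * r)%N by rewrite -addnS mulnDl -mulnA.
set G := gm a _ _.
have G0 : 0 <= G by apply: gm_ge0.
have th1 := rpow_ge0 th a; have M0 := pos_INR M.
have lam1 : 1 <= lam by have : 0 <= INR M * rpow th a by [apply: Rmult_le_pos]; nra.
have K1 j : (j < M)%N -> ((K * M + j) %/ M = K)%N.
  by move=> hj; rewrite divnMDl ?divn_small ?addn0 //; lia.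
have sg : S g x (x + M * r) = \rsum_(0 <= j < M) S g (x + j * r) (x + j.+1 * r) by exact: S_blocks.
have sv : S v x (x + M * r) = \rsum_(0 <= j < M) S v (x + j * r) (x + j.+1 * r) by exact: S_blocks.
have hold : \rsum_(0 <= j < M) gm a (S g (x + j * r) (x + j.+1 * r)) (S v (x + j * r) (x + j.+1 * r)) <= G.
  by rewrite /G sg sv; apply: gm_holder => // *; apply: S_ge0.
case: (pselect (near g v eta r M x)) => hn; last first.
- have eb : \rsum_(0 <= j < M) (A ^ (bad_cell g v eta th r M (K * M + j) : nat) *
     gm a (S g ((K * M + j) * r) ((K * M + j).+1 * r)) (S v ((K * M + j) * r) ((K * M + j).+1 * r))) =
     A * \rsum_(0 <= j < M) gm a (S g (x + j * r) (x + j.+1 * r)) (S v (x + j * r) (x + j.+1 * r)).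
    rewrite -rsumZ; apply: eq_big_nat => j /andP[_ hj]; rewrite cell cell1 /bad_cell K1 // -/x.
    by case: asboolP => //= _; rewrite Rmult_1_r.
  rewrite eb.
  set Sg := \rsum_(0 <= j < M) gm a _ _ in hold *.
  have [z|[hg hv]] : G = 0 \/ (0 < S g x (x + M * r) /\ 0 < S v x (x + M * r)).
    case: (Rle0_cases (S_ge0 g0 x (x + M * r))) => h1; first by left; rewrite /G h1 gm0l.
    case: (Rle0_cases (S_ge0 v0 x (x + M * r))) => h2; first by left; rewrite /G h2 gm0r.
    by right.
  - have : 0 <= Sg by apply: rsum_ge0 => *; apply: gm_ge0.
    by move=> ?; have -> : Sg = 0 by [lra]; rewrite z; lra.
  have lt : Sg <= (1 - Rmin a (1 - a) * (eta / 2) ^ 2) * G.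
    apply/Rlt_le/Rnot_le_lt => h; apply: hn; split => //; split => // j hj.
    rewrite [in S g x _]sg [in S v x _]sv.
    apply: (@gm_holder_stab a eta _ (index_iota 0 M) (fun j => S g (x + j * r) (x + j.+1 * r))
      (fun j => S v (x + j * r) (x + j.+1 * r))) => //; rewrite ?iota_uniq ?mem_index_iota -?sg -?sv //.
    - by move=> *; apply: S_ge0.
    - by move=> *; apply: S_ge0.
  have : A * Sg <= A * ((1 - Rmin a (1 - a) * (eta / 2) ^ 2) * G) by apply: Rmult_le_compat_l; lra.
  nra.
pose Pg := S g x (x + M * r).
have Pg0 : 0 <= Pg by apply: S_ge0.
apply: (@Rle_trans _ (\rsum_(0 <= j < M)
  (gm a (S g (x + j * r) (x + j.+1 * r)) (S v (x + j * r) (x + j.+1 * r)) + (A - 1) * (rpow th a * G)))).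
  rewrite big_nat_cond [Z in _ <= Z]big_nat_cond; apply: rsum_le => j /andP[/andP[_ hj] _].
  rewrite cell cell1 /bad_cell K1 // -/x -/Pg cell cell1.
  have b0 := gm_ge0 a (S g (x + j * r) (x + j.+1 * r)) (S v (x + j * r) (x + j.+1 * r)).
  have b1 : 0 <= (A - 1) * (rpow th a * G) by apply: Rmult_le_pos; [lra|apply: Rmult_le_pos].
  case: asboolP => //= _; case: asboolP => hs /=; last by lra.
  have : gm a (S g (x + j * r) (x + j.+1 * r)) (S v (x + j * r) (x + j.+1 * r)) <= rpow th a * G.
    rewrite /gm (_ : rpow th a * G = rpow (th * Pg) a * rpow (S v x (x + M * r)) (1 - a)); last first.
      by rewrite rpowM // /G /gm -/Pg; ring.
    apply: gm_le => //; try exact: S_ge0; first exact: Rlt_le.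
    apply: S_mono => //; first by rewrite leq_addr.
    by rewrite leq_add2l leq_mul2r hj orbT.
  nra.
rewrite rsumD rsum_const_nat subn0.
have : (1 + (A - 1) * (INR M * rpow th a)) * G <= lam * G by apply: Rmult_le_compat_r.
lra.
Qed.

Variables (T N m : nat).
Hypothesis TN : (T * N <= m)%N.
Let len t := (2 ^ (m - t * N))%N.
Let M := (2 ^ N)%N.

Lemma len_step t : (t < T)%N -> len t = (M * len t.+1)%N.
Proof.
move=> ht; rewrite /len /M -expnD; congr (2 ^ _)%N; rewrite mulSn.
have : (t.+1 * N <= T * N)%N by rewrite leq_mul2r ht orbT.
by rewrite mulSn; lia.
Qed.

Definition nbad (t w : nat) : nat :=
  (\sum_(t <= t' < T) (bad_cell g v eta th (len t'.+1) M (w %/ len t'.+1) : nat))%N.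

(* Downward induction on the level: a node that is not near loses a factor A in Hoelder's
   inequality, which pays for its bad children; elsewhere only the light cells are charged. *)
Lemma exp_moment (lam : R) : 1 + (A - 1) * (INR M * rpow th a) <= lam ->
  \rsum_(0 <= w < 2 ^ m) (A ^ nbad 0 w * gm a (g w) (v w)) <= lam ^ T * gm a (S g 0 (2 ^ m)) (S v 0 (2 ^ m)).
Proof.
move=> hlam.
suff main d t K : (t + d = T)%N ->
    S (fun w => A ^ nbad t w * gm a (g w) (v w)) (K * len t) (K * len t + len t) <=
    lam ^ d * gm a (S g (K * len t) (K * len t + len t)) (S v (K * len t) (K * len t + len t)).
  by have := main T 0%N 0%N (add0n _); rewrite /len !mul0n subn0 add0n.
elim: d t K => [|d IH] t K e.
  rewrite addn0 in e; rewrite /= Rmult_1_l e /S.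
  apply: (@Rle_trans _ (\rsum_(K * len T <= w < K * len T + len T) gm a (g w) (v w))); last first.
    by apply: gm_holder.
  apply: rsum_le => w _; rewrite /nbad big_geq //=; lra.
have ht : (t < T)%N by lia.
have lt0 : (0 < len t.+1)%N by rewrite expn_gt0.
rewrite (len_step ht) S_blocks.
apply: (@Rle_trans _ (\rsum_(0 <= j < M) (lam ^ d *
   (A ^ (bad_cell g v eta th (len t.+1) M (K * M + j) : nat) *
     gm a (S g ((K * M + j) * len t.+1) ((K * M + j).+1 * len t.+1)) (S v ((K * M + j) * len t.+1) ((K * M + j).+1 * len t.+1)))))).
  apply: rsum_le => j _.
  have ex : (K * (M * len t.+1) + j * len t.+1 = (K * M + j) * len t.+1)%N by rewrite mulnDl mulnA.
  have ex1 : (K * (M * len t.+1) + j.+1 * len t.+1 = (K * M + j) * len t.+1 + len t.+1)%N.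
    by rewrite mulSn mulnDl mulnA; lia.
  rewrite ex ex1 (_ : (K * M + j).+1 * len t.+1 = (K * M + j) * len t.+1 + len t.+1)%N; last first.
    by rewrite mulSn addnC.
  set k := (K * M + j)%N.
  have := IH t.+1 k ltac:(lia).
  rewrite (@eq_S (fun w => A ^ nbad t w * gm a (g w) (v w)) (fun w => A ^ (bad_cell g v eta th (len t.+1) M k : nat) *
     (A ^ nbad t.+1 w * gm a (g w) (v w)))); last first.
    move=> w /andP[h1 h2]; rewrite /nbad big_ltn // pow_add.
    have -> : (w %/ len t.+1 = k)%N.
      have -> : w = (k * len t.+1 + (w - k * len t.+1))%N by lia.
      by rewrite divnMDl // divn_small ?addn0 //; lia.
    by rewrite Rmult_assoc.
  rewrite /S rsumZ => h.
  set Z := A ^ _; have Z0 : 0 <= Z by apply: pow_le; lra.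
  have := Rmult_le_compat_l _ _ _ Z0 h.
  by rewrite -!Rmult_assoc (Rmult_comm Z (lam ^ d)).
rewrite rsumZ.
have := level_moment (len t.+1) K hlam.
have lam0 : 0 <= lam ^ d.
  apply: pow_le; apply: Rle_trans hlam.
  have := pos_INR M; have := rpow_ge0 th a => *.
  have z1 : 0 <= INR M * rpow th a by apply: Rmult_le_pos.
  have z2 : 0 <= (A - 1) * (INR M * rpow th a) by apply: Rmult_le_pos; lra.
  lra.
move=> h; have := Rmult_le_compat_l _ _ _ lam0 h.
by rewrite /= -Rmult_assoc (Rmult_comm lam).
Qed.

(** Markov's inequality for the exponential moment. *)
Lemma many_bad_small (lam : R) (k : nat) : 1 + (A - 1) * (INR M * rpow th a) <= lam ->
  A ^ k * \rsum_(0 <= w < 2 ^ m | (k <= nbad 0 w)%N) gm a (g w) (v w) <=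
  lam ^ T * gm a (S g 0 (2 ^ m)) (S v 0 (2 ^ m)).
Proof.
move=> hlam; apply: Rle_trans (exp_moment hlam).
rewrite -rsumZ big_mkcond; apply: rsum_le => w _.
have G0 := gm_ge0 a (g w) (v w).
case: ifP => h; last by apply: Rmult_le_pos => //; apply: pow_le; lra.
by apply: Rmult_le_compat_r => //; apply: Rle_pow => //; apply/leP.
Qed.
End Moment.

(** * Types of blocks *)

Lemma near_cumulative g v eta r M x : near g v eta r M x -> forall j, (j <= M)%N ->
  Rabs (S g x (x + j * r) / S g x (x + M * r) - S v x (x + j * r) / S v x (x + M * r)) <= INR M * eta.
Proof.
move=> [P0 [V0 h]] j hj.
rewrite (S_blocks g x r j) (S_blocks v x r j) /Rdiv !big_distrl -rsumB /=.
apply: Rle_trans (rsum_abs _ _ _) _.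
have eta0 : 0 <= eta \/ j = 0%N.
  case: j hj => [|j] hj; [by right|left].
  by apply: Rle_trans (h 0%N _); [apply: Rabs_pos|lia].
apply: (@Rle_trans _ (\rsum_(0 <= i < j) eta)).
  rewrite big_nat_cond [Z in _ <= Z]big_nat_cond; apply: rsum_le => i /andP[/andP[_ hi] _].
  by apply: h; lia.
rewrite rsum_const_nat subn0; case: eta0 => [e0|->].
  by apply: Rmult_le_compat_r => //; apply: le_INR; lia.
rewrite (_ : INR 0 = 0) // Rmult_0_l.
case: M h {P0 V0 hj} => [|M] h; first by rewrite /=; lra.
by apply: Rmult_le_pos; [apply: pos_INR|apply: Rle_trans (h 0%N _); [apply: Rabs_pos|]].
Qed.

Section Periodic.
Variables (p : nat -> R) (n : nat).
Hypotheses (p0 : forall k, 0 <= p k) (n0 : (0 < n)%N) (pn : forall k, p (k %% n)%N = p k).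

Lemma S_periodic u u' d : u = u' %[mod n] -> S p u (u + d) = S p u' (u' + d).
Proof.
move=> e; rewrite -{1}(add0n u) -{1}(add0n u') (addnC u d) (addnC u' d) !S_shift.
by apply: eq_S => k _; rewrite -pn -(pn (k + u')) -modnDmr e modnDmr.
Qed.

(** The value of [p] at [w - y] on the circle; adding [n - y] avoids truncated subtraction. *)
Definition win (y w : nat) : R := p (w + (n - y))%N.

Lemma S_win y u d : (y <= n)%N -> S (win y) u (u + d) = S p (u + (n - y)) (u + (n - y) + d).
Proof. by move=> hy; rewrite addnAC S_shift. Qed.

(** Nearness at [y1] and at [y1 + sg] refers to the same [v], so [p] is nearly proportional on two
    stretches that differ by [sg], and [window_spread] applies there. Nearness at [y], again through
    [v], carries the conclusion over to the window of [y], which need not belong to the pair. The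
    heavy cell [j0] turns additive errors into multiplicative ones. *)
Lemma local_spread (v : nat -> R) (eta th : R) (r M x y y1 sg j0 Rc k : nat) :
  (0 < r)%N -> (y <= n)%N -> (y1 < n)%N -> (r <= sg)%N -> (sg <= n)%N ->
  near (win y) v eta r M x -> near (win y1) v eta r M x -> near (win ((y1 + sg) %% n)) v eta r M x ->
  0 < th -> INR M * eta <= th / 200 ->
  th * S (win y) x (x + M * r) <= S (win y) (x + j0 * r) (x + j0.+1 * r) ->
  let i := (sg %/ r)%N in
  ((k + 5) * i.+1 <= Rc)%N -> (Rc <= j0)%N -> (j0 + Rc <= M)%N ->
  INR k * S (win y) (x + (j0 - i.+1) * r) (x + (j0 + i + 2) * r) <=
    7 * S (win y) (x + (j0 - Rc) * r) (x + (j0 + Rc) * r).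
Proof.
move=> r0 hy hy1 hr hsg ny n1 n2 th0 hM hth i hk h0 hj.
have i1 : (1 <= i)%N by rewrite divn_gt0.
have ir : (i * r <= sg)%N by apply: leq_divM.
have ir1 : (sg <= i.+1 * r)%N by apply/ltnW; rewrite ltn_ceil.
set A := (x + (n - y1) + n)%N.
set y2 := ((y1 + sg) %% n)%N in n2.
have hy2 : (y2 < n)%N by rewrite ltn_mod.
have c1E j d : S (win y1) (x + j) (x + j + d) = S p (A + j) (A + j + d).
  by rewrite S_win 1?ltnW //; apply: S_periodic; rewrite /A -(modnDr (x + j + (n - y1)) n); congr (_ %% _)%N; lia.
have c2E d : S (win y2) x (x + d) = S p (A - sg) (A - sg + d).
  rewrite S_win 1?ltnW //; apply: S_periodic; apply/eqP.
  rewrite -(eqn_modDr (y1 + sg)) /A.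
  have -> : (x + (n - y1) + n - sg + (y1 + sg) = x + n + n)%N by lia.
  rewrite -[eqbLHS]modnDmr -/y2.
  have -> : (x + (n - y2) + y2 = x + n)%N by lia.
  by rewrite !modnDr.
have P1 := n1.1; have P2 := n2.1.
have ny' := near_cumulative ny; have n1' := near_cumulative n1; have n2' := near_cumulative n2.
have c1E' j : S (win y1) x (x + j) = S p A (A + j) by have := c1E 0%N j; rewrite !addn0.
rewrite c1E' in P1; rewrite c2E in P2.
set e3 := 2 * (INR M * eta).
have near12 j : (j <= M)%N -> Rabs (S p A (A + j * r) / S p A (A + M * r) -
    S p (A - sg) (A - sg + j * r) / S p (A - sg) (A - sg + M * r)) <= e3.
  move=> hj'; have := n1' _ hj'; have := n2' _ hj'; rewrite !c1E' !c2E /e3.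
  by move=> /Rabs_le_bounds [? ?] /Rabs_le_bounds [? ?]; apply: Rabs_le; lra.
have sA : (sg <= A)%N by rewrite /A; lia.
have hi : (i.+1 <= Rc)%N by lia.
have main := window_spread p0 sA ir ir1 i1 P1 P2 near12 hk h0 hj.
set P := S p A (A + M * r) in P1 main.
set Py := S (win y) x (x + M * r) in hth.
have Py0 : 0 < Py := ny.1.
have w0 : forall z, 0 <= win y z by move=> z; apply: p0.
have le z z' : (z <= z')%N -> (x + z * r <= x + z' * r)%N.
  by move=> hz; rewrite leq_add2l leq_mul2r hz orbT.
have le' z z' : (z <= z')%N -> (A + z * r <= A + z' * r)%N.
  by move=> hz; rewrite leq_add2l leq_mul2r hz orbT.
have comp u u' : (u <= u')%N -> (u' <= M)%N ->
    - (2 * e3) <= S (win y) (x + u * r) (x + u' * r) / Py - S p (A + u * r) (A + u' * r) / P <= 2 * e3.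
  move=> hu hu'.
  have e1 : S (win y) (x + u * r) (x + u' * r) = S (win y) x (x + u' * r) - S (win y) x (x + u * r).
    by rewrite (@S_cat _ x (x + u * r)%N (x + u' * r)%N); [ring|apply: leq_addr|apply: le].
  have e2 : S p (A + u * r) (A + u' * r) = S p A (A + u' * r) - S p A (A + u * r).
    by rewrite (@S_cat _ A (A + u * r)%N (A + u' * r)%N); [ring|apply: leq_addr|apply: le'].
  rewrite e1 e2 !Rdiv_minus_distr.
  have := ny' _ hu'; have := ny' _ (leq_trans hu hu').
  have := n1' _ hu'; have := n1' _ (leq_trans hu hu').
  rewrite !c1E' -/P -/Py /e3.
  move=> /Rabs_le_bounds [? ?] /Rabs_le_bounds [? ?] /Rabs_le_bounds [? ?] /Rabs_le_bounds [? ?].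
  lra.
have cs := comp (j0 - i.+1)%N (j0 + i + 2)%N ltac:(lia) ltac:(lia).
have cb := comp (j0 - Rc)%N (j0 + Rc)%N ltac:(lia) ltac:(lia).
set sy := S (win y) (x + (j0 - i.+1) * r) (x + (j0 + i + 2) * r) in cs *.
set bY := S (win y) (x + (j0 - Rc) * r) (x + (j0 + Rc) * r) in cb *.
set s1 := S p (A + (j0 - i.+1) * r) (A + (j0 + i + 2) * r) in cs main.
set b1 := S p (A + (j0 - Rc) * r) (A + (j0 + Rc) * r) in cb main.
have sb : sy <= bY by apply: S_mono => //; apply: le; lia.
have ts : th * Py <= sy.
  by apply: Rle_trans hth _; apply: S_mono => //; apply: le; lia.
have k0 := pos_INR k.
have m1 : INR k * (s1 / P / 5 - 4 * e3) <= b1 / P.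
  apply: (Rmult_le_reg_r P) => //.
  have -> : INR k * (s1 / P / 5 - 4 * e3) * P = INR k * (s1 / 5 - 4 * e3 * P) by field; lra.
  by have -> : b1 / P * P = b1 by field; lra.
have ts' : th <= sy / Py.
  by apply: (Rmult_le_reg_r Py) => //; have -> : sy / Py * Py = sy by [field; lra].
have sb' : sy / Py <= bY / Py by apply: Rmult_le_compat_r => //; apply/Rlt_le/Rinv_0_lt_compat.
have e3th : e3 <= th / 100 by rewrite /e3; lra.
(* As [e3] is at most a hundredth of [sy / Py], the left side of [m1] is at least [78 / 500] of
   [INR k * (sy / Py)], and replacing [b1 / P] by [bY / Py] costs a factor [1.02]. The quotient of
   the two constants is below [7]. *)
have m2 : INR k * (sy / Py) <= 7 * (bY / Py).
  have : INR k * (sy / Py / 5 - 22 * e3 / 5) <= b1 / P.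
    by apply: Rle_trans m1; apply: Rmult_le_compat_l => //; lra.
  have : INR k * (sy / Py * (78 / 500)) <= INR k * (sy / Py / 5 - 22 * e3 / 5).
    by apply: Rmult_le_compat_l => //; lra.
  lra.
have := Rmult_le_compat_r Py _ _ (Rlt_le _ _ Py0) m2.
have -> : INR k * (sy / Py) * Py = INR k * sy by field; lra.
by have -> : 7 * (bY / Py) * Py = 7 * bY by field; lra.
Qed.
End Periodic.

Definition node_mass (m : nat) (p : nat -> R) (s z : nat) : R :=
  S p (z %/ 2 ^ (m - s) * 2 ^ (m - s)) (z %/ 2 ^ (m - s) * 2 ^ (m - s) + 2 ^ (m - s)).

Section Types.
Variables (m b D T : nat) (p v : nat -> R) (eta th : R).
Let N := (b * D)%N.
Let n := (2 ^ m)%N.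
Let M := (2 ^ N)%N.
Let Rc := (2 ^ (N - D))%N.
Hypotheses (D4 : (4 <= D)%N) (TN : (T * N <= m)%N).
Hypotheses (p0 : forall k, 0 <= p k) (pn : forall k, p (k %% n)%N = p k).
Hypotheses (th0 : 0 < th) (hM : INR M * eta <= th / 200).

Definition len (t : nat) := (2 ^ (m - t * N))%N.

Definition near_at (t K y : nat) : Prop := near (win p n y) v eta (len t.+1) M (K * len t).

Definition pair_at (t K sg : nat) : Prop :=
  exists y, (y < n)%N /\ near_at t K y /\ near_at t K ((y + sg) %% n).

(* tau records the smallest shift sg >= len t.+1 between two points near K:
   2^{-tau D} len t <= sg < 2^{-(tau-1) D} len t. *)
Definition type_at (t K tau : nat) : Prop :=
  (tau <= b)%N /\
  (forall sg, (len t.+1 <= sg)%N -> (sg < 2 ^ (m - t * N - tau * D))%N -> ~ pair_at t K sg) /\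
  (tau = 0%N \/ exists sg, (2 ^ (m - t * N - tau * D) <= sg)%N /\
     (sg < 2 ^ (m - t * N - tau.-1 * D))%N /\ pair_at t K sg).

(** [tau = b] always satisfies the exclusion, its range of shifts being empty. The least such [tau]
    is a type: the failure of the exclusion at [tau.-1] provides the shift. *)
Lemma type_exists t K : exists tau, type_at t K tau.
Proof.
pose P tau := `[< forall sg, (len t.+1 <= sg)%N -> (sg < 2 ^ (m - t * N - tau * D))%N -> ~ pair_at t K sg >].
have Pb : P b.
  apply/asboolP => sg h1 h2; exfalso; move: h1 h2; rewrite /len mulSn -/N.
  rewrite (_ : m - t * N - N = m - (N + t * N))%N; last lia.
  by rewrite leqNgt => /negP.
have ex : exists tau, P tau by exists b.
exists (ex_minn ex); case: ex_minnP => tau /asboolP h1 h2.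
split; first exact: h2.
split => //; case: tau h1 h2 => [|tau] h1 h2; [by left|right].
have /negP nP : ~ P tau by move/h2; rewrite ltnn.
have : exists sg, (len t.+1 <= sg)%N /\ (sg < 2 ^ (m - t * N - tau * D))%N /\ pair_at t K sg.
  apply: contrapT => h; move/negP: nP; apply; apply/asboolP => sg k1 k2 k3.
  by apply: h; exists sg.
move=> [sg [k1 [k2 k3]]]; exists sg; split => //.
by rewrite leqNgt; apply/negP => h; apply: (h1 sg).
Qed.

Definition cell_pos (t w : nat) := (w %/ len t.+1 %% M)%N.
(** [Rc] cells make up a share [2 ^ (- D)] of the block. This margin is the room in which
    [local_spread] compares windows. *)
Definition edge (t w : nat) : bool := ~~ ((Rc <= cell_pos t w)%N && (cell_pos t w + Rc <= M)%N).

(* The value b.+1 stands for a level that is bad or at the edge; it carries no information. *)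
Definition label_at (t w y tau : nat) : Prop :=
  if (tau <= b)%N then
    ~~ bad_cell (win p n y) v eta th (len t.+1) M (w %/ len t.+1) /\ ~~ edge t w /\
    type_at t (w %/ len t) tau
  else bad_cell (win p n y) v eta th (len t.+1) M (w %/ len t.+1) || edge t w.

Lemma label_exists t w y : exists tau, (tau < b.+2)%N /\ label_at t w y tau.
Proof.
case hb : (bad_cell (win p n y) v eta th (len t.+1) M (w %/ len t.+1) || edge t w).
  by exists b.+1; split => //; rewrite /label_at ltnn.
have [tau ht] := type_exists t (w %/ len t); exists tau; split; first by have := ht.1; lia.
by rewrite /label_at ht.1; move/negbT: hb; rewrite negb_or => /andP[].
Qed.

Lemma len_stepM t : (t < T)%N -> len t = (M * len t.+1)%N.
Proof. exact: len_step. Qed.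

Lemma node_divE t w : (t < T)%N -> (w %/ len t.+1 %/ M = w %/ len t)%N.
Proof. by move=> ht; rewrite -divnMA mulnC -len_stepM. Qed.

Lemma label_near t w y tau : (t < T)%N -> (tau <= b)%N -> label_at t w y tau ->
  near_at t (w %/ len t) y.
Proof.
move=> ht htau; rewrite /label_at htau => -[h _]; move: h; rewrite /bad_cell negb_or => /andP[h _].
by move/asboolPn: h => /contrapT; rewrite node_divE // -len_stepM.
Qed.

(** Both points are near in the block of the same [w], so their difference is the shift of a pair,
    and the type forbids shifts between [len t.+1] and the threshold. The common translation by [t2]
    preserves the difference. *)
Lemma close_points t w y y' t2 tau : (t < T)%N -> (tau <= b)%N -> (y < n)%N -> (y' < n)%N ->
  label_at t w y tau -> label_at t w y' tau ->
  let Y := ((y + t2) %% n)%N in let Y' := ((y' + t2) %% n)%N in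
  (Y <= Y')%N -> (Y' - Y < 2 ^ (m - t * N - tau * D))%N -> (Y' - Y < len t.+1)%N.
Proof.
move=> ht htau hy hy' l1 l2 Y Y' hYY h.
have n1 := label_near ht htau l1; have n2 := label_near ht htau l2.
rewrite ltnNge; apply/negP => hl.
move: l1; rewrite /label_at htau => -[_ [_ [_ [hno _]]]].
apply: (hno _ hl h); exists y; split => //; split => //.
suff -> : ((y + (Y' - Y)) %% n = y')%N by [].
rewrite -[RHS](modn_small hy'); apply/eqP.
rewrite -(eqn_modDr t2) addnAC -[eqbLHS]modnDml -/Y.
have -> : (Y + (Y' - Y) = Y')%N by lia.
by rewrite /Y' modn_mod.
Qed.

(** Three of the [tau] scales are given up: one because [sg] may be almost [2 ^ D] times the length
    of the node, one because the windows must fit into [Rc] cells, one to absorb the factor [7] of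
    [local_spread] and the rounding. For [tau <= 3] the claim is then just monotonicity of the
    mass. *)
Lemma ball_mass t w y t1 tau : (t < T)%N -> (tau <= b)%N -> (w < n)%N -> (y < n)%N -> (t1 < n)%N ->
  label_at t w y tau ->
  let z := ((w + (n - y) + t1) %% n)%N in
  in_half m (t * N) z ->
  INR (2 ^ (tau * D)) * node_mass m (fun k => p (k + (n - t1))%N) (t * N + tau * D) z <=
  INR (2 ^ (3 * D)) * node_mass m (fun k => p (k + (n - t1))%N) (t * N) z.
Proof.
move=> ht htau hw hy ht1 hl z hz.
set p' := fun k => _; have p'0 k : 0 <= p' k by apply: p0.
have tauN : (tau * D <= N)%N by rewrite leq_mul2r htau orbT.
have tN : (t * N + N <= m)%N.
  by apply: leq_trans TN; rewrite addnC -mulSn leq_mul2r ht orbT.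
set lam := (2 ^ (m - (t * N + tau * D)))%N.
have lam0 : (0 < lam)%N by rewrite expn_gt0.
have L0 : (0 < len t)%N by rewrite expn_gt0.
have lamL : (len t = 2 ^ (tau * D) * lam)%N.
  by rewrite /len /lam -expnD; congr (2 ^ _)%N; lia.
have zL : (z %/ lam = z %/ len t * 2 ^ (tau * D) + z %/ lam %% 2 ^ (tau * D))%N.
  by rewrite lamL (mulnC (2 ^ _)%N lam) divnMA -divn_eq.
have sub : node_mass m p' (t * N + tau * D) z <= node_mass m p' (t * N) z.
  rewrite /node_mass -/lam -/(len t); apply: S_mono => //.
    rewrite lamL mulnA leq_mul2r; apply/orP; right.
    by rewrite [X in (_ <= X)%N]zL -lamL leq_addr.
  rewrite [X in (X * lam + _)%N]zL -/(len t).
  have : (z %/ lam %% 2 ^ (tau * D) < 2 ^ (tau * D))%N by rewrite ltn_mod expn_gt0.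
  move: (z %/ lam %% 2 ^ (tau * D))%N (z %/ len t)%N => x X hx.
  rewrite lamL mulnDl -mulnA -addnA leq_add2l -mulSnr leq_mul2r.
  by rewrite hx orbT.
have nm0 : 0 <= node_mass m p' (t * N + tau * D) z by apply: S_ge0.
have [tau3|tau3] := leqP tau 3.
  apply: Rmult_le_compat => //; first exact: pos_INR.
  by apply: le_INR; apply/leP; rewrite leq_exp2l // leq_mul2r tau3 orbT.
have nr := label_near ht htau hl.
move: hl; rewrite /label_at htau => -[hb [he [_ [_ [//|[sg [sg1 [sg2 [y1 [hy1 [np1 np2]]]]]]]]]]]; first lia.
rewrite -subnDA -/lam in sg1.
move: he; rewrite /edge negbK => /andP[he1 he2].
set j0 := cell_pos t w in he1 he2.
set r := len t.+1 in nr np1 np2 hb *.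
set K := (w %/ len t)%N in nr np1 np2 hb *.
set x := (K * len t)%N in nr np1 np2.
have r0 : (0 < r)%N by rewrite expn_gt0.
have LE : len t = (M * r)%N := len_stepM ht.
have rlam : (r <= lam)%N by rewrite leq_exp2l // mulSn leq_sub2l // (addnC N) leq_add2l.
have wE : (w = x + j0 * r + w %% r)%N.
  by rewrite {1}(divn_eq w r) {1}(divn_eq (w %/ r) M) node_divE // mulnDl -mulnA -LE.
have rho : (w %% r < r)%N by rewrite ltn_mod.
set rh := (w %% r)%N in wE rho.
(* Unreduced versions of [z] and of the start of the block, without the translation [t1] and with
   one extra turn, so that intervals around [z] are compared without wrapping around. *)
set zN := (w + (n - y) + n)%N; set a' := (x + (n - y) + n)%N.
have zNE : (zN = a' + j0 * r + rh)%N by rewrite /zN {1}wE /a'; clear; lia.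
have n0 : (0 < n)%N by rewrite expn_gt0.
have shiftE d1 d : (d1 <= z)%N -> S p' (z - d1) (z - d1 + d) = S p (zN - d1) (zN - d1 + d).
  move=> h; rewrite /p' -S_shift addnAC; apply: S_periodic => //; apply/eqP.
  have zn : (z < n)%N by rewrite ltn_mod.
  rewrite -(eqn_modDr (t1 + d1)).
  have -> : (z - d1 + (n - t1) + (t1 + d1) = z + n)%N by move: h ht1; clear; lia.
  have -> : (zN - d1 + (t1 + d1) = w + (n - y) + t1 + n)%N by rewrite /zN; move: h zn; clear; lia.
  by rewrite !modnDr /z modn_mod.
have winE u u' : (u <= u')%N -> S (win p n y) (x + u) (x + u') = S p (a' + u) (a' + u').
  move=> hu; rewrite -(subnKC hu) !addnA S_win; last exact: ltnW.
  apply: S_periodic => //; rewrite /a'.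
  have -> : (x + (n - y) + n + u = x + u + (n - y) + n)%N by clear; lia.
  by rewrite modnDr.
set i := (sg %/ r)%N.
have hsgn : (sg <= n)%N by rewrite ltnW // (leq_trans sg2) // leq_exp2l //; clear; lia.
have ir1 : (sg <= i.+1 * r)%N by apply/ltnW; rewrite ltn_ceil.
have hi : (i.+1 <= 2 ^ (N - tau.-1 * D))%N.
  rewrite ltn_divLR // -expnD; apply: leq_trans sg2 _; rewrite leq_exp2l //.
  have : (tau.-1 * D <= N)%N by apply: leq_trans tauN; rewrite leq_mul2r leq_pred orbT.
  move: tN; rewrite mulSn; move: (t * N)%N (tau.-1 * D)%N; clear; lia.
(* The margin has [2 ^ (N - D)] cells and a window spans at most [2 ^ (N - tau.-1 * D)], so there is
   room for [2 ^ ((tau - 2) * D)] windows, five of which are reserved by [window_spread]. As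
   [2 ^ D >= 16], at least [7 * 2 ^ ((tau - 3) * D)] remain. *)
set k := (2 ^ ((tau - 2) * D) - 5)%N.
have D16 : (16 <= 2 ^ D)%N by rewrite (@leq_exp2l 2 4).
have tau2 : (2 ^ ((tau - 2) * D) = 2 ^ D * 2 ^ ((tau - 3) * D))%N.
  by rewrite -expnD -mulSn; congr (2 ^ (_ * _))%N; move: tau3; clear; lia.
have tau3p : (0 < 2 ^ ((tau - 3) * D))%N by rewrite expn_gt0.
have k5 : (k + 5 = 2 ^ ((tau - 2) * D))%N.
  by rewrite /k tau2; move: D16 tau3p; clear; nia.
have hk7 : (7 * 2 ^ ((tau - 3) * D) <= k)%N.
  by rewrite /k tau2; move: D16 tau3p; clear; nia.
have hkR : ((k + 5) * i.+1 <= Rc)%N.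
  rewrite k5; apply: leq_trans (leq_mul (leqnn _) hi) _.
  rewrite -expnD leq_exp2l //.
  have e1 : ((tau - 2) * D + D = tau.-1 * D)%N.
    by rewrite addnC -mulSn; congr (_ * _)%N; move: tau3; clear; lia.
  have : (tau.-1 * D <= N)%N by apply: leq_trans tauN; rewrite leq_mul2r leq_pred orbT.
  by move: e1; move: ((tau - 2) * D)%N (tau.-1 * D)%N; clear; lia.
have RM : ((Rc + 1) * 4 <= M)%N.
  have DN : (D <= N)%N.
    by rewrite /N leq_pmull //; move: htau tau3; clear; lia.
  have -> : (M = 2 ^ D * Rc)%N by rewrite /M /Rc -expnD subnKC.
  have : (0 < Rc)%N by rewrite expn_gt0.
  by move: D16; clear; nia.
have hcell : th * S (win p n y) x (x + M * r) <= S (win p n y) (x + j0 * r) (x + j0.+1 * r).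
  move: hb; rewrite /bad_cell negb_or => /andP[_ /asboolPn /Rnot_lt_le].
  rewrite node_divE // -LE -/K -/x.
  have wr : (w %/ r * r = x + j0 * r)%N.
    by move: wE; rewrite {1}(divn_eq w r) -/rh => /eqP; rewrite eqn_add2r => /eqP.
  rewrite -wr.
  by rewrite !mulSnr addnA -wr.
have main := local_spread p0 n0 pn r0 (ltnW hy) hy1 (leq_trans rlam sg1) hsgn nr np1 np2 th0 hM hcell hkR he1 he2.
rewrite -/i !winE in main; first last.
- by rewrite leq_mul2r; apply/orP; right; clear; lia.
- by rewrite leq_mul2r; apply/orP; right; clear; lia.
have iJ : (i.+1 <= j0)%N by apply: leq_trans he1; move: hkR; clear; nia.
(* The node contains [z] and has length [lam <= sg <= i.+1 * r], so it reaches at most [i.+1] cells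
   beyond the cell of [z] on either side. *)
have Q1 : node_mass m p' (t * N + tau * D) z <= S p (a' + (j0 - i.+1) * r) (a' + (j0 + i + 2) * r).
  have zq := divn_eq z lam.
  have rq : (z %% lam < lam)%N by rewrite ltn_mod.
  rewrite /node_mass -/lam.
  have -> : (z %/ lam * lam = z - z %% lam)%N by rewrite {2}zq addnK.
  rewrite shiftE ?leq_mod //.
  have IJr : (i.+1 * r <= j0 * r)%N by rewrite leq_mul2r iJ orbT.
  have -> : ((j0 + i + 2) * r = j0 * r + i.+1 * r + r)%N by rewrite -mulnDl -mulSnr; congr (_ * _)%N; clear; lia.
  rewrite mulnBl zNE.
  have aux (A J I R h q l s : nat) : (q < l -> l <= s -> s <= I -> I <= J -> h < R ->
      (A + (J - I) <= A + J + h - q) && (A + J + h - q + l <= A + (J + I + R)))%N by clear; lia.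
  by have /andP[u1 u2] := aux a' _ _ _ _ _ _ _ rq sg1 ir1 IJr rho; apply: S_mono.
(* Centrality of [z] enters here: the [Rc] cells on one side and the rounding take at most a quarter
   of the block, by [RM]. *)
have B1 : S p (a' + (j0 - Rc) * r) (a' + (j0 + Rc) * r) <= node_mass m p' (t * N) z.
  have zq := divn_eq z (len t).
  move: hz; rewrite /in_half -/(len t) => /andP[hz1 hz2].
  rewrite /node_mass -/(len t).
  have -> : (z %/ len t * len t = z - z %% len t)%N by rewrite {2}zq addnK.
  rewrite shiftE ?leq_mod //.
  have RJr : (Rc * r <= j0 * r)%N by rewrite leq_mul2r he1 orbT.
  have RMr : (4 * (Rc * r) + 4 * r <= len t)%N.
    rewrite LE; apply: leq_trans (leq_mul RM (leqnn r)); clear; lia.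
  rewrite mulnBl mulnDl zNE.
  have aux (A J I R h q l : nat) : (l <= 4 * q -> 4 * q < 3 * l -> I <= J -> 4 * I + 4 * R <= l -> h < R ->
      (A + J + h - q <= A + (J - I)) && (A + (J + I) <= A + J + h - q + l))%N by clear; lia.
  by have /andP[u1 u2] := aux a' _ _ _ _ _ _ hz1 hz2 RJr RMr rho; apply: S_mono.
set Q := node_mass _ _ _ _ in Q1 *; set I := node_mass _ _ _ _ in B1 *.
have Q0 : 0 <= Q by apply: S_ge0.
have h7 : INR (7 * 2 ^ ((tau - 3) * D))%N * Q <= 7 * I.
  apply: (@Rle_trans _ (INR k * Q)).
    by apply: Rmult_le_compat_r => //; apply: le_INR; apply/leP.
  apply: Rle_trans (Rmult_le_compat_l _ _ _ (pos_INR k) Q1) _.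
  apply: Rle_trans main _; lra.
have -> : (2 ^ (tau * D) = 2 ^ (3 * D) * 2 ^ ((tau - 3) * D))%N.
  by rewrite -expnD -mulnDl; congr (2 ^ (_ * _))%N; move: tau3; clear; lia.
rewrite mult_INR Rmult_assoc; apply: Rmult_le_compat_l; first exact: pos_INR.
move: h7; rewrite mult_INR (_ : INR 7 = 7); [lra|by rewrite /=; lra].
Qed.
End Types.

(** * Pairs, labels and pigeonholing *)

Lemma modI_eq m x y : x = y %[mod 2 ^ m] -> modI m x = modI m y.
Proof. by move=> h; apply: val_inj. Qed.

Lemma modI_val m (x : 'I_(2 ^ m)) : modI m x = x.
Proof. by apply: val_inj; rewrite /= modn_small. Qed.

Definition addI m (x t : 'I_(2 ^ m)) : 'I_(2 ^ m) := modI m (x + t).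
Definition subI m (x t : 'I_(2 ^ m)) : 'I_(2 ^ m) := modI m (x + (2 ^ m - t)).

Lemma subK_mod n (t : nat) u : (t <= n)%N -> (u + (n - t) + t = u %[mod n])%N.
Proof. by move=> h; rewrite -addnA subnK // modnDr. Qed.

Lemma addK_mod n (t : nat) u : (t <= n)%N -> (u + t + (n - t) = u %[mod n])%N.
Proof. by move=> h; rewrite -addnA subnKC // modnDr. Qed.

Lemma addIK m (t : 'I_(2 ^ m)) : cancel (fun x => addI x t) (fun x => subI x t).
Proof.
move=> x; rewrite /addI /subI -[RHS]modI_val; apply: modI_eq.
by rewrite /= modnDml addK_mod // ltnW.
Qed.

Lemma subIK m (t : 'I_(2 ^ m)) : cancel (fun x => subI x t) (fun x => addI x t).
Proof.
move=> x; rewrite /addI /subI -[RHS]modI_val; apply: modI_eq.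
by rewrite /= modnDml subK_mod // ltnW.
Qed.

Lemma addIC m (x t : 'I_(2 ^ m)) : addI x t = addI t x.
Proof. by rewrite /addI addnC. Qed.

Lemma subI_inj m (t : 'I_(2 ^ m)) : injective (fun x => subI x t).
Proof. exact: can_inj (subIK t). Qed.

Lemma subII m (w : 'I_(2 ^ m)) : involutive (subI w).
Proof.
move=> y; rewrite /subI -[RHS]modI_val; apply: modI_eq; apply/eqP.
set n := (2 ^ m)%N.
set z := ((w + (n - y)) %% n)%N.
have zn : (z < n)%N by rewrite ltn_mod pos2m.
rewrite -(eqn_modDr z) /= -/n -/z subK_mod ?(ltnW zn) //.
by rewrite /z modnDmr addnCA subnKC ?modnDr // ltnW.
Qed.

Lemma convE m (mu nu : 'I_(2 ^ m) -> R) w :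
  conv mu nu w = \rsum_y (nu y * mu (subI w y)).
Proof.
rewrite /conv /rsum (reindex_inj (inv_inj (subII w))) /=.
by apply: eq_big => [y|y _]; rewrite ?inE // -/(subI w y) -/(subI w (subI w y)) subII Rmult_comm.
Qed.

Lemma transl_subI m (t : 'I_(2 ^ m)) (mu : 'I_(2 ^ m) -> R) x : transl t mu x = mu (subI x t).
Proof. by []. Qed.

Lemma sum_S m (F : nat -> R) : S F 0 (2 ^ m) = \big[Rplus/R0]_(i < 2 ^ m) F i.
Proof. by rewrite /S big_mkord. Qed.

Lemma mass_exists m (mu : 'I_(2 ^ m) -> R) : measure2 mu -> exists i, p2 (- INR m) <= mu i.
Proof.
move=> [mu0 mu1]; apply: contrapT => /forallNP h.
have e : INR (2 ^ m)%N * p2 (- INR m) = 1 by rewrite -p2_nat Rmult_comm p2N.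
have s1 : \rsum_i mu i = 1 by rewrite -mu1 /rsum; apply: eq_bigl => i; rewrite inE.
have s2 : \big[Rplus/R0]_(i < 2 ^ m) p2 (- INR m) = 1 by rewrite rsum_const card_ord.
have : \rsum_i mu i < \big[Rplus/R0]_(i < 2 ^ m) p2 (- INR m).
  have i0 : 'I_(2 ^ m) := Ordinal (pos2m m).
  rewrite (bigD1 i0) //= [Z in _ < Z](bigD1 i0) //=; apply: Rplus_lt_le_compat.
    by apply/Rnot_le_lt/h.
  by apply: rsum_le => i _; apply/Rlt_le/Rnot_le_lt/h.
lra.
Qed.

Lemma dyadic_class (x : R) (k : nat) : x <= 1 -> p2 (- INR k) < x ->
  exists j : 'I_k, p2 (- INR j.+1) < x <= 2 * p2 (- INR j.+1).
Proof.
move=> x1; elim: k => [|k IH]; first by rewrite /= Ropp_0 p2_0; lra.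
move=> hx; case: (Rlt_le_dec (p2 (- INR k)) x) => h.
  by have [j hj] := IH h; exists (widen_ord (leqnSn k) j).
exists ord_max; split => //.
rewrite -{1}p2_1 -p2D; apply: Rle_trans h _; apply: p2_le.
rewrite [nat_of_ord _]/= S_INR; lra.
Qed.

(** * Weighted pairs, and the extraction of two sets from one label *)

Section Core.
Variables (q : R) (m b D T l k1 k2 : nat) (eta th A lam eps bt : R).
Hypotheses (q1 : 1 < q).
Let a := 1 / q.
Let N := (b * D)%N.
Let n := (2 ^ m)%N.
Let M := (2 ^ N)%N.
Hypotheses (D4 : (4 <= D)%N) (TN : (T * N <= m)%N) (b1 : (1 <= b)%N) (Tb : (T * b <= l)%N).
Hypotheses (eta0 : 0 <= eta) (th0 : 0 < th) (hM : INR M * eta <= th / 200) (A1 : 1 <= A).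
Hypothesis A2 : A * (1 - Rmin a (1 - a) * (eta / 2) ^ 2) <= 1.
Hypothesis hlam : 1 + (A - 1) * (INR M * rpow th a) <= lam.
Variables (mu nu : 'I_(2 ^ m) -> R).
Hypotheses (mmu : measure2 mu) (mnu : measure2 nu).

Let p (k : nat) := rpow (mu (modI m k)) q.
(** Cutting off the points often at an edge inside [v], and not in the sum over pairs, leaves the
    total weight equal to the sum of [v] and lets Hoelder's inequality run over the whole tree. *)
Let Omega (w : nat) := (\sum_(t < T) (edge m b D t w : nat) <= k1)%N.
Let v (w : nat) := if Omega w then rpow (conv mu nu (modI m w)) q else 0.
Let Vt := \big[Rplus/R0]_(w < 2 ^ m) v w.
Let pt := \rsum_i rpow (mu i) q.
Let G := gm a pt Vt.
(* Summing X over y gives conv mu nu w ^ q on Omega (total_weight); for fixed y, summing over w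
   is a Hoelder sum comparing the window of mu ^ q at w - y with conv mu nu ^ q. *)
Let X (u : 'I_(2 ^ m) * 'I_(2 ^ m)) := nu u.2 * gm a (rpow (mu (subI u.1 u.2)) q) (v u.1).

Let a0 : 0 < a. Proof. by apply: Rdiv_lt_0_compat; lra. Qed.
Let a1 : a < 1.
Proof. by apply: (Rmult_lt_reg_r q); rewrite /a; [lra|field_simplify; lra]. Qed.
Let aq : q * a = 1. Proof. by rewrite /a; field; lra. Qed.

Let mu0 i : 0 <= mu i. Proof. exact: mmu.1. Qed.
Let nu0 i : 0 <= nu i. Proof. exact: mnu.1. Qed.
Let nu1 : \rsum_i nu i = 1.
Proof. by rewrite -mnu.2 /rsum; apply: eq_bigl => i; rewrite inE. Qed.
Let mu1 : \rsum_i mu i = 1.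
Proof. by rewrite -mmu.2 /rsum; apply: eq_bigl => i; rewrite inE. Qed.
Let p0 k : 0 <= p k. Proof. exact: rpow_ge0. Qed.
Let v0 k : 0 <= v k. Proof. by rewrite /v; case: ifP => _; [exact: rpow_ge0|lra]. Qed.
Let pn k : p (k %% n)%N = p k.
Proof. by rewrite /p (@modI_eq m (k %% n) k) // modn_mod. Qed.
Let conv0 w : 0 <= conv mu nu w.
Proof. by rewrite convE; apply: rsum_ge0 => y _; apply: Rmult_le_pos. Qed.
Let X0 u : 0 <= X u.
Proof. by apply: Rmult_le_pos => //; apply: gm_ge0. Qed.
Let rq x : 0 <= x -> rpow (rpow x q) a = x.
Proof. by move=> h; rewrite rpow_rpow // aq rpow1. Qed.
Let XE u : X u = nu u.2 * (mu (subI u.1 u.2) * rpow (v u.1) (1 - a)).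
Proof. by rewrite /X /gm rq. Qed.
Let Vt0 : 0 <= Vt. Proof. by apply: rsum_ge0. Qed.

Lemma total_weight : \rsum_u X u = Vt.
Proof.
have -> : \rsum_u X u = \rsum_w \rsum_y X (w, y).
  by rewrite pair_bigA /=; apply: eq_bigr => -[].
rewrite /Vt; apply: eq_bigr => w _.
have -> : \rsum_y X (w, y) = conv mu nu w * rpow (v w) (1 - a).
  rewrite convE big_distrl /=; apply: eq_bigr => y _; rewrite XE /=; ring.
rewrite /v modI_val; case: ifP => _; last by rewrite rpow0; lra.
rewrite rpow_rpow // -{1}(rpow1 (conv0 w)) -rpowD //; congr rpow.
have -> : 1 + q * (1 - a) = 1 + q - q * a by ring.
by rewrite aq; ring.
Qed.

Let pt_gt0 : 0 < pt.
Proof.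
have [i hi] := mass_exists mmu.
have : rpow (mu i) q <= pt.
  by apply: (@rsum_ge_term _ predT (fun i => rpow (mu i) q)) => // j _; apply: rpow_ge0.
have := @rpow_gt0 (mu i) q; have := p2_gt0 (- INR m); move=> h1 h2.
by have := h2 ltac:(lra); lra.
Qed.

Let pt_S y : (y <= n)%N -> S (win p n y) 0 n = pt.
Proof.
move=> hy; rewrite -[in S _ 0 n](add0n n) S_win // add0n.
have -> : S p (n - y) (n - y + n) = S p 0 (0 + n).
  have e : ((n - y) + y = 0 %[mod n])%N by rewrite subnK // modnn mod0n.
  have sp : S p 0 (n - y) = S p n (n + (n - y)).
    by have := S_periodic pn (u := 0) (u' := n) (n - y); rewrite add0n; apply; rewrite modnn mod0n.
  have h1 : S p 0 (n - y + n) = S p 0 n + S p n (n + (n - y)).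
    by rewrite (addnC n (n - y)%N) -S_cat //; apply: leq_addl.
  have h2 : S p 0 (n - y + n) = S p 0 (n - y) + S p (n - y) (n - y + n).
    by rewrite -S_cat //; apply: leq_addr.
  rewrite add0n; lra.
rewrite add0n sum_S /pt; apply: eq_bigr => i _.
by rewrite /p modI_val.
Qed.

Hypothesis HO : / 2 * \rsum_w rpow (conv mu nu w) q <= Vt.
Hypothesis Hnorm : p2 (- eps * INR m * q) * pt <= \rsum_w rpow (conv mu nu w) q.

(** The total is [Vt], that is [gm a Vt Vt]; the norm hypothesis allows one of the two arguments to
    be replaced by a multiple of [pt]. The power [a] turns the loss [2 ^ (- eps * m * q)] into
    [2 ^ (- eps * m)]. *)
Lemma total_lower : / 2 * p2 (- eps * INR m) * G <= \rsum_u X u.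
Proof.
rewrite total_weight -[Z in _ <= Z](gm_id a Vt0).
have P := p2_gt0 (- eps * INR m * q).
have h : / 2 * p2 (- eps * INR m * q) * pt <= Vt by lra.
have hx : 0 <= / 2 * p2 (- eps * INR m * q) * pt.
  by apply: Rmult_le_pos; lra.
apply: Rle_trans (gm_le a0 a1 hx Vt0 h (Rle_refl _)).
rewrite /gm /G rpowM; [|nra|lra].
rewrite rpowM; [|lra|lra].
rewrite p2_rpow (_ : - eps * INR m * q * a = - eps * INR m); last by rewrite Rmult_assoc aq; ring.
have h2 : / 2 <= rpow (/ 2) a.
  have -> : / 2 = p2 (- (1)) by have := p2N 1; rewrite p2_1 => e; lra.
  by rewrite p2_rpow; apply: p2_le; lra.
rewrite /gm.
have := p2_gt0 (- eps * INR m); have := rpow_ge0 pt a; have := rpow_ge0 Vt (1 - a) => z1 z2 z3.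
have z4 : 0 <= p2 (- eps * INR m) * (rpow pt a * rpow Vt (1 - a)) by apply: Rmult_le_pos; [lra|nra].
nra.
Qed.

Let nb (w y : nat) := nbad eta th (win p n y) v T N m 0 w.

Lemma bad_weight : A ^ k2 * \rsum_(u : 'I_(2 ^ m) * 'I_(2 ^ m) | (k2 <= nb u.1 u.2)%N) X u <= lam ^ T * G.
Proof.
have -> : \rsum_(u : 'I_(2 ^ m) * 'I_(2 ^ m) | (k2 <= nb u.1 u.2)%N) X u =
    \rsum_(y : 'I_(2 ^ m)) \rsum_(w : 'I_(2 ^ m) | (k2 <= nb w y)%N) X (w, y).
  rewrite (exchange_big_dep predT) //= pair_big_dep /=.
  by apply: eq_big => -[].
rewrite -rsumZ -(Rmult_1_l (lam ^ T * G)) -nu1 big_distrl /=; apply: rsum_le => y _.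
have := @many_bad_small a eta th A a0 a1 eta0 (Rlt_le _ _ th0) A1 A2 (win p n y) v
  (fun k => p0 _) v0 T N m TN lam k2 hlam.
rewrite pt_S; last by rewrite ltnW.
rewrite sum_S -/Vt -/G big_mkord => h.
have -> : \rsum_(w : 'I_(2 ^ m) | (k2 <= nb w y)%N) X (w, y) =
    nu y * \rsum_(w < 2 ^ m | (k2 <= nb w y)%N) gm a (win p n y w) (v w).
  by rewrite -rsumZ.
have := Rmult_le_compat_l _ _ _ (nu0 y) h.
by rewrite -!Rmult_assoc (Rmult_comm (nu y) (A ^ k2)).
Qed.

(** Of the exponent [3 * m], one [m] pays for the number of points, one for the lower bound
    [2 ^ (- m)] on the largest atom of [mu], and one remains as a gain. Above this level only
    [3 * m] dyadic classes are needed. *)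
Definition small := p2 (- INR (3 * m)).

Let G_lower : p2 (- INR m) * rpow Vt (1 - a) <= G.
Proof.
rewrite /G /gm; apply: Rmult_le_compat_r; first exact: rpow_ge0.
have [i hi] := mass_exists mmu.
rewrite -(@rq (p2 (- INR m))); last exact/Rlt_le/p2_gt0.
apply: rpow_le; [lra|exact: rpow_ge0|].
apply: (@Rle_trans _ (rpow (mu i) q)).
  by apply: rpow_le => //; [lra|exact/Rlt_le/p2_gt0].
by apply: (@rsum_ge_term _ predT (fun i => rpow (mu i) q)) => // j _; apply: rpow_ge0.
Qed.

Lemma small_mu_weight :
  \rsum_(u : 'I_(2 ^ m) * 'I_(2 ^ m) | ~~ `[< small < mu (subI u.1 u.2) >]) X u <= p2 (- INR m) * G.
Proof.
apply: (@Rle_trans _ (\rsum_(u : 'I_(2 ^ m) * 'I_(2 ^ m)) (nu u.2 * (small * rpow Vt (1 - a))))).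
  rewrite big_mkcond; apply: rsum_le => u _.
  have s0 := p2_gt0 (- INR (3 * m)).
  have r0 := rpow_ge0 Vt (1 - a); have h0 := nu0 u.2.
  case: ifP => [/asboolPn /Rnot_lt_le h|_]; last first.
    by apply: Rmult_le_pos => //; apply: Rmult_le_pos => //; apply: Rlt_le.
  rewrite XE; apply: Rmult_le_compat_l => //; apply: Rmult_le_compat => //; first exact: rpow_ge0.
  apply: rpow_le => //; [lra|].
  by apply: (@rsum_ge_term _ predT (fun w : 'I_(2 ^ m) => v w)).
have -> : \rsum_(u : 'I_(2 ^ m) * 'I_(2 ^ m)) (nu u.2 * (small * rpow Vt (1 - a))) =
    \rsum_(w : 'I_(2 ^ m)) \rsum_(y : 'I_(2 ^ m)) (nu y * (small * rpow Vt (1 - a))).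
  by rewrite pair_bigA.
rewrite -big_distrl /= nu1 rsum_const card_ord Rmult_1_l -p2_nat -Rmult_assoc.
have -> : p2 (INR m) * small = p2 (- INR m) * p2 (- INR m).
  by rewrite /small -!p2D mult_INR; congr p2; rewrite /=; ring.
by rewrite Rmult_assoc; apply: Rmult_le_compat_l => //; apply/Rlt_le/p2_gt0.
Qed.

Lemma small_nu_weight :
  \rsum_(u : 'I_(2 ^ m) * 'I_(2 ^ m) | ~~ `[< small < nu u.2 >]) X u <= p2 (- INR m) * G.
Proof.
have -> : \rsum_(u : 'I_(2 ^ m) * 'I_(2 ^ m) | ~~ `[< small < nu u.2 >]) X u =
    \rsum_(y : 'I_(2 ^ m) | ~~ `[< small < nu y >]) \rsum_(w : 'I_(2 ^ m)) X (w, y).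
  rewrite exchange_big /= pair_big /=.
  by apply: eq_big => -[].
have s0 : 0 < small := p2_gt0 (- INR (3 * m)).
have G0 : 0 <= G by apply: gm_ge0.
apply: (@Rle_trans _ (\rsum_(y : 'I_(2 ^ m)) (small * G))).
  rewrite big_mkcond; apply: rsum_le => y _.
  case: ifP => [/asboolPn /Rnot_lt_le h|_]; last by apply: Rmult_le_pos => //; lra.
  rewrite /X /= rsumZ; apply: Rmult_le_compat => //.
    by apply: rsum_ge0 => w _; apply: gm_ge0.
  apply: Rle_trans (gm_holder _ a0 a1 _ _) _ => //; [by move=> *; apply: rpow_ge0|].
  rewrite -/Vt (_ : \rsum_(w : 'I_(2 ^ m)) rpow (mu (subI w y)) q = pt); first exact: Rle_refl.
  by rewrite /pt [RHS](reindex_inj (@subI_inj m y)).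
rewrite rsum_const card_ord -Rmult_assoc -p2_nat; apply: Rmult_le_compat_r => //.
rewrite /small -p2D; apply: p2_le; rewrite mult_INR /=.
have := pos_INR m; lra.
Qed.

Let E (u : 'I_(2 ^ m) * 'I_(2 ^ m)) : bool :=
  [&& Omega u.1, (nb u.1 u.2 < k2)%N, `[< small < mu (subI u.1 u.2) >] & `[< small < nu u.2 >]].

Hypothesis Hbad : lam ^ T <= / 8 * p2 (- eps * INR m) * A ^ k2.
Hypothesis Hm : p2 (- INR m) <= / 16 * p2 (- eps * INR m).

(** From the share [1 / 2] of [total_lower] one subtracts [1 / 8] for pairs with many bad levels and
    twice [1 / 16] for small values of [mu] and of [nu]. *)
Lemma good_weight : / 4 * p2 (- eps * INR m) * G <= \rsum_(u | E u) X u.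
Proof.
have G0 : 0 <= G by apply: gm_ge0.
have split4 : \rsum_u X u <= \rsum_(u | E u) X u +
    (\rsum_(u : 'I_(2 ^ m) * 'I_(2 ^ m) | (k2 <= nb u.1 u.2)%N) X u +
    (\rsum_(u : 'I_(2 ^ m) * 'I_(2 ^ m) | ~~ `[< small < mu (subI u.1 u.2) >]) X u +
     \rsum_(u : 'I_(2 ^ m) * 'I_(2 ^ m) | ~~ `[< small < nu u.2 >]) X u)).
  rewrite [Z in _ <= Z + _]big_mkcond [Z in _ <= _ + (Z + _)]big_mkcond.
  rewrite [Z in _ <= _ + (_ + (Z + _))]big_mkcond [Z in _ <= _ + (_ + (_ + Z))]big_mkcond -!rsumD.
  apply: rsum_le => u _; have Xu := X0 u; rewrite /E ltnNge.
  case hO: (Omega u.1) => /=; last first.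
    have -> : X u = 0 by rewrite /X /v hO gm0r; lra.
    by do 3 (case: ifP => _); lra.
  by case: (k2 <= _)%N => /=; case: `[< _ >] => /=; case: `[< _ >] => /=; lra.
have h1 := total_lower; have h2 := bad_weight; have h3 := small_mu_weight; have h4 := small_nu_weight.
have Ak : 0 < A ^ k2 by apply: pow_lt; lra.
have h2' : \rsum_(u : 'I_(2 ^ m) * 'I_(2 ^ m) | (k2 <= nb u.1 u.2)%N) X u <= / 8 * p2 (- eps * INR m) * G.
  apply: (Rmult_le_reg_l (A ^ k2)) => //; apply: Rle_trans h2 _.
  have := Rmult_le_compat_r _ _ _ G0 Hbad; lra.
have := Rmult_le_compat_r _ _ _ G0 Hm; lra.
Qed.

Definition mid (l m D : nat) (x : 'I_(2 ^ m)) : bool := [forall s : 'I_l, in_half m (s * D) x].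

Let Lb : finType := ({ffun 'I_T -> 'I_b.+2} * ('I_(3 * m) * 'I_(3 * m)) * ('I_(2 ^ m) * 'I_(2 ^ m)))%type.

Let rel (u : 'I_(2 ^ m) * 'I_(2 ^ m)) (L : Lb) : bool :=
  [&& `[< forall t : 'I_T, label_at m b D p v eta th t u.1 u.2 (L.1.1 t) >],
      `[< p2 (- INR L.1.2.1.+1) < mu (subI u.1 u.2) <= 2 * p2 (- INR L.1.2.1.+1) >],
      `[< p2 (- INR L.1.2.2.+1) < nu u.2 <= 2 * p2 (- INR L.1.2.2.+1) >],
      mid l D (addI (subI u.1 u.2) L.2.1) & mid l D (addI u.2 L.2.2)].

Let cM := #|[pred x : 'I_(2 ^ m) | mid l D x]|.

Let le1 (g : 'I_(2 ^ m) -> R) : (forall i, 0 <= g i) -> \rsum_i g i = 1 -> forall i, g i <= 1.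
Proof. by move=> g0 <- i; apply: (@rsum_ge_term _ predT g). Qed.

(** Types and dyadic classes exist for every good pair, and translations can carry [w - y] and [y]
    to any two central points. Hence pigeonholing over translations costs only the square of
    [2 ^ m / cM], at most [(2 ^ l) ^ 2]. *)
Lemma labels_card u : E u -> (cM * cM <= #|[pred L | rel u L]|)%N.
Proof.
case: u => w y /and4P[_ _ /asboolP hmu /asboolP hnu].
rewrite /= in hmu hnu.
have [j1 hj1] := dyadic_class (le1 mu0 mu1 _) hmu.
have [j2 hj2] := dyadic_class (le1 nu0 nu1 _) hnu.
have /choice [f hf] : forall t : 'I_T, exists c : 'I_b.+2, label_at m b D p v eta th t w y c.
  by move=> t; have [c [hc lc]] := label_exists p v eta th D4 TN t w y; exists (Ordinal hc).
pose h (xx : 'I_(2 ^ m) * 'I_(2 ^ m)) : Lb := ([ffun t => f t], (j1, j2), (subI xx.1 (subI w y), subI xx.2 y)).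
have hinj : injective h.
  move=> [x1 x2] [x1' x2'] e.
  have e1 : subI x1 (subI w y) = subI x1' (subI w y) := congr1 (fun L : Lb => L.2.1) e.
  have e2 : subI x2 y = subI x2' y := congr1 (fun L : Lb => L.2.2) e.
  by rewrite (subI_inj e1) (subI_inj e2).
rewrite -cardX -(card_image hinj); apply: subset_leq_card; apply/subsetP => L /imageP[[x1 x2]].
rewrite !inE /= => /andP[m1 m2] ->; rewrite /rel /= (addIC (subI w y)) (addIC y) !subIK m1 m2 !andbT.
apply/and3P; split; apply/asboolP => // t; rewrite ffunE; exact: hf.
Qed.

Hypothesis HcM : (2 ^ m <= cM * 2 ^ l)%N.
Hypothesis Hcount : INR (b.+2 ^ T * (3 * m) ^ 2 * (2 ^ l) ^ 2) * p2 (- bt * INR m) <= / 4 * p2 (- eps * INR m).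

Let G_gt0 : 0 < G.
Proof.
have Vt_gt0 : 0 < Vt.
  apply: Rlt_le_trans HO; have := p2_gt0 (- eps * INR m * q) => h.
  have : 0 < p2 (- eps * INR m * q) * pt by apply: Rmult_lt_0_compat.
  lra.
by apply: gm_gt0.
Qed.

Lemma good_label : exists L, p2 (- bt * INR m) * G <= \rsum_(u | E u && rel u L) X u.
Proof.
have m0 : (0 < m)%N.
  case: (posnP m) => // e; exfalso.
  move: Hm; rewrite e /= !Rmult_0_r Ropp_0 p2_0; lra.
have n0 : (0 < 2 ^ m)%N := pos2m m.
have [|||L hL] := @rsum_pigeonhole _ Lb X E rel (cM * cM).
- by [].
- exact: labels_card.
- by rewrite !card_prod card_ffun !card_ord !muln_gt0 expn_gt0 n0 m0.
exists L; set s := \rsum_(u | E u && rel u L) X u in hL *.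
have s0 : 0 <= s by apply: rsum_ge0.
have gw := good_weight.
have cM0 : (0 < cM)%N by rewrite lt0n; apply/eqP => c0; move: HcM; rewrite c0; move: n0; lia.
have cL : (#|Lb| <= (b.+2 ^ T * (3 * m) ^ 2 * (2 ^ l) ^ 2) * (cM * cM))%N.
  rewrite !card_prod card_ffun !card_ord -!mulnn.
  apply: leq_trans (leq_mul (leqnn _) (leq_mul HcM HcM)) _.
  by move: (b.+2 ^ T)%N (3 * m)%N cM (2 ^ l)%N; clear; lia.
have c0 : 0 < INR (cM * cM) by apply: lt_0_INR; apply/ltP; rewrite muln_gt0 cM0.
have := le_INR _ _ (leP cL); rewrite mult_INR => cL'.
move: Hcount cL'; set Z := INR (b.+2 ^ T * _ * _); set C := INR (cM * cM) in hL c0 * => Hc cL'.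
have Z0 : 0 <= Z by apply: pos_INR.
have h1 : C * (/ 4 * p2 (- eps * INR m) * G) <= Z * C * s.
  apply: Rle_trans (Rmult_le_compat_l _ _ _ (Rlt_le _ _ c0) gw) _; apply: Rle_trans hL _.
  by apply: Rmult_le_compat_r.
have h2 : / 4 * p2 (- eps * INR m) * G <= Z * s by apply: (Rmult_le_reg_l C) => //; lra.
have h3 := Rmult_le_compat_r _ _ _ (Rlt_le _ _ G_gt0) Hc.
have Z1 : 0 < Z.
  apply: lt_0_INR; apply/ltP; rewrite !muln_gt0 !expn_gt0 /=; move: m0; clear; lia.
by apply: (Rmult_le_reg_l Z) => //; lra.
Qed.

Section Extract.
Variable L : Lb.
Hypothesis HL : p2 (- bt * INR m) * G <= \rsum_(u | E u && rel u L) X u.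
Let E1 u := E u && rel u L.
Let al := p2 (- INR L.1.2.1.+1).
Let A1s : {set 'I_(2 ^ m)} := [set z | [exists u, E1 u && (z == subI u.1 u.2)]].
Let B1s w : {set 'I_(2 ^ m)} := [set y | E1 (w, y)].

Let E1A u : E1 u -> subI u.1 u.2 \in A1s.
Proof. by move=> h; rewrite inE; apply/existsP; exists u; rewrite h /=. Qed.

Let A1_mu z : z \in A1s -> al < mu z <= 2 * al.
Proof.
by rewrite inE => /existsP[u /andP[/andP[_ /and5P[_ /asboolP h _ _ _]] /eqP ->]].
Qed.

Let al0 : 0 < al := p2_gt0 _.

Let pA := \rsum_(z in A1s) rpow (mu z) q.

Let sumE1 (F : 'I_(2 ^ m) * 'I_(2 ^ m) -> R) :
  \rsum_(u | E1 u) F u = \rsum_(w : 'I_(2 ^ m)) \rsum_(y in B1s w) F (w, y).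
Proof.
by rewrite pair_big_dep /=; apply: eq_big => -[w y] //=; rewrite inE.
Qed.

Let sum_slices (F : 'I_(2 ^ m) * 'I_(2 ^ m) -> R) : (forall u, 0 <= F u) ->
  \rsum_(u | E1 u) F u <= \rsum_(y : 'I_(2 ^ m)) \rsum_(w : 'I_(2 ^ m) | subI w y \in A1s) F (w, y).
Proof.
move=> F0; apply: (@Rle_trans _ (\rsum_(u : 'I_(2 ^ m) * 'I_(2 ^ m) | subI u.1 u.2 \in A1s) F u)).
  by apply: rsum_sub => // u; apply: E1A.
rewrite (exchange_big_dep predT) //= pair_big_dep /=.
by apply: Req_le; apply: eq_big => -[].
Qed.

Let slice_sum (F : 'I_(2 ^ m) -> R) y :
  \rsum_(w : 'I_(2 ^ m) | subI w y \in A1s) F (subI w y) = \rsum_(z in A1s) F z.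
Proof. by rewrite [RHS](reindex_inj (@subI_inj m y)). Qed.

Let cancelV x y : x * rpow Vt (1 - a) <= y * rpow Vt (1 - a) -> x <= y.
Proof.
move=> h; apply: (Rmult_le_reg_r (rpow Vt (1 - a))) => //.
case: (Rle0_cases (rpow_ge0 Vt (1 - a))) => // e.
by have := G_gt0; rewrite /G /gm e; lra.
Qed.

(** For fixed [y], Hoelder's inequality over the [w] with [w - y] in [A1s] gives at most
    [gm a pA Vt]; averaging against [nu] keeps this bound, and the power of [Vt] cancels against the
    one in [G]. *)
Lemma A_mass : p2 (- bt * INR m * q) * pt <= pA.
Proof.
have h : p2 (- bt * INR m) * G <= gm a pA Vt.
  apply: Rle_trans HL _; apply: Rle_trans (sum_slices X0) _.
  rewrite -(Rmult_1_l (gm a pA Vt)) -nu1 big_distrl /=; apply: rsum_le => y _.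
  rewrite /X /= rsumZ; apply: Rmult_le_compat_l => //.
  apply: Rle_trans (gm_holder _ a0 a1 _ _) _ => //; first by move=> *; apply: rpow_ge0.
  rewrite (slice_sum (fun z => rpow (mu z) q)) -/pA.
  apply: gm_le => //; [by apply: rsum_ge0 => *; apply: rpow_ge0|exact: rsum_ge0|exact: Rle_refl|].
  exact: rsum_sub.
have pA0 : 0 <= pA by apply: rsum_ge0 => *; apply: rpow_ge0.
apply: (rpow_le_inv a0) => //.
rewrite rpowM; [|exact/Rlt_le/p2_gt0|lra].
rewrite p2_rpow (_ : - bt * INR m * q * a = - bt * INR m); last by rewrite Rmult_assoc aq; ring.
by apply: cancelV; move: h; rewrite /G /gm; lra.
Qed.

(* Bound gm by Gw ^ q and interpolate: if all slices B1s w had small mass, then Gw would be small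
   in sup norm and bounded in L^1. *)
Lemma B_mass : exists w, p2 (- ((bt * INR m + 1) / (1 - a) + 1)) <= \rsum_(y in B1s w) nu y.
Proof.
apply: contrapT => /forallNP hB.
set ga := p2 _ in hB.
have ga0 : 0 < ga by apply: p2_gt0.
have hB' w : \rsum_(y in B1s w) nu y <= ga by apply/Rlt_le/Rnot_le_lt/hB.
pose Gw w := \rsum_(y in B1s w) (nu y * mu (subI w y)).
have Gw0 w : 0 <= Gw w by apply: rsum_ge0 => *; apply: Rmult_le_pos.
have Gw1 w : Gw w <= 2 * al * ga.
  apply: (@Rle_trans _ (\rsum_(y in B1s w) (2 * al * nu y))).
    apply: rsum_le => y; rewrite inE => /E1A /A1_mu /= h; rewrite Rmult_comm.
    by apply: Rmult_le_compat_r => //; lra.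
  by rewrite rsumZ; apply: Rmult_le_compat_l => //; lra.
have sG : \rsum_w Gw w <= 2 * al * INR #|A1s|.
  have := sum_slices (F := fun u => nu u.2 * mu (subI u.1 u.2)) (fun u => Rmult_le_pos _ _ (nu0 _) (mu0 _)).
  rewrite sumE1 /= => h; apply: Rle_trans h _.
  rewrite -(Rmult_1_l (2 * al * _)) -nu1 big_distrl /=; apply: rsum_le => y _.
  rewrite rsumZ; apply: Rmult_le_compat_l => //; rewrite slice_sum.
  apply: (@Rle_trans _ (\rsum_(z in A1s) (2 * al))); last by rewrite rsum_const_in Rmult_comm; apply: Rle_refl.
  by apply: rsum_le => z /A1_mu; lra.
have cA : INR #|A1s| * rpow al q <= pt.
  rewrite -rsum_const_in; apply: (@Rle_trans _ pA).
    by apply: rsum_le => z /A1_mu h; apply: rpow_le; lra.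
  by apply: rsum_sub => // *; apply: rpow_ge0.
have qm1 : 0 <= q - 1 by lra.
have GQ : \rsum_w rpow (Gw w) q <= rpow 2 q * rpow ga (q - 1) * pt.
  apply: (@Rle_trans _ (\rsum_w (rpow (2 * al * ga) (q - 1) * Gw w))).
    apply: rsum_le => w _; rewrite (_ : q = q - 1 + 1); last ring.
    rewrite rpowD // rpow1 //; apply: Rmult_le_compat_r => //.
    rewrite (_ : q - 1 + 1 - 1 = q - 1); last ring.
    exact: rpow_le.
  rewrite rsumZ; apply: Rle_trans (Rmult_le_compat_l _ _ _ (rpow_ge0 _ _) sG) _.
  have e : rpow (2 * al * ga) (q - 1) * (2 * al * INR #|A1s|) =
      rpow 2 q * rpow ga (q - 1) * (INR #|A1s| * rpow al q).
    rewrite !rpowM; try lra.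
    have qE z : 0 <= z -> rpow z q = rpow z (q - 1) * z.
      by move=> hz; rewrite -[Z in _ * Z](rpow1 hz) -rpowD //; congr rpow; ring.
    rewrite (qE 2 ltac:(lra)) (qE al (Rlt_le _ _ al0)).
    ring.
  rewrite e; apply: Rmult_le_compat_l => //.
  by apply: Rmult_le_pos; apply: rpow_ge0.
have h : p2 (- bt * INR m) * G <= gm a (rpow 2 q * rpow ga (q - 1) * pt) Vt.
  apply: Rle_trans HL _; rewrite sumE1.
  apply: (@Rle_trans _ (\rsum_(w : 'I_(2 ^ m)) gm a (rpow (Gw w) q) (v w))).
    apply: rsum_le => w _; rewrite /gm rq // /Gw big_distrl /=.
    by apply: Req_le; apply: eq_bigr => y _; rewrite XE /=; ring.
  apply: Rle_trans (gm_holder _ a0 a1 _ _) _ => //; first by move=> *; apply: rpow_ge0.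
  apply: gm_le => //; [by apply: rsum_ge0 => *; apply: rpow_ge0|exact: Rle_refl].
have h2 : p2 (- bt * INR m) <= 2 * rpow ga (1 - a).
  have pa : 0 < rpow pt a by apply: rpow_gt0.
  apply: (Rmult_le_reg_r (rpow pt a)) => //; apply: cancelV.
  move: h; rewrite /G /gm !rpowM; try apply: Rmult_le_pos; try exact: rpow_ge0; try lra.
  rewrite rq; last lra.
  rewrite rpow_rpow; last lra.
  have -> : (q - 1) * a = q * a - a by ring.
  rewrite aq.
  lra.
(* The exponent of [ga] is made for this: the division by [1 - a] undoes the power, the [1] next to
   [bt * INR m] absorbs the factor [2], and the last [1] leaves the margin [1 - a] that contradicts
   [h2]. *)
have e : 2 * rpow ga (1 - a) = p2 (- bt * INR m - (1 - a)).
  rewrite /ga p2_rpow -{1}p2_1 -p2D; congr p2; field; lra.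
by have := p2_lt (x := - bt * INR m - (1 - a)) (y := - bt * INR m) ltac:(lra); lra.
Qed.
End Extract.

Lemma core_structure : exists (t1 t2 : 'I_(2 ^ m)) (lab : nat -> nat) (A0 B0 : {set 'I_(2 ^ m)}) (al be : R),
  [/\ 0 < al, 0 < be, forall x, x \in A0 -> al < transl t1 mu x <= 2 * al &
      forall y, y \in B0 -> be < transl t2 nu y <= 2 * be] /\
  p2 (- bt * INR m * q) * pt <= \rsum_(x in A0) rpow (transl t1 mu x) q /\
  p2 (- ((bt * INR m + 1) / (1 - a) + 1)) <= \rsum_(y in B0) transl t2 nu y /\
  (forall x, x \in A0 -> mid l D x) /\ (forall y, y \in B0 -> mid l D y) /\
  (\sum_(t < T) (b < lab t : nat) <= k1 + k2)%N /\
  (forall t, (t < T)%N -> (lab t <= b)%N -> forall x, x \in A0 ->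
    INR (2 ^ (lab t * D)) * node_mass m (fun k => rpow (transl t1 mu (modI m k)) q) (t * N + lab t * D) x <=
    INR (2 ^ (3 * D)) * node_mass m (fun k => rpow (transl t1 mu (modI m k)) q) (t * N) x) /\
  (forall t, (t < T)%N -> (lab t <= b)%N -> forall y y', y \in B0 -> y' \in B0 -> (y <= y')%N ->
    (y' - y < 2 ^ (m - t * N - lab t * D))%N -> (y' - y < 2 ^ (m - t.+1 * N))%N).
Proof.
have [L HL] := good_label.
have am := A_mass HL; have [w0 bm] := B_mass HL.
set A1s := finset _ in am; set B1s := finset _ in bm.
pose lab (t : nat) : nat := if insub t is Some t' then L.1.1 t' else 0%N.
have labE (t : 'I_T) : lab t = L.1.1 t by rewrite /lab valK.
exists L.2.1, L.2.2, lab, [set x | subI x L.2.1 \in A1s], [set y | subI y L.2.2 \in B1s].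
exists (p2 (- INR L.1.2.1.+1)), (p2 (- INR L.1.2.2.+1)).
have inA x : x \in [set x | subI x L.2.1 \in A1s] -> exists2 u, E u && rel u L & subI x L.2.1 = subI u.1 u.2.
  by rewrite !inE => /existsP[u /andP[h /eqP e]]; exists u.
have inB y : y \in [set y | subI y L.2.2 \in B1s] -> E (w0, subI y L.2.2) && rel (w0, subI y L.2.2) L.
  by rewrite !inE.
split; [split|split; [|split; [|split; [|split; [|split; [|split]]]]]].
- exact: p2_gt0.
- exact: p2_gt0.
- by move=> x /inA[u /andP[_ /and5P[_ /asboolP h _ _ _]] e]; rewrite transl_subI e.
- by move=> y /inB /andP[_ /and5P[_ _ /asboolP h _ _]]; rewrite transl_subI.
- apply: Rle_trans am _; apply: Req_le; rewrite (reindex_inj (@subI_inj m L.2.1)) /=.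
  by apply: eq_bigl => x; rewrite [in RHS]inE.
- apply: Rle_trans bm _; apply: Req_le; rewrite (reindex_inj (@subI_inj m L.2.2)) /=.
  by apply: eq_bigl => x; rewrite [in RHS]inE.
- by move=> x /inA[u /andP[_ /and5P[_ _ _ h _]] e]; rewrite -e subIK in h.
- by move=> y /inB /andP[_ /and5P[_ _ _ _ h]]; rewrite /= subIK in h.
(* One point of the slice suffices: for the pair [(w0, y)] a label above [b] means a bad cell or an
   edge, and a good pair has at most [k1] edge levels and fewer than [k2] bad ones. *)
- have [y hy] : exists y, y \in B1s.
    apply: contrapT => /forallNP h; move: bm.
    rewrite big_pred0; last by move=> y; apply/negP/h.
    by have := p2_gt0 (- ((bt * INR m + 1) / (1 - a) + 1)); lra.
  move: hy; rewrite inE => /andP[/and4P[/= hO hnb _ _] /and5P[/asboolP hl _ _ _ _]].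
  apply: (@leq_trans (\sum_(t < T) (edge m b D t w0 : nat) + nb w0 y)); last exact: leq_add hO (ltnW hnb).
  rewrite /nb /nbad big_mkord -big_split /=; apply: leq_sum => t _; rewrite labE.
  have := hl t; rewrite /label_at /= leqNgt; case: ltnP => //= _.
  by rewrite /len -/N -/M; case: bad_cell; case: edge.
- move=> t ht hlab x xA.
  have [u /andP[_ /and5P[/asboolP hl _ _ hmid _]] e] := inA _ xA.
  have hlt := hl (Ordinal ht); rewrite -labE /= in hlt.
  have hz : ((u.1 + (n - u.2) + L.2.1) %% n)%N = x.
    have := congr1 val (subIK L.2.1 x); rewrite e /addI /subI /= modnDml => <-.
    by [].
  have := @ball_mass m b D T p v eta th D4 TN p0 pn th0 hM t u.1 u.2 L.2.1 (lab t) ht hlab (ltn_ord _) (ltn_ord _) (ltn_ord _) hlt.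
  rewrite hz => h; rewrite /transl.
  have ep k : rpow (mu (modI m (modI m k + (2 ^ m - L.2.1)))) q = p (k + (n - L.2.1)).
    by rewrite /p; congr (rpow (mu _) _); apply: modI_eq; rewrite /= modnDml.
  have en s z : node_mass m (fun k => rpow (mu (modI m (modI m k + (2 ^ m - L.2.1)))) q) s z =
      node_mass m (fun k => p (k + (n - L.2.1))) s z by apply: eq_S => k _; rewrite ep.
  rewrite !en; apply: h.
  have tb : (t * b < l)%N.
    by apply: leq_trans Tb; rewrite ltn_pmul2r.
  have /forallP /(_ (Ordinal tb)) := hmid; rewrite -e subIK /=.
  by rewrite /N mulnA.
- move=> t ht hlab y y' /inB /andP[_ /and5P[/asboolP hl _ _ _ _]] /inB /andP[_ /and5P[/asboolP hl' _ _ _ _]].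
  have h1 := hl (Ordinal ht); have h2 := hl' (Ordinal ht); rewrite -labE /= in h1 h2.
  have := @close_points m b D T p v eta th D4 TN t w0 (subI y L.2.2) (subI y' L.2.2) L.2.2 (lab t) ht hlab
    (ltn_ord _) (ltn_ord _) h1 h2.
  have e z : ((subI z L.2.2 + L.2.2) %% n)%N = z by have := congr1 val (subIK L.2.2 z).
  by rewrite !e.
Qed.
End Core.

(** * Shifts and central points *)

(** Centrality at a level is decided by one digit in base [2 ^ D], which must lie in the middle half
    of its range. Distinct levels constrain distinct digits, so each level costs a factor [2]. *)
Lemma mid_card (l D : nat) : (2 <= D)%N ->
  (2 ^ (l * D) <= #|[pred x : 'I_(2 ^ (l * D)) | mid l D x]| * 2 ^ l)%N.
Proof.
move=> D2; elim: l => [|l IH].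
  apply: (@leq_trans 1); first by rewrite mul0n.
  rewrite -[X in (X <= _)%N]muln1 leq_mul //; apply/card_gt0P; exists (Ordinal (pos2m _)).
  by apply/forallP => -[].
set c := #|_| in IH; set c' := #|_|.
suff h : (2 ^ D.-1 * c <= c')%N.
  rewrite mulSn expnD (expnS 2 l).
  have -> : (2 ^ D = 2 * 2 ^ D.-1)%N by rewrite -expnS prednK //; move: D2; clear; lia.
  move: (2 ^ D.-1)%N (2 ^ (l * D))%N (2 ^ l)%N c c' h IH; clear; nia.
have lt (i : 'I_(2 ^ D.-1)) (x : 'I_(2 ^ (l * D))) :
    ((2 ^ (D - 2) + i) * 2 ^ (l * D) + x < 2 ^ (l.+1 * D))%N.
  have hi := ltn_ord i; have hx := ltn_ord x; rewrite mulSn expnD.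
  have -> : (2 ^ D = 2 ^ (D - 2) + 2 ^ D.-1 + 2 ^ (D - 2))%N.
    have e1 : (2 ^ D = 4 * 2 ^ (D - 2))%N by rewrite -(expnD 2 2); congr (2 ^ _)%N; move: D2; clear; lia.
    have e2 : (2 ^ D.-1 = 2 * 2 ^ (D - 2))%N by rewrite -(expnD 2 1); congr (2 ^ _)%N; move: D2; clear; lia.
    by move: e1 e2; clear; lia.
  by move: hi hx; move: (2 ^ (D - 2))%N (2 ^ D.-1)%N (2 ^ (l * D))%N (nat_of_ord i) (nat_of_ord x); clear; nia.
pose f (ix : 'I_(2 ^ D.-1) * 'I_(2 ^ (l * D))) : 'I_(2 ^ (l.+1 * D)) := Ordinal (lt ix.1 ix.2).
have finj : injective f.
  move=> [i x] [i' x'] /(congr1 val) /= e.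
  have em := congr1 (fun z => z %% 2 ^ (l * D))%N e.
  have ed := congr1 (fun z => z %/ 2 ^ (l * D))%N e.
  rewrite /= !modnMDl !modn_small // in em.
  rewrite /= !divnMDl ?expn_gt0 // !divn_small // !addn0 in ed.
  by move/addnI: ed => ed; congr pair; apply: val_inj.
have -> : (2 ^ D.-1 * c = #|[predX 'I_(2 ^ D.-1) & [pred x : 'I_(2 ^ (l * D)) | mid l D x]]|)%N.
  by rewrite cardX card_ord.
rewrite -(card_image finj); apply: subset_leq_card; apply/subsetP => z /imageP[[i x]].
rewrite !inE /= => /forallP hx ->; apply/forallP => -[[|s] hs] /=.
  rewrite /in_half mul0n subn0 /=.
  have hlt := lt i x; rewrite modn_small //.
  have hi := ltn_ord i; have hx' := ltn_ord x; rewrite mulSn expnD.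
  have e1 : (2 ^ D = 4 * 2 ^ (D - 2))%N by rewrite -(expnD 2 2); congr (2 ^ _)%N; move: D2; clear; lia.
  have e2 : (2 ^ D.-1 = 2 * 2 ^ (D - 2))%N by rewrite -(expnD 2 1); congr (2 ^ _)%N; move: D2; clear; lia.
  rewrite e1; move: hi hx' e2; clear.
  move: (2 ^ (D - 2))%N (2 ^ D.-1)%N (2 ^ (l * D))%N (nat_of_ord i) (nat_of_ord x); clear; nia.
have := hx (Ordinal (hs : (s < l)%N)); rewrite /in_half /= !mulSn subnDl.
have dv : (2 ^ (l * D - s * D) %| 2 ^ (l * D))%N by apply: dvdn_exp2l; apply: leq_subr.
have aux c0 y : ((c0 * 2 ^ (l * D) + y) %% 2 ^ (l * D - s * D) = y %% 2 ^ (l * D - s * D))%N.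
  by rewrite -modnDml (eqP (dvdn_mull c0 dv)) add0n.
rewrite aux.
by [].
Qed.

Section Shift.
Variables (m b D T k1 : nat).
Let N := (b * D)%N.
Hypotheses (b1 : (1 <= b)%N) (D1 : (1 <= D)%N) (TN : (T * N <= m)%N).

Lemma edge_count t : (t < T)%N ->
  \rsum_(w < 2 ^ m) INR (edge m b D t w : nat) <= INR (2 * 2 ^ (m - D)).
Proof.
move=> ht.
have tN : (N + t * N <= m)%N by apply: leq_trans TN; rewrite -mulSn leq_mul2r ht orbT.
have DN : (D <= N)%N by rewrite leq_pmull.
set r := (2 ^ (m - t.+1 * N))%N; set M := (2 ^ N)%N; set Rc := (2 ^ (N - D))%N.
have r0 : (0 < r)%N by rewrite expn_gt0.
pose ed (j : nat) : nat := ~~ ((Rc <= j)%N && (j + Rc <= M)%N).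
have RM : (Rc + Rc <= M)%N.
  rewrite addnn -mul2n -expnS leq_exp2l //; move: DN D1; clear; lia.
have cnt : \rsum_(0 <= j < M) INR (ed j) <= INR (2 * Rc).
  rewrite (big_cat_nat (n := Rc)) //=; last by move: RM; clear; lia.
  rewrite (big_cat_nat (m := Rc) (n := M - Rc)) //=; try by move: RM; clear; lia.
  rewrite [X in _ + (X + _)]big_nat_cond [X in _ + (X + _)]big1 ?Rplus_0_l; last first.
    by move=> j /andP[/andP[h1 h2] _]; rewrite /ed h1 /=; have -> : (j + Rc <= M)%N by move: h2; clear; lia.
  have le1 j : INR (ed j) <= 1 by rewrite /ed; case: (~~ _); rewrite /=; lra.
  apply: Rle_trans (Rplus_le_compat _ _ _ _ (rsum_le (G := fun _ => 1) _ (fun j _ => le1 j)) (rsum_le (G := fun _ => 1) _ (fun j _ => le1 j))) _.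
  rewrite !rsum_const_nat subn0 subKn; last by move: RM; clear; lia.
  by rewrite mult_INR /=; lra.
have nE : (2 ^ m = 2 ^ (t * N) * (M * r))%N.
  by rewrite /M /r -!expnD; congr (2 ^ _)%N; rewrite mulSn; move: tN; clear; lia.
rewrite -(@sum_S m (fun w => INR (edge m b D t w : nat))) nE -[(_ * (M * r))%N]add0n S_blocks.
apply: (@Rle_trans _ (\rsum_(0 <= K < 2 ^ (t * N)) (INR r * INR (2 * Rc)))).
  apply: rsum_le => K _; rewrite mulSnr addnA add0n S_blocks.
  apply: Rle_trans (Rmult_le_compat_l _ _ _ (pos_INR r) cnt).
  rewrite -rsumZ big_nat_cond [Z in _ <= Z]big_nat_cond; apply: rsum_le => j /andP[/andP[_ hj] _].
  rewrite mulSnr addnA.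
  rewrite (@eq_S _ (fun _ => INR (ed j))); last first.
    move=> w /andP[h1 h2]; congr INR; rewrite /edge /ed /cell_pos /len -/N -/r -/M -/Rc.
    have -> : (w %/ r = K * M + j)%N.
      have -> : w = ((K * M + j) * r + (w - (K * (M * r) + j * r)))%N.
        by rewrite mulnDl -mulnA subnKC.
      by rewrite divnMDl // divn_small ?addn0 //; move: h1 h2; clear; lia.
    by rewrite modnMDl modn_small.
  by rewrite /S rsum_const_nat addnC addnK; lra.
rewrite rsum_const_nat subn0 -!mult_INR; apply: le_INR; apply/leP.
rewrite !multE /Rc /r !(mulnCA _ 2%N) leq_mul2l /= -!expnD leq_exp2l //.
rewrite mulSn; move: tN DN; clear; lia.
Qed.

Let cnt w := (\sum_(t < T) (edge m b D t w : nat))%N.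

(* Average over the shift x. *)
Lemma edge_shift (u : 'I_(2 ^ m) -> R) : (forall i, 0 <= u i) -> (T * 4 <= k1.+1 * 2 ^ D)%N ->
  exists x, / 2 * \rsum_i u i <= \rsum_(w < 2 ^ m | (cnt w <= k1)%N) u (subI w x).
Proof.
move=> u0 hT; set U := \rsum_i u i.
have U0 : 0 <= U by apply: rsum_ge0.
have sU x : \rsum_w u (subI w x) = U by rewrite /U [RHS](reindex_inj (@subI_inj m x)).
have sU' w : \rsum_x u (subI w x) = U by rewrite /U [RHS](reindex_inj (inv_inj (subII w))).
have DM : (D <= m)%N \/ T = 0%N.
  case: T TN => [|T'] h; [by right|left]; apply: leq_trans h.
  by rewrite mulSn; apply: leq_trans (leq_addr _ _); rewrite leq_pmull.
have sc : \rsum_(w < 2 ^ m) INR (cnt w) <= INR (T * (2 * 2 ^ (m - D))).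
  have INRs w : INR (cnt w) = \rsum_(t < T) INR (edge m b D t w : nat).
    by rewrite /cnt; apply: (big_morph INR plus_INR erefl).
  under eq_bigr => w _ do rewrite INRs.
  rewrite exchange_big /= mult_INR -[T in INR T]card_ord -rsum_const; apply: rsum_le => t _.
  exact: edge_count.
(* For each [w] the sum of [u (subI w x)] over [x] is [U], so some shift has at most the average
   number of edge levels, [2 * T / 2 ^ D]. This is at most half of [k1.+1], and Markov's inequality
   leaves half of the mass. *)
have [x hx] : exists x, \rsum_w (u (subI w x) * INR (cnt w)) * INR (2 ^ m) <= INR (T * (2 * 2 ^ (m - D))) * U.
  apply: contrapT => /forallNP h.
  have : \rsum_(x < 2 ^ m) (INR (T * (2 * 2 ^ (m - D))) * U) < \rsum_(x < 2 ^ m) (\rsum_w (u (subI w x) * INR (cnt w)) * INR (2 ^ m)).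
    have i0 : 'I_(2 ^ m) := Ordinal (pos2m m).
    rewrite (bigD1 i0) //= [Z in _ < Z](bigD1 i0) //=; apply: Rplus_lt_le_compat.
      by apply/Rnot_le_lt/h.
    by apply: rsum_le => i _; apply/Rlt_le/Rnot_le_lt/h.
  rewrite rsum_const card_ord -big_distrl /= exchange_big /=.
  have -> : \rsum_(w < 2 ^ m) \rsum_(x < 2 ^ m) (u (subI w x) * INR (cnt w)) = \rsum_(w < 2 ^ m) (U * INR (cnt w)).
    by apply: eq_bigr => w _; rewrite -big_distrl /= sU'.
  rewrite rsumZ; set sC := \rsum_(w < 2 ^ m) _ => h1.
  have {}sc : sC <= INR (T * (2 * 2 ^ (m - D))) := sc.
  have h2 := Rmult_le_compat_l _ _ _ U0 sc.
  have n0 := pos_INR (2 ^ m); have := Rmult_le_compat_r _ _ _ n0 h2; lra.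
exists x.
have sp : U = \rsum_(w < 2 ^ m | (cnt w <= k1)%N) u (subI w x) + \rsum_(w < 2 ^ m | ~~ (cnt w <= k1)%N) u (subI w x).
  by rewrite -(sU x) (bigID (fun w : 'I_(2 ^ m) => (cnt w <= k1)%N)).
have bd : INR k1.+1 * \rsum_(w < 2 ^ m | ~~ (cnt w <= k1)%N) u (subI w x) <= \rsum_w (u (subI w x) * INR (cnt w)).
  rewrite -rsumZ big_mkcond; apply: rsum_le => w _; case: leqP => h.
    by apply: Rmult_le_pos => //; apply: pos_INR.
  by rewrite (Rmult_comm (INR k1.+1)); apply: Rmult_le_compat_l => //; apply: le_INR; apply/leP.
set bad := \rsum_(w < 2 ^ m | ~~ (cnt w <= k1)%N) u (subI w x) in sp bd.
have nn : 0 < INR (2 ^ m) by apply: lt_0_INR; apply/ltP; rewrite pos2m.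
have cc : INR (T * (2 * 2 ^ (m - D))) * 2 <= INR k1.+1 * INR (2 ^ m).
  rewrite -[2]/(INR 2) -!mult_INR; apply: le_INR; apply/leP.
  case: DM => [DM|->]; last by rewrite !mul0n.
  rewrite -{2}(subnKC DM) expnD.
  move: (2 ^ (m - D))%N hT => z hT; have := leq_mul hT (leqnn z); move: (2 ^ D)%N; clear; lia.
have k0 : 0 < INR k1.+1 by apply: lt_0_INR; apply/ltP.
have h3 : (INR k1.+1 * bad) * INR (2 ^ m) <= INR (T * (2 * 2 ^ (m - D))) * U.
  by apply: Rle_trans hx; apply: Rmult_le_compat_r => //; lra.
have h4 : (INR k1.+1 * INR (2 ^ m)) * bad <= (INR k1.+1 * INR (2 ^ m)) * (/ 2 * U).
  have := Rmult_le_compat_r _ _ _ U0 cc; lra.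
have := Rmult_le_reg_l _ _ _ (Rmult_lt_0_compat _ _ k0 nn) h4.
lra.
Qed.
End Shift.

Lemma transl_conv m (mu nu : 'I_(2 ^ m) -> R) x w :
  conv mu (transl x nu) w = conv mu nu (subI w x).
Proof.
rewrite !convE (reindex_inj (can_inj (addIK x))) /=; apply: eq_bigr => y _.
rewrite transl_subI addIK; congr (_ * mu _).
rewrite /subI /addI; apply: modI_eq; apply/eqP.
set n := (2 ^ m)%N.
have yn : (y < n)%N := ltn_ord y; have xn : (x < n)%N := ltn_ord x.
set z := ((y + x) %% n)%N; have zn : (z < n)%N by rewrite ltn_mod pos2m.
rewrite -(eqn_modDr (z + x + y)) /= -/n -/z.
have -> : (w + (n - z) + (z + x + y) = w + n + (x + y))%N by move: zn; clear; lia.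
rewrite -[(_ %% _ + (n - y) + _)%N]addnA modnDml.
have -> : (w + (n - x) + (n - y + (z + x + y)) = w + n + n + z)%N by move: yn xn; clear; lia.
by rewrite /z modnDmr [(_ + n + n + _)%N]addnAC modnDr (addnC y).
Qed.

Lemma transl_transl m (nu : 'I_(2 ^ m) -> R) x t : transl t (transl x nu) = transl (addI t x) nu.
Proof.
apply: funext => i; rewrite !transl_subI; congr nu.
apply: (can_inj (addIK (addI t x))); rewrite subIK.
rewrite [RHS](_ : i = addI (addI (subI (subI i t) x) x) t); last by rewrite !subIK.
rewrite /addI; apply: modI_eq.
move: (subI _ x) => z; rewrite /= modnDmr modnDml (addnC (nat_of_ord t)) addnA.
by [].
Qed.

Lemma transl_sum m (f : R -> R) (nu : 'I_(2 ^ m) -> R) x : \rsum_i f (transl x nu i) = \rsum_i f (nu i).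
Proof. by rewrite [RHS](reindex_inj (@subI_inj m x)). Qed.

(** * Mass along a regular tree *)

Section TreeMass.
Variables (V W : finType) (key : nat -> V -> W) (l : nat) (w : V -> R).
Hypothesis nest : forall s a b, (s < l)%N -> key s.+1 a = key s.+1 b -> key s a = key s b.
Hypothesis keyl : injective (key l).
Hypothesis w0 : forall x, 0 <= w x.
Variables (A : {set V}) (r : nat -> nat).
Hypothesis reg : forall s, (s < l)%N -> regular_at key s A (r s).

Definition cyl s k := \rsum_(x : V | key s x == k) w x.
(** Nodes met by [A] count with their full weight, points outside [A] included, because the
    available mass bounds concern whole nodes. From root to leaves this decreases from at most the
    total weight to the weight of [A]. *)
Definition level_mass s := \rsum_(k in key s @: A) cyl s k.

Lemma cyl_ge0 s k : 0 <= cyl s k. Proof. exact: rsum_ge0. Qed.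
Lemma level_mass_ge0 s : 0 <= level_mass s.
Proof. by apply: rsum_ge0 => k _; apply: cyl_ge0. Qed.

Lemma level_mass_le_total s : level_mass s <= \rsum_x w x.
Proof.
rewrite /level_mass /cyl (exchange_big_dep predT) //= ; apply: rsum_le => x _.
rewrite big_mkcond /= (bigD1 (key s x)) //= eqxx andbT big1 ?Rplus_0_r.
  by case: ifP => _; [exact: Rle_refl|exact: w0].
by move=> k /negbTE; rewrite eq_sym => ->; rewrite andbF.
Qed.

Lemma level_mass_last : level_mass l = \rsum_(x in A) w x.
Proof.
rewrite /level_mass big_imset /=; last by move=> x y _ _; apply: keyl.
apply: eq_bigr => x _; rewrite /cyl (big_pred1 x) // => y.
by apply/eqP/eqP => [/keyl|->].
Qed.

Lemma level_mass_split s d : (s + d <= l)%N ->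
  level_mass (s + d) = \rsum_(k in key s @: A) \rsum_(u in key (s + d) @: [set b in A | key s b == k]) cyl (s + d) u.
Proof.
move=> hd; apply: big_imset_fibers => a b; apply: (nest_le nest) => //; exact: leq_addr.
Qed.

Lemma level_mass_mono s d : (s + d <= l)%N -> level_mass (s + d) <= level_mass s.
Proof.
move=> hd; rewrite level_mass_split //; apply: rsum_le => k _.
rewrite /cyl (exchange_big_dep predT) //= [Z in _ <= Z]big_mkcond /=; apply: rsum_le => x _.
rewrite big_mkcond /=.
case: (boolP (key (s + d) x \in key (s + d) @: [set b in A | key s b == k])) => hx; last first.
  rewrite big1; first by case: ifP => _; [exact: w0|exact: Rle_refl].
  move=> u _; case: ifP => // /andP[hu /eqP e]; by rewrite -e (negbTE hx) in hu.
have -> : key s x == k.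
  move/imsetP: hx => [b /setIdP[_ /eqP <-]] e; apply/eqP.
  by apply: (nest_le nest) e => //; exact: leq_addr.
rewrite (bigD1 (key (s + d) x)) //= eqxx andbT hx big1 ?Rplus_0_r; first exact: Rle_refl.
by move=> u /negbTE; rewrite eq_sym => ->; rewrite andbF.
Qed.

(** A node has exactly as many descendants in [A] as the product of branching numbers, each carrying
    at most the share [c] of its weight: few branches and small shares force a drop. *)
Lemma level_mass_drop s d c : (s + d <= l)%N -> 0 <= c ->
  (forall a, a \in A -> cyl (s + d) (key (s + d) a) <= c * cyl s (key s a)) ->
  level_mass (s + d) <= INR (\prod_(s <= s' < s + d) r s') * c * level_mass s.
Proof.
move=> hd c0 h; rewrite level_mass_split // -rsumZ; apply: rsum_le => k /imsetP[a aA ->].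
have e : #|key (s + d) @: cap key s A a| = (\prod_(s <= s' < s + d) r s')%N.
  apply: (descendants nest) => // s' h1 h2; apply: reg; exact: leq_trans h2 hd.
rewrite -e Rmult_assoc -rsum_const_in; apply: rsum_le => u /imsetP[b /setIdP[bA /eqP eb] ->].
by rewrite -eb; apply: h.
Qed.
End TreeMass.

(** * The dyadic tree *)

Section Dyadic.
Variables (l D : nat).
Let m := (l * D)%N.
Let V := 'I_(2 ^ (l * D)).

Lemma dkey_lt s (a : V) : (a %/ 2 ^ (m - s * D) < 2 ^ m)%N.
Proof. exact: leq_ltn_trans (leq_div _ _) (ltn_ord a). Qed.
Definition dkey s (a : V) : V := Ordinal (dkey_lt s a).

Lemma dlevel s : (s < l)%N -> (2 ^ (m - s * D) = 2 ^ (m - s.+1 * D) * 2 ^ D)%N.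
Proof.
move=> hs; rewrite -expnD; congr (2 ^ _)%N.
have : (s.+1 * D <= m)%N by rewrite leq_mul2r hs orbT.
by rewrite mulSn; move: (s * D)%N; clear; lia.
Qed.

Lemma dkey_parent s (a : V) : (s < l)%N -> (dkey s a = dkey s.+1 a %/ 2 ^ D :> nat)%N.
Proof. by move=> hs; rewrite /= (dlevel hs) divnMA. Qed.

Lemma dkey_nest s (a b : V) : (s < l)%N -> dkey s.+1 a = dkey s.+1 b -> dkey s a = dkey s b.
Proof. by move=> hs e; apply: ord_inj; rewrite (dkey_parent a hs) (dkey_parent b hs) e. Qed.

Lemma dkey0 (a b : V) : dkey 0 a = dkey 0 b.
Proof. by apply: val_inj; rewrite /= mul0n subn0 !divn_small. Qed.

Lemma dkeyl : injective (dkey l).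
Proof.
move=> a b /(congr1 val) /=; rewrite -/m subnn expn0 !divn1 => e; exact: val_inj.
Qed.

Lemma dchildren_le s (A : {set V}) a : (s < l)%N -> (#|children dkey s A a| <= 2 ^ D)%N.
Proof.
move=> hs; pose h (u : V) : 'I_(2 ^ D) := modI D u.
have inj : {in children dkey s A a &, injective h}.
  move=> u v /imsetP[x /setIdP[_ /eqP ex] ->] /imsetP[y /setIdP[_ /eqP ey] ->] /(congr1 val) e.
  apply: ord_inj; rewrite (divn_eq (dkey s.+1 x) (2 ^ D)) (divn_eq (dkey s.+1 y) (2 ^ D)).
  by rewrite -(dkey_parent x hs) -(dkey_parent y hs) ex ey; congr (_ + _)%N; exact: e.
by rewrite -(card_in_imset inj); apply: leq_trans (max_card _) _; rewrite card_ord.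
Qed.

Lemma Ncount_children s (A : {set V}) a :
  Ncount (s.+1 * D) (cap_blk (s * D) A a) = #|children dkey s A a|.
Proof.
have -> : cap_blk (s * D) A a = cap dkey s A a by apply/setP => b; rewrite !inE.
rewrite /Ncount /children; set C := cap _ _ _ _.
have -> : [seq blk (l * D) (s.+1 * D) (val a0) | a0 <- enum C] = map val (map (dkey s.+1) (enum C)).
  by rewrite -map_comp.
rewrite undup_map_inj; last exact: val_inj.
rewrite size_map -(card_uniqP (undup_uniq _)); apply: eq_card => u.
rewrite mem_undup; apply/mapP/imsetP => -[x hx ->]; exists x => //.
  by rewrite mem_enum in hx.
by rewrite mem_enum.
Qed.

Lemma node_mass_cyl (F : V -> R) s (x : V) : (s <= l)%N ->
  node_mass m (fun k => F (modI m k)) (s * D) x = cyl dkey F s (dkey s x).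
Proof.
move=> hs; rewrite /node_mass /cyl; set la := (2 ^ (m - s * D))%N.
have la0 : (0 < la)%N by rewrite expn_gt0.
have hk : (x %/ la * la + la <= 2 ^ m)%N.
  have e : (2 ^ m = 2 ^ (s * D) * la)%N.
    by rewrite /la -expnD subnKC // leq_mul2r hs orbT.
  rewrite -mulSnr [X in (_ <= X)%N]e leq_mul2r; apply/orP; right.
  by rewrite ltn_divLR //; apply: leq_trans (ltn_ord x) (eq_leq e).
rewrite /S (big_nat_widen _ _ (2 ^ m)) // (big_nat_widenl _ 0) // big_mkord /=.
apply: eq_big => i; last by move=> _; congr F; apply: val_inj; rewrite /= modn_small.
rewrite -val_eqE /= -/m -/la; apply/andP/eqP => [[h2 h1]|e].
  by apply/eqP; rewrite eqn_leq -[X in X && _]ltnS ltn_divLR // mulSnr h2 leq_divRL.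
by rewrite -e leq_divM -mulSnr -ltn_divLR.
Qed.

Lemma card_close (C : {set V}) : (forall u v, u \in C -> v \in C -> (v <= u.+1)%N) -> (#|C| <= 2)%N.
Proof.
move=> h; rewrite leqNgt; apply/negP => /card_gt2P[x [y [z [[xC yC zC] [xy yz zx]]]]].
have := h _ _ xC yC; have := h _ _ yC xC; have := h _ _ xC zC; have := h _ _ zC xC.
have := h _ _ yC zC; have := h _ _ zC yC.
move: xy yz zx; rewrite -!val_eqE /=; clear; lia.
Qed.

End Dyadic.

(** * Branching numbers *)

(** Serves to thin a branching number strictly below a real threshold while losing at most a factor
    [2] against that threshold. *)
Lemma below_half (x : R) : 1 < x -> exists k : nat, (0 < k)%N /\ INR k < x /\ x <= 2 * INR k.
Proof.
move=> x1.
have ex : exists k : nat, `[< x <= INR k >].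
  by have [k hk] := INR_unbounded x; exists k; apply/asboolP/Rlt_le.
case: (ex_minnP ex) => k /asboolP hk mk.
case: k hk mk => [|[|k]] hk mk; [by rewrite /= in hk; lra|by rewrite /= in hk; lra|].
exists k.+1; split => //; split.
  apply: Rnot_le_lt => h.
  by have := mk k.+1 (introT (asboolP _) h); rewrite ltnn.
by rewrite S_INR in hk; have := pos_INR k; rewrite S_INR in hk *; lra.
Qed.

Lemma INR_prod_le (F : nat -> nat) (e : nat -> R) u v :
  (forall s, (u <= s < v)%N -> INR (F s) <= p2 (e s)) ->
  INR (\prod_(u <= s < v) F s) <= p2 (\rsum_(u <= s < v) e s).
Proof.
move=> h; rewrite [\prod_(u <= s < v) F s]big_nat_cond [\rsum_(u <= s < v) e s]big_nat_cond.
elim/big_rec2: _ => [|s y x /andP[hs _] IH]; first by rewrite p2_0 /=; lra.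
rewrite mult_INR p2D; apply: Rmult_le_compat => //; try exact: pos_INR.
exact: h.
Qed.

Lemma INR_prod_ratio (F G : nat -> nat) (e : nat -> R) u v :
  (forall s, (u <= s < v)%N -> INR (F s) <= INR (G s) * p2 (e s)) ->
  INR (\prod_(u <= s < v) F s) <= INR (\prod_(u <= s < v) G s) * p2 (\rsum_(u <= s < v) e s).
Proof.
move=> h; rewrite [\prod_(u <= s < v) F s]big_nat_cond [\prod_(u <= s < v) G s]big_nat_cond [\rsum_(u <= s < v) e s]big_nat_cond.
elim/big_rec3: _ => [|s y x z /andP[hs _] IH]; first by rewrite p2_0 /=; lra.
rewrite !mult_INR p2D.
have := Rmult_le_compat _ _ _ _ (pos_INR _) (pos_INR _) (h _ hs) IH; lra.
Qed.

Lemma INR_prod_ge (F : nat -> nat) (e : nat -> R) u v :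
  (forall s, (u <= s < v)%N -> p2 (e s) <= INR (F s)) ->
  p2 (\rsum_(u <= s < v) e s) <= INR (\prod_(u <= s < v) F s).
Proof.
move=> h; rewrite [\prod_(u <= s < v) F s]big_nat_cond [\rsum_(u <= s < v) e s]big_nat_cond.
elim/big_rec2: _ => [|s y x /andP[hs _] IH]; first by rewrite p2_0 /=; lra.
rewrite mult_INR p2D; apply: Rmult_le_compat => //; try exact/Rlt_le/p2_gt0.
exact: h.
Qed.

Lemma INR_sum (F : nat -> nat) u v : INR (\sum_(u <= s < v) F s) = \rsum_(u <= s < v) INR (F s).
Proof. exact: (big_morph INR plus_INR erefl). Qed.

Section TreePart.
Variables (l D b T : nat).
Let m := (l * D)%N.
Let V := 'I_(2 ^ m).
Variables (q delta al ga : R) (f : 'I_(2 ^ (l * D)) -> R) (A0 B0 : {set 'I_(2 ^ (l * D))}) (lab : nat -> nat).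
Hypotheses (q1 : 1 < q) (d0 : 0 < delta) (d1 : delta < 1) (D1 : (1 <= D)%N) (b1 : (1 <= b)%N).
Hypotheses (Tl : (T * b <= l)%N) (lT : (l <= T * b + b)%N).
Hypothesis al0 : 0 < al.
Hypothesis fA : forall x, x \in A0 -> al < f x <= 2 * al.
Let pt := \rsum_x rpow (f x) q.
Hypothesis pt0 : 0 < pt.
Hypothesis massA : p2 (- ga) * pt <= \rsum_(x in A0) rpow (f x) q.
Hypothesis ball : forall t, (t < T)%N -> (lab t <= b)%N -> forall x, x \in A0 ->
    INR (2 ^ (lab t * D)) * node_mass m (fun k => rpow (f (modI m k)) q) (t * (b * D) + lab t * D) x <=
    INR (2 ^ (3 * D)) * node_mass m (fun k => rpow (f (modI m k)) q) (t * (b * D)) x.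
Hypothesis close : forall t, (t < T)%N -> (lab t <= b)%N -> forall y y' : 'I_(2 ^ (l * D)), y \in B0 -> y' \in B0 -> (y <= y')%N ->
    (y' - y < 2 ^ (m - t * (b * D) - lab t * D))%N -> (y' - y < 2 ^ (m - t.+1 * (b * D)))%N.

Notation key := (@dkey l D).
Notation reg := (regular_at key).
Let nest := @dkey_nest l D.

Variables (A1 : {set 'I_(2 ^ (l * D))}) (Ra : nat -> nat).
Hypotheses (sA1 : A1 \subset A0) (A1n : (0 < #|A1|)%N) (cA1 : (#|A0| <= #|A1| * D.+1 ^ l)%N).
Hypothesis regA : forall s, (s < l)%N -> reg s A1 (Ra s).

(** The exponent [1 - delta / 2] leaves a gap to the final [1 - delta]. A low level will be thinned
    below the final threshold, which costs at most [1 + delta / 2 * D] in the exponent. *)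
Let low (s : nat) : bool := `[< INR (Ra s) < p2 ((1 - delta / 2) * INR D) >].
Let nlow t := if (lab t <= b)%N then (\sum_(t * b <= s < t * b + lab t) (low s : nat))%N else 0%N.

Lemma Ra_le s : (s < l)%N -> (Ra s <= 2 ^ D)%N.
Proof.
by move=> hs; have /card_gt0P[a aA] := A1n; rewrite -(regA hs aA); apply: dchildren_le.
Qed.

Lemma block_prod u d : (u + d <= l)%N ->
  INR (\prod_(u <= s < u + d) Ra s) <= p2 (INR D * INR d - delta / 2 * INR D * INR (\sum_(u <= s < u + d) (low s : nat))).
Proof.
move=> hd; apply: Rle_trans (INR_prod_le (e := fun s => INR D - delta / 2 * INR D * INR (low s : nat)) _) _.
  move=> s /andP[h1 h2]; rewrite /low; case: asboolP => h /=.
    by apply: Rle_trans (Rlt_le _ _ h) _; apply: p2_le; lra.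
  rewrite Rmult_0_r Rminus_0_r p2_nat; apply: le_INR; apply/leP/Ra_le.
  exact: leq_trans h2 hd.
apply: p2_le; rewrite rsumB rsum_const_nat rsumZ INR_sum addKn; lra.
Qed.

Let w (x : 'I_(2 ^ (l * D))) := rpow (f x) q.
Let w0 x : 0 <= w x. Proof. exact: rpow_ge0. Qed.
Let lm := level_mass key w A1.

(** In an informative block, a node [lab t] levels down has at most the share
    [2 ^ ((3 - lab t) * D)] of its block, whereas each low level supplies fewer than
    [2 ^ ((1 - delta / 2) * D)] children. So every low level there costs [2 ^ (- delta / 2 * D)], up
    to [2 ^ (3 * D)] per block. Elsewhere the level mass merely does not grow. *)
Lemma chain_mass t : (t <= T)%N ->
  lm (t * b) <= pt * p2 (INR (3 * D) * INR t - delta / 2 * INR D * INR (\sum_(0 <= t' < t) nlow t')).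
Proof.
elim: t => [|t IH] ht.
  rewrite big_geq // /= !Rmult_0_r Rminus_0_r p2_0 Rmult_1_r; exact: level_mass_le_total.
have {}IH := IH (ltnW ht).
have tb : (t * b + b <= l)%N by rewrite -mulSnr; apply: leq_trans Tl; rewrite leq_mul2r ht orbT.
have lm0 s : 0 <= lm s by apply: level_mass_ge0.
suff step : lm (t.+1 * b) <= p2 (INR (3 * D) - delta / 2 * INR D * INR (nlow t)) * lm (t * b).
  apply: Rle_trans step _; apply: Rle_trans (Rmult_le_compat_l _ _ _ (Rlt_le _ _ (p2_gt0 _)) IH) _.
  have e : (\sum_(0 <= t' < t.+1) nlow t' = \sum_(0 <= t' < t) nlow t' + nlow t)%N by rewrite big_nat_recr.
  rewrite e (plus_INR (\sum_(0 <= t' < t) nlow t')%N) (S_INR t) (Rmult_comm (p2 _)) Rmult_assoc -p2D.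
  by apply: Req_le; congr (_ * p2 _); ring.
rewrite mulSnr /nlow; case: ifP => hl; last first.
  rewrite /= Rmult_0_r Rminus_0_r -[lm (_ + _)]Rmult_1_l; apply: Rmult_le_compat => //; try lra.
    by rewrite -p2_0; apply: p2_le; apply: pos_INR.
  by have := level_mass_mono nest w0 A1 tb.
have hd : (t * b + lab t <= l)%N by apply: leq_trans tb; rewrite leq_add2l.
apply: (@Rle_trans _ (lm (t * b + lab t))).
  have -> : (t * b + b = t * b + lab t + (b - lab t))%N by move: hl; clear; lia.
  have h3 : (t * b + lab t + (b - lab t) <= l)%N by move: tb hl; clear; lia.
  by have := level_mass_mono nest w0 A1 h3.
pose c := INR (2 ^ (3 * D)) * p2 (- INR (lab t * D)).
have c0 : 0 <= c by apply: Rmult_le_pos; [exact: pos_INR|exact/Rlt_le/p2_gt0].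
have drop := level_mass_drop (w := w) nest regA hd c0.
apply: Rle_trans (drop _) _.
  move=> a aA; have := ball ht hl (subsetP sA1 _ aA).
  have -> : (t * (b * D) + lab t * D = (t * b + lab t) * D)%N by rewrite mulnDl mulnA.
  rewrite mulnA (@node_mass_cyl l D w) // (@node_mass_cyl l D w) //; last by apply: leq_trans hd; apply: leq_addr.
  set X1 := cyl _ _ _ _; set X2 := cyl _ _ _ _ => h.
  rewrite /c; have e := p2N (INR (lab t * D)); rewrite p2_nat in e.
  have p0 := p2_gt0 (- INR (lab t * D)).
  have := Rmult_le_compat_l _ _ _ (Rlt_le _ _ p0) h.
  by rewrite -!Rmult_assoc e; lra.
apply: Rmult_le_compat_r => //.
apply: Rle_trans (Rmult_le_compat_r _ _ _ c0 (block_prod hd)) _.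
rewrite /c -p2_nat -!p2D; apply: p2_le; rewrite !mult_INR; lra.
Qed.

(** The chain of masses ends at the weight of [A1], which is still a large share of the total. The
    term [q] is the spread of [mu ^ q] within a dyadic class, [ga] the share lost by pigeonholing,
    and the logarithm the cost of regularising. *)
Lemma low_count : delta / 2 * INR D * INR (\sum_(0 <= t < T) nlow t) <=
  q + ga + INR l * log2 (INR D.+1) + INR (3 * D) * INR T.
Proof.
have h := chain_mass (leqnn T).
have lm1 : lm l <= lm (T * b).
  have h3 : (T * b + (l - T * b) <= l)%N by rewrite subnKC.
  by have := level_mass_mono nest w0 A1 h3; rewrite subnKC.
rewrite /lm level_mass_last in lm1; last exact: dkeyl.
have aq := rpow_gt0 q al0.
have lo : INR #|A1| * rpow al q <= \rsum_(x in A1) w x.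
  rewrite -rsum_const_in; apply: rsum_le => x /(subsetP sA1) /fA hx.
  by apply: rpow_le; lra.
have up : \rsum_(x in A0) w x <= INR #|A0| * (rpow 2 q * rpow al q).
  rewrite -rsum_const_in; apply: rsum_le => x /fA hx.
  by rewrite -rpowM; try lra; apply: rpow_le; lra.
have cc : INR #|A0| <= INR #|A1| * p2 (INR l * log2 (INR D.+1)).
  have -> : p2 (INR l * log2 (INR D.+1)) = INR (D.+1 ^ l).
    rewrite INR_expn Rmult_comm -Rpower_pow; last by apply: lt_0_INR; apply/ltP.
    rewrite /p2 -Rpower_mult -/(p2 _) p2_log2 //; by apply: lt_0_INR; apply/ltP.
  by rewrite -mult_INR; apply: le_INR; apply/leP.
have two : rpow 2 q = p2 q by rewrite -{1}p2_1 p2_rpow Rmult_1_l.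
set E1 := p2 (INR l * _) in cc.
have E10 : 0 < E1 by apply: p2_gt0.
have fin : p2 (- ga) * pt <= (p2 q * E1) * (pt * p2 (INR (3 * D) * INR T - delta / 2 * INR D * INR (\sum_(0 <= t' < T) nlow t'))).
  apply: Rle_trans massA _; apply: Rle_trans up _.
  apply: (@Rle_trans _ ((p2 q * E1) * (INR #|A1| * rpow al q))).
    rewrite two; have := Rmult_le_compat_r (p2 q * rpow al q) _ _ _ cc.
    have : 0 <= p2 q * rpow al q by apply: Rmult_le_pos; [exact/Rlt_le/p2_gt0|lra].
    move=> u h2; have := h2 u; lra.
  apply: Rmult_le_compat_l; first by apply: Rmult_le_pos; [exact/Rlt_le/p2_gt0|lra].
  by apply: Rle_trans lo _; apply: Rle_trans lm1 _.
have fin2 : p2 (- ga) <= p2 (q + INR l * log2 (INR D.+1) + (INR (3 * D) * INR T - delta / 2 * INR D * INR (\sum_(0 <= t' < T) nlow t'))).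
  apply: (Rmult_le_reg_r pt) => //; apply: Rle_trans fin _; rewrite !p2D -/E1; lra.
by have := p2_le_inv fin2; lra.
Qed.

Variables (B1 : {set 'I_(2 ^ (l * D))}) (Rb : nat -> nat).
Hypotheses (sB1 : B1 \subset B0) (B1n : (0 < #|B1|)%N) (cB1 : (#|B0| <= #|B1| * D.+1 ^ l)%N).
Hypothesis regB : forall s, (s < l)%N -> reg s B1 (Rb s).

Let triv (s : nat) : bool := [&& (s %/ b < T)%N, (lab (s %/ b) <= b)%N & (lab (s %/ b) <= s %% b)%N].

(** Past the type of a block, two points of one node are within the threshold of [close], hence
    closer than the node length at the end of the block, which is at most that of a child. Their
    children are equal or adjacent. *)
Lemma Rb_triv s : (s < l)%N -> triv s -> (Rb s <= 2)%N.
Proof.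
move=> hs /and3P[h1 h2 h3]; have /card_gt0P[z zB] := B1n; rewrite -(regB hs zB).
apply: card_close => _ _ /imsetP[x /setIdP[xB /eqP ex] ->] /imsetP[y /setIdP[yB /eqP ey] ->].
rewrite /= -/m; set la := (2 ^ (m - s.+1 * D))%N.
have la0 : (0 < la)%N by rewrite expn_gt0.
case: (leqP x y) => hxy; last by apply: leqW; apply: leq_div2r; apply: ltnW.
suff hla : (y - x <= la)%N.
  have -> : ((x %/ la).+1 = (la + x) %/ la)%N by rewrite divnDl ?dvdnn // divnn la0.
  by apply: leq_div2r; rewrite addnC -leq_subLR.
set t := (s %/ b)%N in h1 h2 h3; have sE : (s = t * b + s %% b)%N := divn_eq s b.
have sb : (s %% b < b)%N by rewrite ltn_mod.
have dist : (y - x < 2 ^ (m - s * D))%N.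
  have : dkey s x = dkey s y by rewrite ex ey.
  move/(congr1 val) => /=; rewrite -/m; set mu := (2 ^ (m - s * D))%N => e.
  have mu0 : (0 < mu)%N by rewrite expn_gt0.
  have dx := divn_eq x mu; have dy := divn_eq y mu; have ry := ltn_pmod y mu0.
  rewrite e in dx; move: dx dy ry; move: (y %/ mu * mu)%N (x %% mu)%N (y %% mu)%N => u1 u2 u3.
  by move: (nat_of_ord x) (nat_of_ord y); clear; lia.
have h4 : (y - x < 2 ^ (m - t.+1 * (b * D)))%N.
  apply: (close h1 h2 (subsetP sB1 _ xB) (subsetP sB1 _ yB) hxy).
  apply: leq_trans dist _; rewrite leq_exp2l // -subnDA leq_sub2l // mulnA -mulnDl leq_mul2r.
  by rewrite [X in (_ <= X)%N]sE leq_add2l h3 orbT.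
apply: ltnW; apply: leq_trans h4 _; rewrite leq_exp2l // leq_sub2l // mulnA leq_mul2r.
by rewrite [X in (X < _)%N]sE mulSn addnC ltn_add2r sb orbT.
Qed.

Let exc (s : nat) : nat := low s && ~~ triv s.

(** A low level where [B] may still branch lies in an uninformative block, among the first [lab t]
    levels of an informative one, or in the incomplete last block; the three terms correspond to
    these cases. *)
Lemma exc_count : (\sum_(0 <= s < l) exc s <=
  b * \sum_(0 <= t < T) (b < lab t : nat) + \sum_(0 <= t < T) nlow t + b)%N.
Proof.
rewrite (big_cat_nat (n := (T * b)%N)) //=; apply: leq_add; last first.
  apply: (@leq_trans (\sum_(T * b <= s < l) 1)%N); last by rewrite sum_nat_const_nat muln1; move: lT; clear; lia.
  by apply: leq_sum => s _; rewrite /exc; case: (_ && _).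
suff h t : (t <= T)%N -> (\sum_(0 <= s < t * b) exc s <=
    b * \sum_(0 <= t' < t) (b < lab t' : nat) + \sum_(0 <= t' < t) nlow t')%N by exact: h.
elim: t => [|t IH] ht; first by rewrite mul0n big_geq.
rewrite (big_cat_nat (n := (t * b)%N)) //=; last by rewrite leq_mul2r leqnSn orbT.
have e1 : (\sum_(0 <= t' < t.+1) (b < lab t' : nat) = \sum_(0 <= t' < t) (b < lab t' : nat) + (b < lab t))%N.
  by rewrite big_nat_recr.
have e2 : (\sum_(0 <= t' < t.+1) nlow t' = \sum_(0 <= t' < t) nlow t' + nlow t)%N by rewrite big_nat_recr.
rewrite e1 e2 mulnDr addnACA; apply: leq_add; first exact: IH (ltnW ht).
have one s : (exc s <= 1)%N by rewrite /exc; case: (_ && _).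
rewrite mulSnr /nlow; case: ltnP => hl.
  apply: (@leq_trans (\sum_(t * b <= s < t * b + b) 1)%N); first by apply: leq_sum.
  by rewrite sum_nat_const_nat addKn !muln1 leq_addr.
rewrite (big_cat_nat (n := (t * b + lab t)%N)) /=; rewrite ?leq_addr ?leq_add2l //.
rewrite muln0 add0n -[X in (_ <= X)%N]addn0; apply: leq_add.
  by apply: leq_sum => s _; rewrite /exc; case: (low s); case: (triv s).
rewrite big_nat_cond big1 // => s /andP[/andP[s1 s2] _]; rewrite /exc.
have dv : (s %/ b = t)%N.
  have -> : (s = t * b + (s - t * b))%N by move: s1; clear; lia.
  by rewrite divnMDl // divn_small ?addn0 //; move: s2; clear; lia.
have md : (s %% b = s - t * b)%N by rewrite {2}(divn_eq s b) dv addKn.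
have -> : triv s by rewrite /triv dv md ht hl /=; move: s1; clear; lia.
by rewrite andbF.
Qed.

(** At low levels [A] is thinned below the threshold and [B] to a single child; elsewhere both keep
    their branching. Thus [Sc] counts exactly the levels that are not low, and [B] can branch only
    there. [B] pays a factor at most [2] at a low level past the type and at most [2 ^ D] at an
    exceptional one. *)
Lemma tree_output : exists (A B : {set 'I_(2 ^ (l * D))}) (R1 R2 : nat -> nat),
  [/\ A \subset A0, B \subset B0, (0 < #|A|)%N & (0 < #|B|)%N] /\
  (forall s, (s < l)%N -> reg s A (R1 s)) /\ (forall s, (s < l)%N -> reg s B (R2 s)) /\
  (forall s, (s < l)%N -> R2 s = 1%N \/ p2 ((1 - delta) * INR D) <= INR (R1 s)) /\
  (let Sc := #|[set s : 'I_l | Rleb (pow2R ((1 - delta) * INR D)) (INR (R1 s))]| in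
   p2 ((1 - delta / 2) * INR D * INR Sc) <= INR #|A0| /\ INR #|B| <= p2 (INR D * INR Sc)) /\
  INR #|A0| <= INR #|A| * p2 (INR l * log2 (INR D.+1) + INR l * (1 + delta / 2 * INR D)) /\
  INR #|B0| <= INR #|B| * p2 (INR l * log2 (INR D.+1) + INR l +
     INR D * (INR (b * \sum_(0 <= t < T) (b < lab t : nat) + b)) +
     2 / delta * (q + ga + INR l * log2 (INR D.+1) + INR (3 * D) * INR T)).
Proof.
have x1 : 1 < p2 ((1 - delta) * INR D).
  rewrite -[X in X < _]p2_0; apply: p2_lt; apply: Rmult_lt_0_compat; first lra.
  by apply: lt_0_INR; apply/ltP.
have [k0 [k0p [k0x xk0]]] := below_half x1.
pose R1 s := if low s then minn (Ra s) k0 else Ra s.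
pose R2 s := if low s then 1%N else Rb s.
have Rap s : (s < l)%N -> (0 < Ra s)%N.
  move=> hs; have /card_gt0P[a aA] := A1n; rewrite -(regA hs aA); apply/card_gt0P.
  by exists (dkey s.+1 a); apply: imset_f; rewrite inE aA /=.
have Rbp s : (s < l)%N -> (0 < Rb s)%N.
  move=> hs; have /card_gt0P[a aA] := B1n; rewrite -(regB hs aA); apply/card_gt0P.
  by exists (dkey s.+1 a); apply: imset_f; rewrite inE aA /=.
have Rb_le s : (s < l)%N -> (Rb s <= 2 ^ D)%N.
  by move=> hs; have /card_gt0P[a aA] := B1n; rewrite -(regB hs aA); apply: dchildren_le.
have hR1 s : (s < l)%N -> (0 < R1 s <= Ra s)%N.
  by move=> hs; rewrite /R1; case: (low s); rewrite ?leqnn ?Rap // geq_minl leq_min Rap ?k0p.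
have hR2 s : (s < l)%N -> (0 < R2 s <= Rb s)%N.
  by move=> hs; rewrite /R2; case: (low s); rewrite ?leqnn Rbp.
have [A [sA nA rA]] := thin nest A1n regA hR1.
have [B [sB nB rB]] := thin nest B1n regB hR2.
have dD : 0 <= delta / 2 * INR D by apply: Rmult_le_pos; [lra|apply: pos_INR].
have LS s : (s < l)%N -> Rleb (pow2R ((1 - delta) * INR D)) (INR (R1 s)) = ~~ low s.
  move=> hs; rewrite /Rleb; case: (boolP (low s)) => hl; case: Rle_dec => h //=; exfalso.
    have : INR (R1 s) <= INR k0 by rewrite /R1 hl; apply: le_INR; apply/leP; apply: geq_minr.
    by move: k0x; lra.
  apply: h; rewrite /R1 (negbTE hl); move/asboolPn: hl => /Rnot_lt_le; apply: Rle_trans.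
  apply: p2_le; have := pos_INR D; nra.
set Sc := #|[set s : 'I_l | Rleb (pow2R ((1 - delta) * INR D)) (INR (R1 s))]|.
have ScE : Sc = (\sum_(0 <= s < l) (~~ low s : nat))%N.
  rewrite big_mkord /Sc -sum1dep_card big_mkcond /=; apply: eq_bigr => s _.
  by rewrite LS //; case: (low s).
have cA := regular_card nest (@dkey0 l D) (@dkeyl l D) nA rA.
have cB := regular_card nest (@dkey0 l D) (@dkeyl l D) nB rB.
have cA' := regular_card nest (@dkey0 l D) (@dkeyl l D) A1n regA.
have cB' := regular_card nest (@dkey0 l D) (@dkeyl l D) B1n regB.
have LDE : INR (D.+1 ^ l) = p2 (INR l * log2 (INR D.+1)).
  rewrite INR_expn Rmult_comm -Rpower_pow; last by apply: lt_0_INR; apply/ltP.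
  rewrite /p2 -Rpower_mult -/(p2 _) p2_log2 //; by apply: lt_0_INR; apply/ltP.
exists A, B, R1, R2; split.
  by split => //; [exact: subset_trans sA sA1|exact: subset_trans sB sB1].
split => //; split => //; split.
  move=> s hs; have := LS s hs; rewrite /R2; case: (low s) => h; [by left|right].
  by move: h; rewrite /Rleb; case: Rle_dec.
split; first split.
- apply: (@Rle_trans _ (INR #|A1|)); last by apply: le_INR; apply/leP/subset_leq_card.
  rewrite cA' -/Sc ScE INR_sum -rsumZ; apply: INR_prod_ge => s /andP[_ hs].
  rewrite /low; case: asboolP => h /=; last by rewrite Rmult_1_r; lra.
  by rewrite Rmult_0_r p2_0 -[1]/(INR 1); apply: le_INR; apply/leP/Rap.
- rewrite cB -/Sc ScE INR_sum -rsumZ; apply: INR_prod_le => s /andP[_ hs].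
  rewrite /R2; case: (low s) => /=; first by rewrite Rmult_0_r p2_0; lra.
  by rewrite Rmult_1_r p2_nat; apply: le_INR; apply/leP/Rb_le.
split.
- rewrite p2D (Rmult_comm (p2 _)) -Rmult_assoc -LDE.
  apply: Rle_trans (_ : INR #|A1| * INR (D.+1 ^ l) <= _).
    by rewrite -mult_INR; apply: le_INR; apply/leP.
  apply: Rmult_le_compat_r; first exact: pos_INR.
  rewrite cA cA'.
  apply: Rle_trans (INR_prod_ratio (G := R1) (e := fun _ => 1 + delta / 2 * INR D) _) _.
    move=> s /andP[_ hs]; rewrite p2D p2_1 /R1 /low; case: asboolP => h; last first.
      have : 1 <= p2 (delta / 2 * INR D) by rewrite -p2_0; apply: p2_le.
      have := pos_INR (Ra s); nra.
    have e : p2 ((1 - delta / 2) * INR D) = p2 ((1 - delta) * INR D) * p2 (delta / 2 * INR D).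
      by rewrite -p2D; congr p2; field.
    have g0 := p2_gt0 (delta / 2 * INR D); have g1 : 1 <= p2 (delta / 2 * INR D) by rewrite -p2_0; apply: p2_le.
    have r0 := pos_INR (Ra s).
    case: (leqP (Ra s) k0) => hk; first by nra.
    rewrite e in h; have := Rmult_le_compat_r _ _ _ (Rlt_le _ _ g0) xk0; lra.
  by rewrite rsum_const_nat subn0; lra.
- have lc := low_count; have ec := exc_count.
  have key1 : INR #|B1| <= INR #|B| * p2 (INR l + INR D * INR (\sum_(0 <= s < l) exc s)).
    rewrite cB cB'; apply: Rle_trans (INR_prod_ratio (G := R2) (e := fun s => 1 + INR D * INR (exc s)) _) _.
      move=> s /andP[_ hs]; have D0 := pos_INR D; rewrite p2D p2_1 /R2 /exc.
      case: (low s) => /=.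
        case: (boolP (triv s)) => ht /=.
          rewrite Rmult_0_r p2_0; have := le_INR _ _ (leP (Rb_triv hs ht)); rewrite /=; lra.
        rewrite Rmult_1_r p2_nat; have := le_INR _ _ (leP (Rb_le _ hs)); have := pos_INR (2 ^ D); lra.
      by rewrite Rmult_0_r p2_0; have := pos_INR (Rb s); lra.
    by rewrite rsumD rsumZ rsum_const_nat INR_sum subn0; apply: Req_le; congr (_ * p2 _); lra.
  apply: (@Rle_trans _ (INR #|B1| * p2 (INR l * log2 (INR D.+1)))).
    by rewrite -LDE -mult_INR; apply: le_INR; apply/leP.
  apply: Rle_trans (Rmult_le_compat_r _ _ _ (Rlt_le _ _ (p2_gt0 _)) key1) _.
  rewrite Rmult_assoc -p2D; apply: Rmult_le_compat_l; first exact: pos_INR.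
  apply: p2_le.
  have ec' : INR (\sum_(0 <= s < l) exc s) <= INR (b * \sum_(0 <= t < T) (b < lab t : nat) + b) + INR (\sum_(0 <= t < T) nlow t).
    rewrite -plus_INR; apply: le_INR; apply/leP; rewrite plusE addnAC; exact: ec.
  have ec2 := Rmult_le_compat_l _ _ _ (pos_INR D) ec'.
  have lc2 : INR D * INR (\sum_(0 <= t < T) nlow t) <= 2 / delta * (q + ga + INR l * log2 (INR D.+1) + INR (3 * D) * INR T).
    have i0 : 0 <= 2 / delta by apply/Rlt_le/Rdiv_lt_0_compat; lra.
    have := Rmult_le_compat_l _ _ _ i0 lc.
    have -> : 2 / delta * (delta / 2 * INR D * INR (\sum_(0 <= t < T) nlow t)) = INR D * INR (\sum_(0 <= t < T) nlow t).
      by field; lra.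
    by [].
  lra.
Qed.
End TreePart.

(** * Choice of parameters *)

Lemma rsum_setT (I : finType) (F : I -> R) : rsum [set: I] F = \rsum_i F i.
Proof. by rewrite /rsum; apply: eq_bigl => i; rewrite inE. Qed.

Lemma measure2_transl m (mu : 'I_(2 ^ m) -> R) x : measure2 mu -> measure2 (transl x mu).
Proof.
move=> [h0 h1]; split; first by move=> i; apply: h0.
by rewrite rsum_setT (transl_sum (fun y => y)) -rsum_setT.
Qed.

Lemma lqnormE m q (mu : 'I_(2 ^ m) -> R) : lqnorm q mu = rpow (\rsum_i rpow (mu i) q) (1 / q).
Proof. by rewrite /lqnorm /lqnorm_on rsum_setT. Qed.

Lemma measure2_pnorm_gt0 m q (mu : 'I_(2 ^ m) -> R) : measure2 mu -> 0 < \rsum_i rpow (mu i) q.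
Proof.
move=> hm; have [i hi] := mass_exists hm.
have : rpow (mu i) q <= \rsum_i rpow (mu i) q.
  by apply: (@rsum_ge_term _ predT (fun i => rpow (mu i) q)) => // j _; apply: rpow_ge0.
have hmu : 0 < mu i by have := p2_gt0 (- INR m); lra.
by have := rpow_gt0 q hmu; lra.
Qed.

Section Bounds.
Variables (q dl : R) (l D b T k : nat) (eta th A lam eps bt : R).
Let m := (l * D)%N.
Hypotheses (q1 : 1 < q) (d0 : 0 < dl) (d1 : dl < 1) (D4 : (4 <= D)%N) (b1 : (1 <= b)%N).
Hypotheses (Tl : (T * b <= l)%N) (lT : (l <= T * b + b)%N).
Hypotheses (eta0 : 0 <= eta) (th0 : 0 < th) (hM : INR (2 ^ (b * D)) * eta <= th / 200) (A1 : 1 <= A).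
Hypothesis A2 : A * (1 - Rmin (1 / q) (1 - 1 / q) * (eta / 2) ^ 2) <= 1.
Hypothesis hlam : 1 + (A - 1) * (INR (2 ^ (b * D)) * rpow th (1 / q)) <= lam.
Hypothesis Hedge : (T * 4 <= k.+1 * 2 ^ D)%N.
Hypothesis Hbad : lam ^ T <= / 8 * p2 (- eps * INR m) * A ^ k.
Hypothesis Hm : p2 (- INR m) <= / 16 * p2 (- eps * INR m).
Hypothesis Hcount : INR (b.+2 ^ T * (3 * m) ^ 2 * (2 ^ l) ^ 2) * p2 (- bt * INR m) <= / 4 * p2 (- eps * INR m).
Variables (mu nu : 'I_(2 ^ (l * D)) -> R).
Hypotheses (mmu : measure2 mu) (mnu : measure2 nu).
Hypothesis Hnorm : p2 (- eps * INR m) * lqnorm q mu <= lqnorm q (conv mu nu).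

Let ga := bt * INR m * q.
Let LD := INR l * log2 (INR D.+1).
Let lossA := q + ga + LD + INR l * (1 + dl / 2 * INR D).
Let Z := LD + INR l + INR D * INR (b * (k + k) + b) + 2 / dl * (q + ga + LD + INR (3 * D) * INR T).
Let lossB := (bt * INR m + 1) / (1 - 1 / q) + 1 + 1 + Z.

(* lossA and lossB are the logarithmic losses of mass of A and B: dyadic classes, pigeonholing over
   labels, regularisation and thinning of the trees. *)
Lemma inverse_bounds : exists (t1 t2 : 'I_(2 ^ (l * D))) (A B : {set 'I_(2 ^ (l * D))}) (R1 R2 : nat -> nat),
  let mu' := transl t1 mu in let nu' := transl t2 nu in
  let Sc := #|[set s : 'I_l | Rleb (pow2R ((1 - dl) * INR D)) (INR (R1 s))]| in
  [/\ (forall x, x \in A -> 0 < mu' x), (forall y, y \in B -> 0 < nu' y),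
      (forall x y, x \in A -> y \in A -> mu' y <= 2 * mu' x) &
      (forall x y, x \in B -> y \in B -> nu' y <= 2 * nu' x)] /\
  [/\ (forall (s : nat) a, (s < l)%N -> a \in A -> Ncount (s.+1 * D) (cap_blk (s * D) A a) = R1 s),
      (forall (s : nat) a, (s < l)%N -> a \in B -> Ncount (s.+1 * D) (cap_blk (s * D) B a) = R2 s),
      (forall x (s : nat), x \in A -> (s < l)%N -> in_half (l * D) (s * D) x) &
      (forall x (s : nat), x \in B -> (s < l)%N -> in_half (l * D) (s * D) x)] /\
  [/\ (forall s, (s < l)%N -> (0 < R1 s)%N),
      (forall s, (s < l)%N -> R2 s = 1%N \/ p2 ((1 - dl) * INR D) <= INR (R1 s)),
      p2 (- lossA) * (\rsum_i rpow (mu i) q) <= \rsum_(x in A) rpow (mu' x) q &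
      p2 (- lossB) <= \rsum_(y in B) nu' y] /\
  (q - 1) * ((1 - dl / 2) * INR D * INR Sc) <= q + ga - log2 (\rsum_i rpow (mu i) q) /\
  p2 (- (lossB + 1) * q - (q - 1) * (INR D * INR Sc)) <= \rsum_i rpow (nu i) q.
Proof.
have TN : (T * (b * D) <= m)%N by rewrite mulnA leq_mul2r Tl orbT.
have D1 : (1 <= D)%N by move: D4; clear; lia.
have pt0 := measure2_pnorm_gt0 q mmu.
set pt := \rsum_i rpow (mu i) q in pt0 *.
have q0 : 0 < 1 / q by apply: Rdiv_lt_0_compat; lra.
(* Translating [nu] by [x0] translates the convolution, so that half of its [q]-th power sums sits
   at points rarely at an edge. This translation is finally merged with [t2]. *)
have [x0 hx0] := edge_shift b1 D1 TN (fun i => rpow_ge0 (conv mu nu i) q) Hedge.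
set nux := transl x0 nu.
have mnux : measure2 nux by apply: measure2_transl.
have cE w : conv mu nux w = conv mu nu (subI w x0) by apply: transl_conv.
have csum : \rsum_w rpow (conv mu nux w) q = \rsum_w rpow (conv mu nu w) q.
  under eq_bigr => w _ do rewrite cE.
  by rewrite [RHS](reindex_inj (@subI_inj m x0)).
have HO : / 2 * \rsum_w rpow (conv mu nux w) q <= \rsum_(w < 2 ^ m)
   (if (\sum_(t < T) (edge m b D t w : nat) <= k)%N then rpow (conv mu nux (modI m w)) q else 0).
  rewrite csum; apply: Rle_trans hx0 _; rewrite big_mkcond; apply: rsum_le => w _.
  by case: ifP => _; [rewrite modI_val cE|]; apply: Rle_refl.
have Hn : p2 (- eps * INR m * q) * pt <= \rsum_w rpow (conv mu nux w) q.
  rewrite csum; apply: (rpow_le_inv q0).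
    by apply: rsum_ge0 => *; apply: rpow_ge0.
  rewrite rpowM; [|exact/Rlt_le/p2_gt0|exact: Rlt_le].
  rewrite p2_rpow (_ : - eps * INR m * q * (1 / q) = - eps * INR m); last by field; lra.
  by move: Hnorm; rewrite !lqnormE.
have [t1 [t2 [lab [A0 [B0 [al [be]]]]]]] :=
  core_structure q1 D4 TN b1 Tl eta0 th0 hM A1 A2 hlam mmu mnux HO Hn Hbad Hm (mid_card l (leq_trans (isT : (2 <= 4)%N) D4)) Hcount.
rewrite -/pt => -[[al0 be0 fA fB] [massA [massB [midA [midB [hlab [ball close]]]]]]].
set f := transl t1 mu in fA massA ball; set g := transl t2 nux in fB massB.
have gE : g = transl (addI t2 x0) nu by rewrite /g /nux transl_transl.
have mf : measure2 f by apply: measure2_transl.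
have mg : measure2 g by apply: measure2_transl.
have f0 := mf.1; have g0 := mg.1.
have ptf : \rsum_i rpow (f i) q = pt by rewrite /f (transl_sum (fun y => rpow y q)).
have A0n : (0 < #|A0|)%N.
  rewrite lt0n; apply/negP => /eqP /cards0_eq e; move: massA; rewrite e big_set0.
  by have := Rmult_lt_0_compat _ _ (p2_gt0 (- bt * INR m * q)) pt0; lra.
have B0n : (0 < #|B0|)%N.
  rewrite lt0n; apply/negP => /eqP /cards0_eq e; move: massB; rewrite e big_set0.
  by have := p2_gt0 (- ((bt * INR m + 1) / (1 - 1 / q) + 1)); lra.
have [A1' [Ra [sA1 nA1 cA1 rA1]]] := regularize (@dkey_nest l D) (@dkeyl l D) (@dchildren_le l D) A0n.
have [B1' [Rb [sB1 nB1 cB1 rB1]]] := regularize (@dkey_nest l D) (@dkeyl l D) (@dchildren_le l D) B0n.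
have massA' : p2 (- ga) * (\rsum_x rpow (f x) q) <= \rsum_(x in A0) rpow (f x) q.
  by rewrite ptf /ga (_ : - (bt * INR m * q) = - bt * INR m * q) //; ring.
have pt0' : 0 < \rsum_x rpow (f x) q by rewrite ptf.
have [As [Bs [R1 [R2 [[sA sB nA nB] [rA [rB [hv [[vi1 vi2] [cA cB]]]]]]]]]] :=
  tree_output q1 d0 d1 D1 b1 Tl lT al0 fA pt0' massA' ball close sA1 nA1 cA1 rA1 sB1 nB1 cB1 rB1.
exists t1, (addI t2 x0), As, Bs, R1, R2; rewrite /= -gE -/f.
set Sc := #|[set s : 'I_l | Rleb (pow2R ((1 - dl) * INR D)) (INR (R1 s))]| in vi1 vi2 *.
have hA x : x \in As -> al < f x <= 2 * al by move/(subsetP sA)/fA.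
have hB x : x \in Bs -> be < g x <= 2 * be by move/(subsetP sB)/fB.
have [nA0 nA0E] : exists r, INR #|A0| = r by eexists.
have [nAs nAsE] : exists r, INR #|As| = r by eexists.
have [nB0 nB0E] : exists r, INR #|B0| = r by eexists.
have [nBs nBsE] : exists r, INR #|Bs| = r by eexists.
have sumA0 c : \rsum_(x in A0) c = nA0 * c by rewrite rsum_const_in nA0E.
have sumAs c : \rsum_(x in As) c = nAs * c by rewrite rsum_const_in nAsE.
have sumB0 c : \rsum_(x in B0) c = nB0 * c by rewrite rsum_const_in nB0E.
have sumBs c : \rsum_(x in Bs) c = nBs * c by rewrite rsum_const_in nBsE.
have iA0 : 0 < nA0 by rewrite -nA0E; apply: lt_0_INR; apply/ltP.
have iAs : 0 < nAs by rewrite -nAsE; apply: lt_0_INR; apply/ltP.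
have iB0 : 0 < nB0 by rewrite -nB0E; apply: lt_0_INR; apply/ltP.
have iBs : 0 < nBs by rewrite -nBsE; apply: lt_0_INR; apply/ltP.
have two : rpow 2 q = p2 q by rewrite -{1}p2_1 p2_rpow Rmult_1_l.
have upA : \rsum_(x in A0) rpow (f x) q <= nA0 * (p2 q * rpow al q).
  rewrite -two -sumA0; apply: rsum_le => x /fA hx.
  by rewrite -rpowM; try lra; apply: rpow_le; lra.
have {}cA : nA0 <= nAs * p2 (INR l * log2 (INR D.+1) + INR l * (1 + dl / 2 * INR D)) := ltac:(rewrite -nA0E -nAsE; exact: cA).
have {}vi1 : p2 ((1 - dl / 2) * INR D * INR Sc) <= nA0 := ltac:(rewrite -nA0E; exact: vi1).
have {}vi2 : nBs <= p2 (INR D * INR Sc) := ltac:(rewrite -nBsE; exact: vi2).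
have aq := rpow_gt0 q al0.
set Z0 := _ + _ in cB.
have {}cB : nB0 <= nBs * p2 Z0 := ltac:(rewrite -nB0E -nBsE; exact: cB).
have Z0Z : Z0 <= Z.
  rewrite /Z0 /Z /LD; apply: Rplus_le_compat; last exact: Rle_refl.
  apply: Rplus_le_compat_l; apply: Rmult_le_compat_l; first exact: pos_INR.
  by apply: le_INR; apply/leP; rewrite leq_add2r leq_mul2l big_mkord hlab orbT.
have mB : p2 (- lossB) <= \rsum_(y in Bs) g y.
  have h1 : \rsum_(y in B0) g y <= nB0 * (2 * be).
    by rewrite -sumB0; apply: rsum_le => y /fB [].
  have h2 : nBs * be <= \rsum_(y in Bs) g y.
    by rewrite -sumBs; apply: rsum_le => y /hB [h _]; lra.
  have h3 : nB0 <= nBs * p2 Z.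
    by apply: Rle_trans cB _; apply: Rmult_le_compat_l; [lra|apply: p2_le].
  have h4 : p2 (- ((bt * INR m + 1) / (1 - 1 / q) + 1)) <= p2 (1 + Z) * \rsum_(y in Bs) g y.
    apply: Rle_trans massB _; apply: Rle_trans h1 _; rewrite p2D p2_1.
    have := Rmult_le_compat_r (2 * be) _ _ ltac:(lra) h3.
    have := Rmult_le_compat_l (p2 Z) _ _ (Rlt_le _ _ (p2_gt0 _)) h2; lra.
  apply: (Rmult_le_reg_l (p2 (1 + Z))); first exact: p2_gt0.
  by apply: Rle_trans h4; rewrite -p2D; apply: p2_le; rewrite /lossB; lra.
split; [split|split; [split|split; [split|split]]].
- by move=> x /hA; lra.
- by move=> x /hB; lra.
- by move=> x y /hA ? /hA ?; lra.
- by move=> x y /hB ? /hB ?; lra.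
- by move=> s a hs ha; rewrite Ncount_children; apply: rA.
- by move=> s a hs ha; rewrite Ncount_children; apply: rB.
- by move=> x s /(subsetP sA) /midA /forallP h hs; apply: (h (Ordinal hs)).
- by move=> x s /(subsetP sB) /midB /forallP h hs; apply: (h (Ordinal hs)).
- move=> s hs; have /card_gt0P[a aA] := nA; rewrite -(rA s hs a aA); apply/card_gt0P.
  by exists (dkey s.+1 a); apply: imset_f; rewrite inE aA /=.
- exact: hv.
- have h1 : nAs * rpow al q <= \rsum_(x in As) rpow (f x) q.
    by rewrite -sumAs; apply: rsum_le => x /hA h; apply: rpow_le; lra.
  apply: (Rmult_le_reg_l (p2 (q + LD + INR l * (1 + dl / 2 * INR D)))); first exact: p2_gt0.
  rewrite -Rmult_assoc -p2D.
  have -> : q + LD + INR l * (1 + dl / 2 * INR D) + - lossA = - ga by rewrite /lossA; ring.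
  rewrite -ptf; apply: Rle_trans massA' _; apply: Rle_trans upA _.
  have e : p2 (q + LD + INR l * (1 + dl / 2 * INR D)) = p2 q * p2 (LD + INR l * (1 + dl / 2 * INR D)).
    by rewrite -p2D; congr p2; ring.
  rewrite e.
  have := Rmult_le_compat_r (p2 q * rpow al q) _ _ _ cA.
  have pq := p2_gt0 q.
  have nn : 0 <= p2 q * rpow al q by apply: Rmult_le_pos; lra.
  move=> h2; apply: Rle_trans (h2 nn) _.
  rewrite /LD; set E := p2 (_ + _).
  have E0 : 0 <= p2 q * E by apply: Rmult_le_pos; [lra|exact/Rlt_le/p2_gt0].
  apply: Rle_trans (Rmult_le_compat_l _ _ _ E0 h1); apply: Req_le; ring.
- exact: mB.
(* [A0] has mass at most [1] and values above [al], so [al] is at most [1 / nA0]. The share of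
   [mu ^ q] on [A0] is then at most [2 ^ q * nA0 ^ (1 - q)], which bounds [nA0] and with it [Sc]. *)
- have x0E := esym (p2_log2 iA0); set x := log2 (nA0) in x0E.
  have vx : (1 - dl / 2) * INR D * INR Sc <= x by apply: p2_le_inv; rewrite -x0E.
  have al1 : al <= p2 (- x).
    have h : nA0 * al <= 1.
      have s1 : \rsum_i f i = 1 by rewrite -rsum_setT; exact: mf.2.
      rewrite -s1 -sumA0; apply: (@Rle_trans _ (\rsum_(x in A0) f x)).
        by apply: rsum_le => y /fA [h _]; lra.
      by apply: rsum_sub.
    apply: (Rmult_le_reg_l (p2 x)); first exact: p2_gt0.
    by rewrite -p2D Rplus_opp_r p2_0 -x0E.
  have h : p2 (- ga) * p2 (log2 pt) <= p2 x * (p2 q * p2 (- x * q)).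
    rewrite (p2_log2 pt0) -{1}ptf; apply: Rle_trans massA' _; apply: Rle_trans upA _.
    rewrite -x0E; apply: Rmult_le_compat_l; first lra.
    apply: Rmult_le_compat_l; first exact/Rlt_le/p2_gt0.
    by rewrite -p2_rpow; apply: rpow_le; lra.
  rewrite -!p2D in h; have {}h := p2_le_inv h.
  have := Rmult_le_compat_l (q - 1) _ _ ltac:(lra) vx; lra.
(* The mass of [Bs] is at most [2 * be * nBs], which bounds [be] below; [nBs * be ^ q] is then at
   least a quantity decreasing in [nBs] as [q > 1], and [nBs] is at most [2 ^ (D * Sc)]. *)
- have yE := esym (p2_log2 iBs); set y := log2 (nBs) in yE.
  have cE' := esym (p2_log2 be0); set c := log2 be in cE'.
  have yS : y <= INR D * INR Sc by apply: p2_le_inv; rewrite -yE.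
  have h1 : p2 (- lossB) <= p2 (1 + c + y).
    apply: Rle_trans mB _; rewrite !p2D p2_1 -cE' -yE Rmult_comm -sumBs.
    by apply: rsum_le => z /hB [].
  have {}h1 := p2_le_inv h1.
  have h2 : p2 (y + c * q) <= \rsum_i rpow (nu i) q.
    have <- : \rsum_i rpow (g i) q = \rsum_i rpow (nu i) q by rewrite gE (transl_sum (fun y => rpow y q)).
    apply: (@Rle_trans _ (\rsum_(z in Bs) rpow (g z) q)); last first.
      by apply: rsum_sub => // *; apply: rpow_ge0.
    rewrite p2D -p2_rpow -cE' -yE -sumBs; apply: rsum_le => z /hB h.
    by apply: rpow_le; lra.
  apply: Rle_trans h2; apply: p2_le; nra.
Qed.
End Bounds.

(** * Numerical estimates and the order of the parameters *)

Lemma p2_sq y : 0 <= y -> y ^ 2 / 16 <= p2 y.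
Proof.
move=> y0; rewrite /p2 /Rpower.
have -> : y * ln 2 = y * ln 2 / 2 + y * ln 2 / 2 by field.
rewrite exp_plus; have l2 : / 2 < ln 2 by exact: ln_lt_2.
have := exp_ineq1_le (y * ln 2 / 2) => h.
have h1 : y / 4 <= exp (y * ln 2 / 2) by nra.
by have := Rmult_le_compat _ _ _ _ (ltac:(lra) : 0 <= y / 4) (ltac:(lra) : 0 <= y / 4) h1 h1; nra.
Qed.

Lemma p2_pow y n : p2 y ^ n = p2 (y * INR n).
Proof.
by rewrite -Rpower_pow ?/p2 ?Rpower_mult //; apply: exp_pos.
Qed.

Lemma p2_ge1p x : 0 <= x -> 1 + x <= p2 (2 * x).
Proof.
move=> x0; rewrite /p2 /Rpower; apply: Rle_trans (exp_ineq1_le _) _.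
have l2 : / 2 < ln 2 by exact: ln_lt_2.
case: (Req_dec (2 * x * ln 2) x) => [->|ne]; first exact: Rle_refl.
by apply/Rlt_le/exp_increasing; nra.
Qed.

Lemma p2_le1p h : 0 <= h -> h <= 1 -> p2 h <= 1 + h.
Proof.
move=> h0 h1; have := @gm_am1 h 2 1 h0 h1 ltac:(lra) ltac:(lra).
by rewrite /gm rpow_1l Rmult_1_r rpow_pos -/(p2 h); lra.
Qed.

Lemma nat_above x : exists k, x <= INR k.
Proof. by have [k hk] := INR_unbounded x; exists k; lra. Qed.

Lemma nat_ceil x : 0 <= x -> exists k, x <= INR k <= x + 1.
Proof.
move=> x0; have ex : exists k, `[< x <= INR k >] by have [k hk] := nat_above x; exists k; apply/asboolP.
case: (ex_minnP ex) => k /asboolP h1 h2; exists k; split => //.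
case: k h1 h2 => [|k] h1 h2; first by rewrite /=; lra.
have : INR k < x by apply: Rnot_le_lt => h; have := h2 k (introT (asboolP _) h); rewrite ltnn.
by rewrite S_INR; lra.
Qed.

(** With [th = 2 ^ (- 2 * q * N)] the light cells of a block contribute
    [2 ^ N * th ^ (1 / q) = 2 ^ (- N)]. With [h] the loss of [gm_holder_stab], [A = 1 + h] satisfies
    [A * (1 - h) <= 1], and [lam - 1] is smaller than [A - 1] by the factor [2 ^ (- N)]. *)
Lemma small_params (q : R) (N : nat) : 1 < q -> exists eta th A lam h : R,
  [/\ 0 <= eta, 0 < th, INR (2 ^ N) * eta <= th / 200, 1 <= A &
   A * (1 - Rmin (1 / q) (1 - 1 / q) * (eta / 2) ^ 2) <= 1] /\
  [/\ 1 + (A - 1) * (INR (2 ^ N) * rpow th (1 / q)) <= lam, 0 < h, h <= 1, A = 1 + h & lam = 1 + h * p2 (- INR N)].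
Proof.
move=> q1.
pose th := p2 (- 2 * q * INR N); pose eta := th / 200 * p2 (- INR N).
have th0 : 0 < th by apply: p2_gt0.
have N0 := pos_INR N.
have pN : 0 < p2 (- INR N) by apply: p2_gt0.
have th1 : th <= 1 by rewrite -p2_0; apply: p2_le; nra.
have pN1 : p2 (- INR N) <= 1 by rewrite -[X in _ <= X]p2_0; apply: p2_le; lra.
have eta0 : 0 < eta by apply: Rmult_lt_0_compat; lra.
have eta1 : eta <= 1 by rewrite /eta; nra.
have qa : 0 < 1 / q < 1.
  split; first by apply: Rdiv_lt_0_compat; lra.
  by apply: (Rmult_lt_reg_r q); [lra|field_simplify; lra].
set c := Rmin (1 / q) (1 - 1 / q).
have c0 : 0 < c by apply: Rmin_glb_lt; lra.
have c1 : c <= 1 by apply: Rle_trans (Rmin_l _ _) _; lra.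
pose h := c * (eta / 2) ^ 2.
have h0 : 0 < h by apply: Rmult_lt_0_compat => //; apply: pow_lt; lra.
have h1 : h <= 1.
  have : (eta / 2) ^ 2 <= 1 by nra.
  have : 0 <= (eta / 2) ^ 2 by apply: pow2_ge_0.
  by rewrite /h; nra.
have thN : INR (2 ^ N) * rpow th (1 / q) = p2 (- INR N).
  rewrite -p2_nat /th p2_rpow -p2D; congr p2; field; lra.
exists eta, th, (1 + h), (1 + h * p2 (- INR N)), h; split; split => //; try lra.
- by rewrite /eta -p2_nat; have := p2N (INR N); nra.
- by rewrite -/c -/h; nra.
- by rewrite thN; lra.
Qed.

(** [A ^ k] is at least [2 ^ (h * be * T)]. A quarter of this exponent covers [lam ^ T], a quarter
    covers the factor [8], and an eighth covers [eps * mr]. *)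
Lemma bad_tail (be eps mr h lam A : R) (N T k : nat) : 0 < be -> 0 < h -> h <= 1 ->
  A = 1 + h -> lam = 1 + h * p2 (- INR N) -> be * INR T <= INR k ->
  8 * p2 (- INR N) <= be -> 12 <= h * be * INR T -> eps * mr <= h * be * INR T / 8 ->
  lam ^ T <= / 8 * p2 (- eps * mr) * A ^ k.
Proof.
move=> be0 h0 h1 -> -> hk hN hT he.
have pN := p2_gt0 (- INR N); have T0 := pos_INR T.
have x0 : 0 <= h * p2 (- INR N) by nra.
apply: (@Rle_trans _ (p2 (2 * (h * p2 (- INR N))) ^ T)).
  by apply: pow_incr; split; [lra|apply: p2_ge1p].
have hA : p2 h ^ k <= (1 + h) ^ k.
  by apply: pow_incr; split; [apply/Rlt_le/p2_gt0|apply: p2_le1p; lra].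
have e8 : / 8 = p2 (- (3)).
  have := p2N 3; have -> : p2 3 = 8 by rewrite (_ : 3 = 1 + 1 + 1) ?p2D ?p2_1; lra.
  lra.
apply: (@Rle_trans _ (/ 8 * p2 (- eps * mr) * p2 h ^ k)); last first.
  by apply: Rmult_le_compat_l => //; apply: Rmult_le_pos; [lra|apply/Rlt_le/p2_gt0].
rewrite e8 !p2_pow -!p2D; apply: p2_le.
have : h * (be * INR T) <= h * INR k by apply: Rmult_le_compat_l; lra.
have : h * INR T * (8 * p2 (- INR N)) <= h * INR T * be by apply: Rmult_le_compat_l => //; nra.
nra.
Qed.

(** Types, dyadic classes and translations take the parts [1 / 8], [1 / 4] and [1 / 8] of [be * m],
    leaving half for [epm]. The constant [6144 = 6 * 1024] makes [6 * m <= 2 ^ (be * m / 8)] follow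
    from [p2_sq]. *)
Lemma label_count (be epm : R) (b T l D m : nat) : 0 < be -> (T <= l)%N -> m = (l * D)%N ->
  log2 (INR b.+2) <= be * INR D / 8 -> 2 <= be * INR D / 8 -> 6144 <= be ^ 2 * INR m ->
  epm <= be * INR m / 2 ->
  INR (b.+2 ^ T * (3 * m) ^ 2 * (2 ^ l) ^ 2) * p2 (- be * INR m) <= / 4 * p2 (- epm).
Proof.
move=> be0 Tl mE hb hD hm he.
have mR : INR m = INR l * INR D by rewrite mE mult_INR.
have l0 := pos_INR l; have D0 := pos_INR D; have m0 := pos_INR m.
have bb : 1 <= INR b.+2 by rewrite -[1]/(INR 1); apply: le_INR; lia.
have lb0 : 0 <= log2 (INR b.+2).
  by rewrite -(log2_p2 0) p2_0; apply: log2_le; lra.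
have h1 : INR (b.+2 ^ T) <= p2 (be * INR m / 8).
  rewrite INR_expn -(p2_log2 (x := INR b.+2)); last lra.
  rewrite p2_pow; apply: p2_le; rewrite mR.
  have Tl' : INR T <= INR l by apply: le_INR; apply/leP.
  have := Rmult_le_compat _ _ _ _ lb0 (pos_INR T) hb Tl'; lra.
have h2 : INR ((2 ^ l) ^ 2) <= p2 (be * INR m / 8).
  rewrite -expnM -p2_nat; apply: p2_le; rewrite mult_INR mR (_ : INR 2 = 2) //.
  have := Rmult_le_compat_l _ _ _ l0 hD; lra.
have h3 : INR ((3 * m) ^ 2) <= / 4 * p2 (be * INR m / 4).
  have e : p2 (be * INR m / 4) = p2 (be * INR m / 8) * p2 (be * INR m / 8).
    by rewrite -p2D; congr p2; field.
  have z0 : 0 <= be * INR m / 8 by nra.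
  have h := p2_sq z0.
  have h6 : 6 * INR m <= p2 (be * INR m / 8) by apply: Rle_trans h; nra.
  rewrite e INR_expn mult_INR (_ : INR 3 = 3); last by rewrite /=; lra.
  have := Rmult_le_compat _ _ _ _ (ltac:(lra) : 0 <= 6 * INR m) (ltac:(lra) : 0 <= 6 * INR m) h6 h6.
  rewrite /=; lra.
have pz := p2_gt0 (- be * INR m).
rewrite (mult_INR (b.+2 ^ T * (3 * m) ^ 2)) (mult_INR (b.+2 ^ T)).
have p8 := p2_gt0 (be * INR m / 8); have p4 := p2_gt0 (be * INR m / 4).
have h12 := Rmult_le_compat _ _ _ _ (pos_INR _) (pos_INR _) h1 h3.
have nn : 0 <= INR (b.+2 ^ T) * INR ((3 * m) ^ 2) by apply: Rmult_le_pos; apply: pos_INR.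
have h123 := Rmult_le_compat _ _ _ _ nn (pos_INR _) h12 h2.
apply: Rle_trans (Rmult_le_compat_r _ _ _ (Rlt_le _ _ pz) h123) _.
have -> : p2 (be * INR m / 8) * (/ 4 * p2 (be * INR m / 4)) * p2 (be * INR m / 8) * p2 (- be * INR m) =
   / 4 * p2 (be * INR m / 8 + be * INR m / 4 + be * INR m / 8 + - be * INR m) by rewrite !p2D; ring.
apply: Rmult_le_compat_l; first lra.
apply: p2_le; lra.
Qed.

Lemma log2_Rpower x y : log2 (Rpower x y) = y * log2 x.
Proof. by rewrite /log2 /Rpower ln_exp; field; have := ln2_gt0; lra. Qed.

Lemma log2_rpow x y : 0 < x -> log2 (rpow x y) = y * log2 x.
Proof. by move=> h; rewrite rpow_pos // log2_Rpower. Qed.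

(** The parameters are fixed in the order [be], [b], [D], [eta] and [th], [eps], [l], where [be] is
    the unit in which all losses relative to [m] are measured. [dl < 1] puts the branching threshold
    above [1], so that thinning strictly below it leaves a child. *)
Lemma inverse_theorem_delta_lt1 (q dl : R) (D0 : nat) : 1 < q -> 0 < dl -> dl < 1 ->
  exists (eps : R) (D : nat), 0 < eps /\ (D0 <= D)%N /\
  exists L : nat, forall l : nat, (L <= l)%N ->
  forall mu nu : 'I_(2 ^ (l * D)) -> R, measure2 mu -> measure2 nu ->
  p2 (- eps * INR (l * D)) * lqnorm q mu <= lqnorm q (conv mu nu) ->
  exists (t1 t2 : 'I_(2 ^ (l * D))) (A B : {set 'I_(2 ^ (l * D))}) (R1 R2 : nat -> nat),
  let mu' := transl t1 mu in let nu' := transl t2 nu in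
  let Sc := #|[set s : 'I_l | Rleb (pow2R ((1 - dl) * INR D)) (INR (R1 s))]| in
  [/\ (forall x, x \in A -> 0 < mu' x), (forall y, y \in B -> 0 < nu' y),
      (forall x y, x \in A -> y \in A -> mu' y <= 2 * mu' x) &
      (forall x y, x \in B -> y \in B -> nu' y <= 2 * nu' x)] /\
  [/\ (forall (s : nat) a, (s < l)%N -> a \in A -> Ncount (s.+1 * D) (cap_blk (s * D) A a) = R1 s),
      (forall (s : nat) a, (s < l)%N -> a \in B -> Ncount (s.+1 * D) (cap_blk (s * D) B a) = R2 s),
      (forall x (s : nat), x \in A -> (s < l)%N -> in_half (l * D) (s * D) x) &
      (forall x (s : nat), x \in B -> (s < l)%N -> in_half (l * D) (s * D) x)] /\
  [/\ (forall s, (s < l)%N -> (0 < R1 s)%N),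
      (forall s, (s < l)%N -> R2 s = 1%N \/ p2 ((1 - dl) * INR D) <= INR (R1 s)),
      p2 (- dl * INR (l * D)) * lqnorm q mu <= lqnorm_on q mu' A &
      p2 (- dl * INR (l * D)) <= mass nu' B] /\
  (log2 (Rpower (lqnorm q nu) (- (q / (q - 1)))) - dl * INR (l * D) <= INR D * INR Sc) /\
  (INR D * INR Sc <= log2 (Rpower (lqnorm q mu) (- (q / (q - 1)))) + dl * INR (l * D)).
Proof.
move=> q1 d0 d1.
pose q' := q / (q - 1).
have q'0 : 1 < q' by apply: (Rmult_lt_reg_r (q - 1)); [lra|rewrite /q'; field_simplify; lra].
(* [C] is the size of [lossB] in units of [be * INR m]: [q'] comes from the mass of the slice, the
   last term from [low_count], and [8] covers the rest. [K] then brings the four products bounded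
   below to at most [dl / 4]. *)
pose C := 8 + q' + 2 / dl * (q + 3).
have idl : 0 < 2 / dl by apply: Rdiv_lt_0_compat; lra.
have C0 : 8 < C by rewrite /C; have := Rmult_lt_0_compat _ _ idl (ltac:(lra) : 0 < q + 3); lra.
pose K := (q' + 1) * (C + 1) + q + 3 + 2 * q'.
have K1 : 1 < K by rewrite /K; nra.
pose be := dl / (4 * K).
have beK : be * K = dl / 4 by rewrite /be; field; lra.
have be0 : 0 < be by apply: Rdiv_lt_0_compat; lra.
have be1 : be < 1 / 4 by nra.
have bq : be * (q + 3) <= dl / 4 by rewrite -beK /K; apply: Rmult_le_compat_l; nra.
have bC : q' * (be * (C + 1)) <= dl / 4 by rewrite -beK /K; nra.
have bC1 : be * C <= dl / 4 by nra.
have pp : 0 < (q' + 1) * (C + 1) by apply: Rmult_lt_0_compat; lra.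
have bq' : 2 * q' * be <= dl / 4.
  have : be * (2 * q') <= be * K by apply: Rmult_le_compat_l; [lra|rewrite /K; lra].
  lra.
(* Three levels are lost in every block of [b] levels; this makes them a share at most [be] of all
   levels. *)
have [b0 hb0] := nat_above (3 / be); pose b := b0.+1.
have hb : 3 <= be * INR b.
  have : 3 / be <= INR b by rewrite /b S_INR; lra.
  move=> h; have := Rmult_le_compat_l _ _ _ (Rlt_le _ _ be0) h.
  by rewrite (_ : be * (3 / be) = 3) //; field; lra.
have b1 : (1 <= b)%N by [].
have bb : 1 <= INR b.+2 by rewrite -[1]/(INR 1); apply: le_INR; lia.
have lb0 : 0 <= log2 (INR b.+2) by rewrite -(log2_p2 0) p2_0; apply: log2_le; lra.
(* The terms serve, in this order, to make the logarithm of [D.+1] at most [be * D], to allow only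
   [2 ^ (be * D / 8)] types per block, and to make edges and the factor [2 ^ (- N)] negligible
   against [be]. *)
have [D' hD'] := nat_above (64 / be ^ 2 + 8 / be * log2 (INR b.+2) + 32 / be).
pose D := (D0 + 4 + D')%N.
have DR : INR D' <= INR D by apply: le_INR; rewrite /D; lia.
have D4 : (4 <= D)%N by rewrite /D; lia.
have D4R : 4 <= INR D by have := le_INR _ _ (leP D4); rewrite /=; lra.
have be2 : 0 < be ^ 2 by apply: pow_lt.
have t1 : 0 < 64 / be ^ 2 by apply: Rdiv_lt_0_compat; lra.
have t3 : 0 < 32 / be by apply: Rdiv_lt_0_compat; lra.
have t2 : 0 <= 8 / be * log2 (INR b.+2).
  by apply: Rmult_le_pos => //; apply/Rlt_le/Rdiv_lt_0_compat; lra.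
have hD1 : 64 <= be ^ 2 * INR D.
  have := Rmult_le_compat_l _ _ _ (Rlt_le _ _ be2) (ltac:(lra) : 64 / be ^ 2 <= INR D).
  by rewrite (_ : be ^ 2 * (64 / be ^ 2) = 64) //; field; lra.
have hD2 : log2 (INR b.+2) <= be * INR D / 8.
  have := Rmult_le_compat_l _ _ _ (Rlt_le _ _ be0) (ltac:(lra) : 8 / be * log2 (INR b.+2) <= INR D).
  by rewrite (_ : be * (8 / be * log2 (INR b.+2)) = 8 * log2 (INR b.+2)); [lra|field; lra].
have hD3 : 32 <= be * INR D.
  have := Rmult_le_compat_l _ _ _ (Rlt_le _ _ be0) (ltac:(lra) : 32 / be <= INR D).
  by rewrite (_ : be * (32 / be) = 32) //; field; lra.
have LDle : log2 (INR D.+1) <= be * INR D.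
  rewrite -(log2_p2 (be * INR D)); apply: log2_le; first by apply: lt_0_INR; lia.
  apply: Rle_trans (p2_sq _); last lra.
  rewrite S_INR; nra.
have D2 : INR D <= INR (2 ^ D) by apply: le_INR; apply/leP/ltnW/ltn_expl.
pose N := (b * D)%N.
have N0 : 0 < INR N by apply: lt_0_INR; rewrite /N; apply/ltP; rewrite muln_gt0 b1 /=; move: D4; clear; lia.
have [eta [th [A [lam [h [[eta0 th0 hM A1 A2] [hlam h0 h1 AE lamE]]]]]]] := small_params N q1.
(* Since [INR m] is at most [2 * INR T * INR N], the first entry keeps [eps * INR m] below an eighth
   of the exponential gain from [be * INR T] bad blocks; the second is for the count of labels. *)
pose eps := Rmin (h * be / (16 * INR N)) (be / 4).
have hbe : 0 < h * be by apply: Rmult_lt_0_compat.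
have be21 : be ^ 2 <= 1 by rewrite -(pow1 2); apply: pow_incr; lra.
have eps0 : 0 < eps by apply: Rmin_glb_lt; [apply: Rdiv_lt_0_compat; lra|lra].
have eps1 : eps <= be / 4 by apply: Rmin_r.
have eps2 : eps * (16 * INR N) <= h * be.
  have := Rmult_le_compat_r (16 * INR N) _ _ ltac:(lra) (Rmin_l (h * be / (16 * INR N)) (be / 4)).
  by rewrite (_ : h * be / (16 * INR N) * (16 * INR N) = h * be) //; field; lra.
have [T0 hT0] := nat_above (12 / (h * be)).
have [L0 hL0] := nat_above (6144 / be ^ 2 + q / be + (q' + 2) / be + 3 * INR N / be).
exists eps, D; split => //; split; first by rewrite /D; lia.
exists (b * T0.+1 + L0)%N => l hl mu nu mmu mnu Hn.
set m := (l * D)%N in Hn *.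
pose T := (l %/ b)%N.
have Tl : (T * b <= l)%N by apply: leq_divM.
have lT : (l <= T * b + b)%N.
  by rewrite {1}(divn_eq l b) leq_add2l ltnW // ltn_mod.
have T01 : (T0.+1 <= T)%N.
  by rewrite leq_divRL // mulnC; apply: leq_trans hl; apply: leq_addr.
have TT : (T <= l)%N by apply: leq_div.
have mR : INR m = INR l * INR D by rewrite mult_INR.
have l0 := pos_INR l.
have lL : INR L0 <= INR l by apply: le_INR; apply/leP; apply: leq_trans hl; apply: leq_addl.
have lm : INR l <= INR m.
  by rewrite mR -[X in X <= _]Rmult_1_r; apply: Rmult_le_compat_l; lra.
have T0R : 12 <= h * be * INR T.
  have hT : INR T0 <= INR T by apply: le_INR; apply/leP/ltnW.
  have := Rmult_le_compat_l _ _ _ (Rlt_le _ _ hbe) (ltac:(lra) : 12 / (h * be) <= INR T).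
  by rewrite (_ : h * be * (12 / (h * be)) = 12) //; field; lra.
have TRp := pos_INR T.
have mTN : INR m <= 2 * (INR T * INR N).
  rewrite -!mult_INR -[2]/(INR 2) -mult_INR; apply: le_INR; apply/leP.
  rewrite !multE /m /N; have : (l <= 2 * (T * b))%N.
    by apply: leq_trans lT _; rewrite mul2n -addnn leq_add2l leq_pmull // (leq_trans _ T01).
  by move=> hh; rewrite [X in (_ <= X)%N](_ : _ = 2 * (T * b) * D)%N; [rewrite leq_mul2r hh orbT|lia].
have TNm : INR T * INR N <= INR m.
  by rewrite -mult_INR; apply: le_INR; apply/leP; rewrite multE /N mulnA leq_mul2r Tl orbT.
have u1 : 0 < 6144 / be ^ 2 by apply: Rdiv_lt_0_compat; lra.
have u2 : 0 < q / be by apply: Rdiv_lt_0_compat; lra.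
have u3 : 0 < (q' + 2) / be by apply: Rdiv_lt_0_compat; lra.
have u4 : 0 < 3 * INR N / be by apply: Rdiv_lt_0_compat; lra.
have scale c x : 0 < c -> x / c <= INR m -> x <= c * INR m.
  move=> c0 hx; have := Rmult_le_compat_l _ _ _ (Rlt_le _ _ c0) hx.
  by rewrite (_ : c * (x / c) = x) //; field; lra.
have m1 : 6144 <= be ^ 2 * INR m by apply: scale => //; lra.
have m2 : q <= be * INR m by apply: scale => //; lra.
have m3 : q' + 2 <= be * INR m by apply: scale => //; lra.
have m4 : 3 * INR N <= be * INR m by apply: scale => //; lra.
have m5 : 8 <= INR m.
  have : be ^ 2 * INR m <= 1 * INR m by apply: Rmult_le_compat_r; [apply: pos_INR|].
  lra.
have epm : eps * INR m <= h * be * INR T / 8.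
  have := Rmult_le_compat_l _ _ _ (Rlt_le _ _ eps0) mTN.
  have := Rmult_le_compat_r _ _ _ TRp eps2; lra.
have [k [hk1 hk2]] := nat_ceil (Rmult_le_pos _ _ (Rlt_le _ _ be0) TRp).
have Hedge : (T * 4 <= k.+1 * 2 ^ D)%N.
  apply/leP; apply: INR_le; rewrite !mult_INR (_ : INR 4 = 4); last by rewrite /=; lra.
  have k1 : be * INR T <= INR k.+1 by rewrite S_INR; lra.
  have : INR T * 4 <= INR T * (be * INR D) by apply: Rmult_le_compat_l; lra.
  have bT : 0 <= be * INR T by apply: Rmult_le_pos => //; lra.
  have := Rmult_le_compat _ _ _ _ bT (ltac:(lra) : 0 <= INR D) k1 D2; lra.
have hN8 : 8 * p2 (- INR N) <= be.
  have ND : INR D <= INR N.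
    by apply: le_INR; apply/leP; rewrite /N leq_pmull.
  have e : p2 (- INR N) * p2 (INR N) = 1 := p2N _.
  have : INR N <= p2 (INR N).
    by rewrite p2_nat; apply: le_INR; apply/leP/ltnW/ltn_expl.
  have := p2_gt0 (- INR N) => pn0 pN.
  have pD : p2 (- INR N) * INR D <= 1.
    by rewrite -e; apply: Rmult_le_compat_l; lra.
  have : p2 (- INR N) * 32 <= p2 (- INR N) * (be * INR D) by apply: Rmult_le_compat_l; lra.
  have : be * (p2 (- INR N) * INR D) <= be * 1 by apply: Rmult_le_compat_l; lra.
  lra.
have Hbad := bad_tail be0 h0 h1 AE lamE hk1 hN8 T0R epm.
have em : eps * INR m <= be / 4 * INR m by apply: Rmult_le_compat_r => //; apply: pos_INR.
have bm : be / 4 * INR m <= 1 / 16 * INR m by apply: Rmult_le_compat_r; lra.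
have Hm : p2 (- INR m) <= / 16 * p2 (- eps * INR m).
  have -> : / 16 = p2 (- (4)).
    have := p2N 4; have -> : p2 4 = 16 by rewrite (_ : 4 = 1 + 1 + 1 + 1) ?p2D ?p2_1; lra.
    lra.
  rewrite -p2D; apply: p2_le; lra.
have Hcount : INR (b.+2 ^ T * (3 * m) ^ 2 * (2 ^ l) ^ 2) * p2 (- be * INR m) <= / 4 * p2 (- eps * INR m).
  rewrite (_ : - eps * INR m = - (eps * INR m)); last ring.
  by apply: (label_count (D := D)) => //; lra.
have := inverse_bounds q1 d0 d1 D4 b1 Tl lT eta0 th0 hM A1 A2 hlam Hedge Hbad Hm Hcount mmu mnu Hn.
set lossA := q + _ + _ + _; set lossB := _ + 1 + 1 + _.
move=> [s1 [s2 [As [Bs [R1 [R2 /= [f1 [f2 [[g1 g2 g3 g4] [g5 g6]]]]]]]]]].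
set Sc := #|_| in g5 g6; rewrite -/m in g5 g6.
have m0 : 0 <= INR m by lra.
have LDm : INR l * log2 (INR D.+1) <= be * INR m by rewrite mR; have := Rmult_le_compat_l _ _ _ l0 LDle; lra.
have lbm : INR l <= be * INR m.
  have : INR l * 1 <= INR l * (be * INR D) by apply: Rmult_le_compat_l; lra.
  rewrite mR; lra.
have hA : lossA <= be * (q + 3) * INR m + dl / 2 * INR m.
  have el : INR l * (1 + dl / 2 * INR D) = INR l + dl / 2 * INR m by rewrite mR; ring.
  by rewrite /lossA -/m el; lra.
have hB : lossB <= be * C * INR m.
  have e1 : (be * INR m + 1) / (1 - 1 / q) = (be * INR m + 1) * q' by rewrite /q'; field; lra.
  have e2 : INR D * INR (b * (k + k) + b) <= 3 * (be * INR m).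
    have -> : INR (b * (k + k) + b) = INR b * (INR k + INR k) + INR b.
      by rewrite (plus_INR (b * (k + k))) (mult_INR b) (plus_INR k).
    have -> : INR D * (INR b * (INR k + INR k) + INR b) = INR N * (2 * INR k + 1).
      by rewrite /N mult_INR; ring.
    have : INR N * (2 * INR k + 1) <= INR N * (2 * (be * INR T) + 3) by apply: Rmult_le_compat_l; lra.
    have : be * (INR T * INR N) <= be * INR m by apply: Rmult_le_compat_l; lra.
    lra.
  have e3 : INR (3 * D) * INR T <= be * INR m.
    rewrite mult_INR (_ : INR 3 = 3); last by rewrite /=; lra.
    have eN : INR T * INR N = INR D * (INR b * INR T) by rewrite /N mult_INR; ring.
    have : 3 * (INR D * INR T) <= be * INR b * (INR D * INR T).
      by apply: Rmult_le_compat_r => //; apply: Rmult_le_pos; lra.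
    have : be * (INR D * (INR b * INR T)) <= be * INR m by rewrite -eN; apply: Rmult_le_compat_l; lra.
    lra.
  have e4 : 2 / dl * (q + be * INR m * q + INR l * log2 (INR D.+1) + INR (3 * D) * INR T) <= 2 / dl * ((q + 3) * (be * INR m)).
    by apply: Rmult_le_compat_l; lra.
  rewrite /lossB -/m e1 /C; lra.
have dm : 0 <= dl * INR m by apply: Rmult_le_pos; lra.
have hA' : lossA <= dl * INR m.
  have : be * (q + 3) * INR m <= dl / 4 * INR m by apply: Rmult_le_compat_r.
  lra.
have hB' : lossB <= dl * INR m.
  have : be * C * INR m <= dl / 4 * INR m by apply: Rmult_le_compat_r.
  lra.
exists s1, s2, As, Bs, R1, R2; rewrite /= -/m; split => //; split => //.
have ptm := measure2_pnorm_gt0 q mmu; have ptn := measure2_pnorm_gt0 q mnu.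
have q0 : 0 < 1 / q by apply: Rdiv_lt_0_compat; lra.
have q01 : 1 / q < 1 by apply: (Rmult_lt_reg_r q); [lra|field_simplify; lra].
have ScL : INR Sc <= INR l.
  by apply: le_INR; apply/leP; rewrite -[X in (_ <= X)%N](card_ord l); apply: max_card.
have logE (F : 'I_(2 ^ (l * D)) -> R) : 0 < \rsum_i rpow (F i) q ->
    log2 (Rpower (lqnorm q F) (- (q / (q - 1)))) = - log2 (\rsum_i rpow (F i) q) / (q - 1).
  by move=> hF; rewrite log2_Rpower lqnormE log2_rpow //; field; lra.
split; [split|split] => //.
- rewrite lqnormE /lqnorm_on /rsum.
  apply: (@Rle_trans _ (rpow (p2 (- lossA) * \rsum_i rpow (mu i) q) (1 / q))); last first.
    by apply: rpow_le => //; [lra|apply: Rmult_le_pos; [exact/Rlt_le/p2_gt0|lra]].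
  rewrite rpowM; [|exact/Rlt_le/p2_gt0|lra].
  apply: Rmult_le_compat_r; first exact: rpow_ge0.
  rewrite p2_rpow; apply: p2_le.
  have : lossA * (1 / q) <= dl * INR m * (1 / q) by apply: Rmult_le_compat_r; lra.
  have : dl * INR m * (1 / q) <= dl * INR m * 1 by apply: Rmult_le_compat_l; lra.
  lra.
- by apply: Rle_trans g4; apply: p2_le; lra.
- apply: (@Rle_trans _ (INR D * INR Sc)); last exact: Rle_refl.
  rewrite logE //.
  have h5 : - (lossB + 1) * q - (q - 1) * (INR D * INR Sc) <= log2 (\rsum_i rpow (nu i) q).
    by apply: p2_le_inv; rewrite p2_log2.
  have h6 : - log2 (\rsum_i rpow (nu i) q) / (q - 1) <= q' * (lossB + 1) + INR D * INR Sc.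
    apply: (Rmult_le_reg_r (q - 1)); first lra.
    have -> : - log2 (\rsum_i rpow (nu i) q) / (q - 1) * (q - 1) = - log2 (\rsum_i rpow (nu i) q) by field; lra.
    have -> : (q' * (lossB + 1) + INR D * INR Sc) * (q - 1) = q * (lossB + 1) + (q - 1) * (INR D * INR Sc) by rewrite /q'; field; lra.
    lra.
  have h7 : q' * (lossB + 1) <= q' * (be * (C + 1) * INR m) by apply: Rmult_le_compat_l; lra.
  have : q' * (be * (C + 1)) * INR m <= dl / 4 * INR m by apply: Rmult_le_compat_r.
  lra.
- apply: (@Rle_trans _ (INR D * INR Sc)); first exact: Rle_refl.
  rewrite logE //.
  set lg := - _ / _.
  have h6 : (1 - dl / 2) * INR D * INR Sc <= q' * (1 + be * INR m) + lg.
    apply: (Rmult_le_reg_r (q - 1)); first lra.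
    have -> : (q' * (1 + be * INR m) + lg) * (q - 1) = q + be * INR m * q - log2 (\rsum_i rpow (mu i) q).
      by rewrite /q' /lg; field; lra.
    by rewrite Rmult_comm; exact: g5.
  have DS : INR D * INR Sc <= INR m by rewrite mR Rmult_comm; apply: Rmult_le_compat_r; lra.
  have : q' * (1 + be * INR m) <= q' * (2 * (be * INR m)) by apply: Rmult_le_compat_l; lra.
  have : 2 * q' * be * INR m <= dl / 4 * INR m by apply: Rmult_le_compat_r.
  have : dl / 2 * (INR D * INR Sc) <= dl / 2 * INR m by apply: Rmult_le_compat_l; lra.
  lra.
Qed.

(** * Extension to all positive values of [delta] *)

Lemma lqnorm_le1 m q (mu : 'I_(2 ^ m) -> R) : 1 < q -> measure2 mu -> 0 < lqnorm q mu <= 1.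
Proof.
move=> q1 hm; have pt := measure2_pnorm_gt0 q hm; rewrite lqnormE; split; first exact: rpow_gt0.
apply: (@Rle_trans _ (rpow 1 (1 / q))); last by rewrite rpow_1l; lra.
apply: rpow_le; [by apply/Rlt_le/Rdiv_lt_0_compat; lra|lra|].
have h1 : \rsum_i mu i = 1 by rewrite -rsum_setT; exact: hm.2.
rewrite -h1; apply: rsum_le => i _.
have mi : mu i <= 1 by rewrite -h1; apply: (@rsum_ge_term _ predT mu) => // j _; apply: hm.1.
have m0 := hm.1 i.
have -> : q = (q - 1) + 1 by ring.
rewrite rpowD // rpow1 // -[X in _ <= X]Rmult_1_l; apply: Rmult_le_compat_r => //.
by apply: (@Rle_trans _ (rpow 1 (q - 1))); [apply: rpow_le; lra|rewrite rpow_1l; lra].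
Qed.

Theorem mainTheorem7 :
  forall (q delta : R) (D0 : nat),
  (1 < q) -> (0 < delta) ->
  exists (eps : R) (D : nat), (0 < eps) /\ (D0 <= D)%N /\
  exists L : nat, forall l : nat, (L <= l)%N ->
  let m := (l * D)%N in
  forall mu nu : 'I_(2 ^ m) -> R,
  measure2 mu -> measure2 nu ->
  (pow2R (- eps * INR m) * lqnorm q mu <= lqnorm q (conv mu nu)) ->
  exists (t1 t2 : 'I_(2 ^ m)),
  let mu' := transl t1 mu in
  let nu' := transl t2 nu in
  exists (A B : {set 'I_(2 ^ m)}) (R1 R2 : nat -> nat),
    (* supports *)
    (forall x, x \in A -> (0 < mu' x)) /\
    (forall y, y \in B -> (0 < nu' y)) /\
    (* (A-i) *)
    (pow2R (- delta * INR m) * lqnorm q mu <= lqnorm_on q mu' A) /\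
    (* (A-ii) *)
    (forall x y, x \in A -> y \in A -> (mu' y <= 2 * mu' x)) /\
    (* (A-iii) *)
    (forall (s : nat) (a : 'I_(2 ^ m)), (s < l)%N -> a \in A ->
       Ncount (s.+1 * D)%N (cap_blk (s * D)%N A a) = R1 s) /\
    (* (A-iv) *)
    (forall (x : 'I_(2 ^ m)) (s : nat), x \in A -> (s < l)%N -> in_half m (s * D)%N x) /\
    (* (B-i) *)
    (pow2R (- delta * INR m) <= mass nu' B) /\
    (* (B-ii) *)
    (forall x y, x \in B -> y \in B -> (nu' y <= 2 * nu' x)) /\
    (* (B-iii) *)
    (forall (s : nat) (b : 'I_(2 ^ m)), (s < l)%N -> b \in B ->
       Ncount (s.+1 * D)%N (cap_blk (s * D)%N B b) = R2 s) /\
    (* (B-iv) *)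
    (forall (y : 'I_(2 ^ m)) (s : nat), y \in B -> (s < l)%N -> in_half m (s * D)%N y) /\
    (* (v) *)
    (forall s : nat, (s < l)%N ->
       R2 s = 1%N \/ (pow2R ((1 - delta) * INR D) <= INR (R1 s))) /\
    (* (vi) *)
    (let Scard := #|[set s : 'I_l | Rleb (pow2R ((1 - delta) * INR D)) (INR (R1 s))]| in
     let q' := (q / (q - 1)) in
     (log2 (Rpower (lqnorm q nu) (- q')) - delta * INR m <= INR D * INR Scard) /\
     (INR D * INR Scard <= log2 (Rpower (lqnorm q mu) (- q')) + delta * INR m)).
Proof.
move=> q delta D0 q1 d0.
(* For [delta >= 1] the threshold is at most [1] and thinning below it is impossible, so [1 / 2]
   takes the place of [delta]. All clauses but (vi) are monotone in [delta]. *)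
have [dl [dl0 [dl1 [dld dlE]]]] : exists dl, 0 < dl /\ dl < 1 /\ dl <= delta /\ (delta = dl \/ 1 <= delta).
  case: (Rlt_le_dec delta 1) => h; first by exists delta; split => //; split => //; split; [lra|left].
  by exists (1 / 2); split; [lra|split; [lra|split; [lra|right]]].
have [eps [D [eps0 [DD0 [L hL]]]]] := inverse_theorem_delta_lt1 D0 q1 dl0 dl1.
exists eps, D; split => //; split => //; exists L => l hl m mu nu mmu mnu hn.
have [t1 [t2 [A [B [R1 [R2 /= [[a1 a2 a3 a4] [[a5 a6 a7 a8] [[a9 a10 a11 a12] [a13 a14]]]]]]]]]] :=
  hL l hl mu nu mmu mnu hn.
rewrite -/m in a7 a8 a11 a12 a13 a14 *.
have m0 : 0 <= INR m := pos_INR m.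
have D0' : 0 <= INR D := pos_INR D.
have mon : p2 (- delta * INR m) <= p2 (- dl * INR m).
  by apply: p2_le; have := Rmult_le_compat_r _ _ _ m0 dld; lra.
have monD : p2 ((1 - delta) * INR D) <= p2 ((1 - dl) * INR D).
  by apply: p2_le; have := Rmult_le_compat_r _ _ _ D0' dld; lra.
have [lq0 lq1] := lqnorm_le1 q1 mmu.
exists t1, t2, A, B, R1, R2.
split; first exact: a1.
split; first exact: a2.
split; first by apply: Rle_trans a11; apply: Rmult_le_compat_r; [lra|exact: mon].
split; first exact: a3.
split; first exact: a5.
split; first exact: a7.
split; first exact: Rle_trans mon a12.
split; first exact: a4.
split; first exact: a6.
split; first exact: a8.
split; first by move=> s /a10 [h|h]; [left|right; apply: Rle_trans monD h].
case: dlE => [e|d1]; first by subst dl; split; [exact: a13|exact: a14].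
(* As every [R1 s] is at least [1], all levels belong to the set and [D] times its size is [m]. The
   lower bound of (vi) follows from the one for [dl], the upper one from [lqnorm q mu <= 1]. *)
have full : #|[set s : 'I_l | Rleb (pow2R ((1 - delta) * INR D)) (INR (R1 s))]| = l.
  rewrite -[RHS](card_ord l) -cardsT; congr #|pred_of_set _|; apply/setP => s; rewrite !inE.
  rewrite /Rleb; case: Rle_dec => // h; case: h.
  apply: (@Rle_trans _ 1); first by rewrite -[X in _ <= X]p2_0; apply: p2_le; have := Rmult_le_compat_r _ _ _ D0' d1; lra.
  by rewrite -[1]/(INR 1); apply: le_INR; apply/leP/a9.
rewrite full /=; have mE : INR D * INR l = INR m by rewrite -mult_INR multE mulnC.
rewrite mE; set Sc := #|_| in a13.
have ScL : INR Sc <= INR l.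
  by apply: le_INR; apply/leP; rewrite -[X in (_ <= X)%N](card_ord l); apply: max_card.
have dm := Rmult_le_compat_r _ _ _ m0 dld; have dm1 := Rmult_le_compat_r _ _ _ m0 d1.
split.
  have := Rmult_le_compat_l _ _ _ D0' ScL; rewrite mE; lra.
rewrite log2_Rpower.
have lg : log2 (lqnorm q mu) <= 0 by rewrite -[X in _ <= X](log2_p2 0) p2_0; apply: log2_le.
have q'0 : 0 < q / (q - 1) by apply: Rdiv_lt_0_compat; lra.
have : 0 <= q / (q - 1) * - log2 (lqnorm q mu) by apply: Rmult_le_pos; lra.
lra.
Qed.
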